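(* The set of even points of $X$ has positive (Dirichlet) density.
   Context: Let $\mathbb{F}_q$ be a finite field of odd characteristic and let $K$ be a global function field, i.e. an algebraic function field of one variable over $\mathbb{F}_q$. Let $X$ be the set of (closed) points (places) of $K$, viewed as a smooth complete curve. Write $[\mathfrak{p}]$ for the class of the divisor $\mathfrak{p}$ in the Picard group $\operatorname{Pic}X$. A point $\mathfrak{p}$ is called even if $[\mathfrak{p}]\in 2\operatorname{Pic}X$. Density of a set of points is meant in the sense of the Chebotarev density theorem (Dirichlet density). *)

(* Defs.v *)
From HB Require Import structures.
From mathcomp Require Import all_boot all_order all_algebra finmap.
From mathcomp Require Import all_classical all_reals all_analysis.
From mathcomp.multinomials Require Import freeg.

Set Implicit Arguments.
Unset Strict Implicit.
Unset Printing Implicit Defensive.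

Import Order.TTheory GRing.Theory Num.Theory.
Import numFieldNormedType.Exports.

Local Open Scope classical_set_scope.
Local Open Scope ring_scope.
Local Open Scope quotient_scope.

Section FunctionField.
Variables (F : finFieldType) (K : fieldType) (iota : {rmorphism F -> K}).

(* K is a finite extension of F(x) for some x transcendental over F: the
   finite family b spans K over F(x), whose elements are the fractions
   p(x) / q(x) with q != 0.  F need not be the full constant field of K. *)
Definition function_field : Prop :=
  exists x : K, ~ algebraicOver iota x /\
  exists (n : nat) (b : 'I_n -> K), forall y : K,
  exists p q : 'I_n -> {poly F}, (forall i, q i != 0) /\
    y = \sum_(i < n) (map_poly iota (p i)).[x] / (map_poly iota (q i)).[x] * b i.

(* A closed point is given by its normalized (surjective onto Z) discrete
   valuation on K, trivial on F.  The valuation of 0 should be +oo; ord 0 = 0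
   is a convention which makes the valuation determine the function ord. *)
Record place := Place {
  ord :> K -> int;
  ord0 : ord 0 = 0;
  ordM : forall x y, x != 0 -> y != 0 -> ord (x * y) = ord x + ord y;
  ordD : forall x y, x != 0 -> y != 0 -> x + y != 0 ->
    Num.min (ord x) (ord y) <= ord (x + y);
  ord_const : forall a : F, a != 0 -> ord (iota a) = 0;
  ord_uniformizer : exists2 t, t != 0 & ord t = 1
}.

HB.instance Definition _ := gen_eqMixin place.
HB.instance Definition _ := gen_choiceMixin place.

Lemma ord1 (p : place) : p 1 = 0.
Proof.
by apply: (@addrI _ (p 1)); rewrite addr0 -ordM ?oner_eq0 ?mulr1.
Qed.

Lemma ordN (p : place) x : p (- x) = p x.
Proof.
have [->|x0] := eqVneq x 0; first by rewrite oppr0.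
suff pN1 : p (-1) = 0 by rewrite -mulN1r ordM ?oppr_eq0 ?oner_eq0// pN1 add0r.
have : p (-1) *+ 2 = 0.
  by rewrite mulr2n -ordM ?oppr_eq0 ?oner_eq0// mulrNN mulr1 ord1.
by move/eqP; rewrite mulrn_eq0 /= => /eqP.
Qed.

Lemma ordV (p : place) x : x != 0 -> p x^-1 = - p x.
Proof.
by move=> x0; apply: (@addrI _ (p x)); rewrite -ordM ?invr_eq0// divff// ord1 subrr.
Qed.

(* By the convention ord 0 = 0, this contains 0. *)
Definition valuation_ring (p : place) : {pred K} := fun x => 0 <= p x.

Lemma valuation_ring_closed (p : place) : subring_closed (valuation_ring p).
Proof.
split; rewrite /in_mem/= /valuation_ring.
- by rewrite ord1.
- move=> x y px py.
  have [->|x0] := eqVneq x 0; first by rewrite sub0r /in_mem/= ordN.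
  have [->|y0] := eqVneq y 0; first by rewrite subr0.
  have [->|xy0] := eqVneq (x - y) 0; first by rewrite /in_mem/= ord0.
  apply: le_trans (ordD p x0 _ xy0); last by rewrite oppr_eq0.
  by rewrite le_min ordN; apply/andP.
- move=> x y px py.
  have [->|x0] := eqVneq x 0; first by rewrite mul0r /in_mem/= ord0.
  have [->|y0] := eqVneq y 0; first by rewrite mulr0 /in_mem/= ord0.
  by rewrite /in_mem/= ordM//; apply: addr_ge0.
Qed.

HB.instance Definition _ (p : place) :=
  GRing.isSubringClosed.Build K (valuation_ring p) (valuation_ring_closed p).

Definition local_ring (p : place) := {x : K | x \in valuation_ring p}.

HB.instance Definition _ (p : place) := Choice.on (local_ring p).
HB.instance Definition _ (p : place) := SubType.on (local_ring p).
HB.instance Definition _ (p : place) :=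
  [SubChoice_isSubComNzRing of local_ring p by <:].

Definition maximal_ideal (p : place) : {pred local_ring p} :=
  fun x => (val x == 0) || (0 < p (val x)).

Lemma maximal_ideal_closed (p : place) : idealr_closed (@maximal_ideal p).
Proof.
split; rewrite -?topredE/= /maximal_ideal.
- by rewrite rmorph0 eqxx.
- by rewrite rmorph1 oner_eq0 ord1.
move=> a u v; rewrite -!topredE /= /maximal_ideal => mu mv.
have pa : 0 <= p (sval a) := valP a.
have mau : (sval a * sval u == 0) || (0 < p (sval a * sval u)).
  have [->|a0] := eqVneq (sval a) 0; first by rewrite mul0r eqxx.
  case/orP: mu => [/eqP->|pu]; first by rewrite mulr0 eqxx.
  have [->|u0] := eqVneq (sval u) 0; first by rewrite mulr0 eqxx.
  by rewrite ordM// ltr_wpDl ?orbT.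
have [->|s0] := eqVneq (sval a * sval u + sval v) 0; first by [].
have [au0|au0] := eqVneq (sval a * sval u) 0.
  move: s0; rewrite au0 add0r => v0.
  by move: mv; rewrite (negbTE v0).
have [v0|v0] := eqVneq (sval v) 0.
  by rewrite v0 addr0; move: mau; rewrite (negbTE au0).
apply: (lt_le_trans _ (ordD p au0 v0 s0)).
by move: mau mv; rewrite (negbTE au0) (negbTE v0) lt_min => /= -> ->.
Qed.

HB.instance Definition _ (p : place) :=
  isIdealr.Build (local_ring p) (@maximal_ideal p) (maximal_ideal_closed p).

Definition residue_field (p : place) := {ideal_quot (@maximal_ideal p)}.

(* The number of elements of the residue field, which is finite when K is a
   function field over F. *)
Definition place_norm (p : place) : nat := #|` fset_set [set: residue_field p]|.

Definition divisor := {freeg place / int}.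

Definition principal : {pred divisor} :=
  fun D => `[< exists2 f : K, f != 0 & forall p : place, coeff p D = p f >].

Lemma principal_closed : zmod_closed principal.
Proof.
split; first by apply/asboolP; exists 1 => [|p]; rewrite ?oner_eq0// coeff0 ord1.
move=> D E /asboolP[f f0 Df] /asboolP[g g0 Eg]; apply/asboolP.
exists (f / g) => [|p]; first by rewrite mulf_neq0 ?invr_eq0.
by rewrite coeffB Df Eg ordM ?invr_eq0// ordV.
Qed.

HB.instance Definition _ := GRing.isZmodClosed.Build divisor principal principal_closed.

Definition Pic := {ideal_quot principal}.

Definition divisor_class (D : divisor) : Pic := \pi_Pic D.

Definition even_place (p : place) : Prop :=
  exists c : Pic, divisor_class (<< p >> : divisor) = c *+ 2.

Definition dirichlet_sum (R : realType) (S : set place) (s : R) : \bar R :=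
  (\esum_(p in S) ((place_norm p)%:R `^ (- s))%:E)%E.

(* For s > 1 both sums are finite when K is a function field over F. *)
Definition has_dirichlet_density (R : realType) (S : set place) (d : R) : Prop :=
  fine (dirichlet_sum S s) / fine (dirichlet_sum setT s) @[s --> (1 : R)^'+] --> d.

End FunctionField.

(* Main.v *)
(** A point is even iff every quadratic character chi of Pic X is trivial on it.
    The set of these characters is a finite group G, so by orthogonality the
    indicator function of the even points is the average of chi(p) over G, and
    the density is 1/|G| once [sum_p chi(p) N(p)^-s] is seen to diverge as s
    tends to 1 for the trivial character and to stay bounded for the others.

    Let d be the positive generator of the group of degrees of divisors, let
    Q = q^d and t = Q^-s.  Riemann's theorem, [ell A = deg A - g] for deg A large,
    shows that all classes of degree kd contain the same number of effective
    divisors, which is affine in Q^k for k large.  Hence the coefficients of the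
    zeta function Z(t) and of L(t, chi) satisfy eventual linear recurrences, with
    characteristic roots 1, Q for Z and -1, -Q for nontrivial chi.  In particular Z
    has a simple pole at t = 1/Q and L(t, chi) is bounded near 1/Q.

    L(t, chi) does not tend to zero at 1/Q: the power series Z(t) L(t, chi) has
    nonnegative coefficients by its Euler product; its coefficient of t^2k is at
    least that of t^k in Z(t), hence unbounded in k, and by the recurrence it then
    grows like Q^2k.  So Z(t) L(t, chi) still has a pole at 1/Q.  Up to a bounded
    error, log L(t, chi) is [sum_p chi(p) N(p)^-s]. *)

From HB Require Import structures.
From mathcomp Require Import all_boot all_order all_algebra finmap.
From mathcomp Require Import all_classical all_reals all_analysis.
From mathcomp.multinomials Require Import freeg.
From mathcomp Require Import zify ring lra.
Require Import Defs.

Set Implicit Arguments.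
Unset Strict Implicit.
Unset Printing Implicit Defensive.

Import Order.TTheory GRing.Theory Num.Theory.
Import numFieldNormedType.Exports.

Local Open Scope classical_set_scope.
Local Open Scope ring_scope.

(** * Places of a function field *)

(** Places are bare valuations on [K], so divisor theory has to be produced from the finite span
    over [F(x)]. It has two sources: a Zorn argument gives every transcendental element a pole, and
    a pigeonhole count of coefficient vectors over the finite field bounds the zeros of an element.
    That principal divisors have degree 0 is a consequence of the boundedness of [deg A - ell A],
    not an input to it.

    The recurrence for a nontrivial character needs no case distinction. Such a [chi] takes the
    value -1 on some divisor of degree [d], and translation by this divisor yields the roots -1 and
    -Q whether [chi] is nontrivial on classes of degree 0 or factors through the degree.

    Infinite products are never formed. The Euler product is used as an identity
    [k a_k = sum_m lam_m a_(k-m)] between coefficients, the coefficient form of the logarithmic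
    derivative. Positivity and the comparison with [Z(t^2)] follow from it by induction on [k], and
    the exponential formula by a differential equation. *)

Section Evaluation.
Variables (F : finFieldType) (K : fieldType) (iota : {rmorphism F -> K}).

Definition ev (z : K) : {poly F} -> K :=
  horner_morph (fun a => mulrC z (iota a)).

HB.instance Definition _ z := GRing.RMorphism.on (ev z).

Lemma evE z p : ev z p = (map_poly iota p).[z].
Proof. by []. Qed.

Lemma evC z a : ev z a%:P = iota a.
Proof. exact: horner_morphC. Qed.

Lemma evX z : ev z 'X = z.
Proof. exact: horner_morphX. Qed.

Lemma ev_comp z f p : ev z (p \Po f) = ev (ev z f) p.
Proof. by rewrite !evE map_comp_poly horner_comp. Qed.

Lemma transcendental_ev_neq0 z p : ~ algebraicOver iota z -> p != 0 -> ev z p != 0.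
Proof. by move=> tz p0; apply/eqP => pz; apply: tz; exists p => //; apply/rootP. Qed.

(* For [y] transcendental this says [[K : F(y)] <= N]. *)
Definition fin_over (y : K) (N : nat) : Prop := forall w : 'I_N.+1 -> K,
  exists c : 'I_N.+1 -> {poly F},
    (exists j, c j != 0) /\ \sum_j ev y (c j) * w j = 0.

End Evaluation.

(** * Finiteness of [K] over subfields generated by one element *)

Section Dependence.
Variables (F : finFieldType) (K : fieldType) (iota : {rmorphism F -> K}).
Variables (x : K) (n : nat) (b : 'I_n -> K).
Hypothesis x_trans : ~ algebraicOver iota x.
Hypothesis b_span : forall y : K,
  exists p q : 'I_n -> {poly F}, (forall i, q i != 0) /\
    y = \sum_(i < n) ev iota x (p i) / ev iota x (q i) * b i.

Lemma common_denominator (J : finType) (w : J -> K) :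
  exists (d : {poly F}) (g : J -> 'I_n -> {poly F}), d != 0 /\
    forall j, ev iota x d * w j = \sum_i ev iota x (g j i) * b i.
Proof.
have [p /choice[q pq]] := choice (fun j => b_span (w j)).
exists (\prod_j \prod_i q j i).
exists (fun j i => p j i * ((\prod_(j' | j' != j) \prod_i q j' i) * \prod_(i' | i' != i) q j i')).
split.
  by apply/prodf_neq0 => j _; apply/prodf_neq0 => i _; have [] := pq j.
move=> j; have [q0 wE] := pq j.
rewrite [in LHS]wE mulr_sumr; apply: eq_bigr => i _.
rewrite (bigD1 j)//= (bigD1 i)//= !rmorphM /=.
have : ev iota x (q j i) != 0 by exact: transcendental_ev_neq0.
move=> qx; field.
exact: qx.
Qed.

(** Linear algebra by counting: with more unknown coefficients than conditions, two coefficient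
    vectors over the finite field have the same image, and their difference is a nontrivial
    relation. *)
Lemma fin_over_poly (f : {poly F}) : (1 < size f)%N ->
  fin_over iota (ev iota x f) (n * (size f).-1)%N.
Proof.
move=> sf w; set d := (size f).-1.
have [D [g [D0 Dg]]] := common_denominator w.
pose M := (\max_j \max_i size (g j i))%N.
(* The unknowns have [N * L = n * d * L + L] coefficients and their images [n * (d * L + M)]; the
   choice [L > n * M] makes the first number the larger one. *)
pose L := (n * M).+1.
pose N := (n * d).+1.
pose T := {ffun 'I_N -> 'rV[F]_L}.
pose T' := {ffun 'I_n -> 'rV[F]_(d * L + M)}.
pose P (c : T) i := \sum_j ((rVpoly (c j)) \Po f) * g j i.
have sP c i : (size (P c i) <= d * L + M)%N.
  apply: (leq_trans (size_sum _ _ _)); apply/bigmax_leqP => j _.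
  apply: (leq_trans (size_polyMleq _ _)).
  have h1 : (size (g j i) <= M)%N.
    apply: leq_trans (leq_bigmax j); exact: (leq_bigmax i).
  have h2 := size_comp_poly_leq (rVpoly (c j)) f.
  have h3 : (size (rVpoly (c j)) <= L)%N by exact: size_poly.
  have h4 : ((size (rVpoly (c j))).-1 * d <= n * M * d)%N.
    by rewrite leq_mul2r; apply/orP; right; move: h3; rewrite /L; case: (size _).
  rewrite -/d in h2; rewrite /L mulnS (mulnC d).
  rewrite -subn1 leq_subLR (leq_trans (leq_add h2 h1))// addSn add1n ltnS leq_add2r.
  by rewrite (leq_trans h4)// leq_addl.
pose Phi (c : T) : T' := [ffun i => poly_rV (P c i)].
have /injectivePn [c1 [c2 c12 Phi12]] : ~~ injectiveb Phi.
  apply/negP => /injectiveP /leq_card.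
  rewrite !card_ffun !card_mx !card_ord !mul1n leqNgt.
  rewrite -!expnM ltn_exp2l ?card_finNzRing_gt1// => /negP; apply.
  by rewrite /N /L; clear; nia.
have P12 i : P c1 i = P c2 i.
  by rewrite -[LHS](poly_rV_K (sP c1 i)) -[RHS](poly_rV_K (sP c2 i));
     have := congr1 (fun h : T' => rVpoly (h i)) Phi12; rewrite !ffunE.
exists (fun j => rVpoly (c1 j) - rVpoly (c2 j)); split.
  have [j c12j] : exists j, c1 j != c2 j.
    apply/existsP; apply: contraNT c12; rewrite negb_exists => /forallP e.
    by apply/eqP/ffunP => j; exact/eqP/negPn/e.
  exists j; rewrite -linearB /=.
  by apply: contra_neq c12j => e; apply/eqP; rewrite -subr_eq0 -[_ - _]rVpolyK e linear0.
have Dx : ev iota x D != 0 by exact: transcendental_ev_neq0.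
apply: (mulfI Dx); rewrite mulr0 mulr_sumr.
transitivity (\sum_i ev iota x (P c1 i - P c2 i) * b i); last first.
  by rewrite big1// => i _; rewrite P12 subrr rmorph0 mul0r.
under eq_bigr => j _ do rewrite mulrCA Dg mulr_sumr.
rewrite exchange_big /=; apply: eq_bigr => i _.
rewrite /P -sumrB rmorph_sum /= mulr_suml; apply: eq_bigr => j _.
by rewrite -ev_comp comp_polyB -mulrBl [in RHS]rmorphM mulrA.
Qed.

End Dependence.

Section FinOver.
Variables (F : finFieldType) (K : fieldType) (iota : {rmorphism F -> K}).
Variables (y : K) (N : nat).
Hypotheses (y0 : y != 0) (finy : fin_over iota y N).

(** Reversing all coefficient lists over a common length [L] changes the value at [y] into the value
    at [y^-1], up to the factor [y ^+ L.-1]. *)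
Lemma fin_over_inv : fin_over iota y^-1 N.
Proof.
move=> w; have [c [[j cj] cw]] := finy w.
pose L := (\max_j size (c j))%N.
have sL k : (size (c k) <= L)%N by exact: (leq_bigmax k).
pose r (p : {poly F}) := \poly_(i < L) p`_(L.-1 - i).
exists (fun k => r (c k)); split.
  exists j; apply: contra_neq cj => rj.
  apply/polyP => i; rewrite coef0.
  have [iL|Li] := ltnP i L; last by rewrite nth_default// (leq_trans (sL j)).
  have := congr1 (fun p : {poly F} => p`_(L.-1 - i)) rj.
  rewrite coef0 coef_poly subKn; last lia.
  by rewrite ifT//; lia.
have rE (p : {poly F}) : (size p <= L)%N -> ev iota y^-1 (r p) * y ^+ L.-1 = ev iota y p.
  move=> pL; rewrite !evE.
  have -> : map_poly iota (r p) = \poly_(i < L) iota p`_(L.-1 - i).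
    by apply/polyP => i; rewrite /r coef_map /= !coef_poly; case: ifP => // _; rewrite rmorph0.
  rewrite horner_poly (@horner_coef_wide _ L); last by rewrite size_map_poly.
  rewrite mulr_suml [RHS](reindex_inj rev_ord_inj) /=.
  apply: eq_bigr => i _; rewrite coef_map /= exprVn -mulrA.
  have -> : (L.-1 - i = L - i.+1)%N by have := ltn_ord i; lia.
  congr (_ * _); apply: (mulfI (expf_neq0 i y0)); rewrite mulrA mulfV ?expf_neq0//.
  by rewrite mul1r -exprD; congr (_ ^+ _); have := ltn_ord i; lia.
apply: (mulIf (expf_neq0 L.-1 y0)); rewrite mul0r mulr_suml -[RHS]cw.
by apply: eq_bigr => k _; rewrite mulrAC rE.
Qed.

(** As long as all constant terms vanish, the relation can be divided by [y], which lowers the total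
    size of its coefficients. *)
Lemma fin_over_reduced (w : 'I_N.+1 -> K) :
  exists c : 'I_N.+1 -> {poly F},
    (exists j, (c j)`_0 != 0) /\ \sum_j ev iota y (c j) * w j = 0.
Proof.
have [c] := finy w; move: {2}(\sum_j size (c j))%N (leqnn (\sum_j size (c j))) => m.
elim: m c => [|m IHm] c sc [[j cj] cw].
  move: sc; rewrite leqn0 sum_nat_eq0 => /forallP /(_ j) /=.
  by rewrite size_poly_eq0 (negbTE cj).
have [/existsP[i ci]|] := boolP [exists i, (c i)`_0 != 0]; first by exists c; split; [exists i|].
rewrite negb_exists => /forallP c0.
have cX i : c i = (\poly_(k < (size (c i)).-1) (c i)`_k.+1) * 'X.
  apply/polyP => -[|k]; rewrite coefMX /=; first exact/eqP/negbNE/c0.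
  rewrite coef_poly; case: ltnP => // h; rewrite nth_default//.
  by move: h; case: (size _).
pose c' i := \poly_(k < (size (c i)).-1) (c i)`_k.+1.
have c'j : c' j != 0 by apply: contra_neq cj => e; rewrite cX -/(c' j) e mul0r.
apply: (IHm c'); last split; first last.
- apply: (mulfI y0); rewrite mulr0 mulr_sumr -[RHS]cw; apply: eq_bigr => i _.
  by rewrite [in RHS]cX rmorphM /= evX mulrA [y * _]mulrC.
- by exists j.
rewrite -ltnS; apply: leq_trans sc; rewrite (bigD1 j)//= [ltnRHS](bigD1 j)//=.
have lec i : (size (c' i) <= size (c i))%N.
  by apply: (leq_trans (size_poly _ _)); exact: leq_pred.
rewrite -addSn; apply: leq_add; last exact: leq_sum.
apply: (@leq_ltn_trans (size (c j)).-1); first exact: size_poly.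
by rewrite prednK// lt0n size_poly_eq0.
Qed.

(** Modulo [y O] only the constant terms of a reduced relation survive, and they give a relation
    over [F]. *)
Lemma fin_over_residues (O : set K) (w : 'I_N.+1 -> K) :
  (forall a, O (iota a)) -> (forall u v, O u -> O v -> O (u + v)) ->
  (forall u v, O u -> O v -> O (u * v)) -> O y -> (forall j, O (w j)) ->
  exists a : 'I_N.+1 -> F, (exists j, a j != 0) /\
    exists2 z, O z & \sum_j iota (a j) * w j = y * z.
Proof.
move=> OF OD OM Oy Ow; have [c [c0 cw]] := fin_over_reduced w.
exists (fun j => (c j)`_0); split => //.
have O0 : O 0 by rewrite -(rmorph0 iota).
have OS m (u : 'I_m -> K) : (forall i, O (u i)) -> O (\sum_i u i).
  by move=> Ou; apply: (big_ind O).
have Oev p : O (ev iota y p).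
  elim/poly_ind: p => [|p a Op]; first by rewrite rmorph0.
  by rewrite rmorphD rmorphM /= evX evC; apply: (OD) => //; apply: OM.
have cE j : c j = (\poly_(k < (size (c j)).-1) (c j)`_k.+1) * 'X + ((c j)`_0)%:P.
  apply/polyP => -[|k]; rewrite coefD coefMX coefC /= ?add0r// addr0.
  rewrite coef_poly; case: ltnP => // h; rewrite nth_default//.
  by move: h; case: (size _).
exists (- \sum_j ev iota y (\poly_(k < (size (c j)).-1) (c j)`_k.+1) * w j).
  rewrite -mulN1r -(rmorph1 iota) -rmorphN; apply: (OM) => //.
  by apply: OS => j; apply: OM.
rewrite mulrN mulr_sumr; apply/eqP; rewrite -addr_eq0 -big_split /= -[X in _ == X]cw.
apply/eqP/eq_bigr => j _; rewrite [in RHS]cE rmorphD rmorphM /= evX evC mulrDl addrC.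
by congr (_ + _); rewrite mulrCA mulrA; congr (_ * _); rewrite mulrC.
Qed.

End FinOver.

(** * Discreteness of a valuation ring *)

Section ValuationRing.
Variables (F : finFieldType) (K : fieldType) (iota : {rmorphism F -> K}).
Variable O : set K.
Hypothesis OF : forall a, O (iota a).
Hypothesis OD : forall u v, O u -> O v -> O (u + v).
Hypothesis OM : forall u v, O u -> O v -> O (u * v).
Hypothesis O_total : forall z, O z \/ O z^-1.

Let O0 : O 0. Proof. by rewrite -(rmorph0 iota). Qed.
Let O1 : O 1. Proof. by rewrite -(rmorph1 iota). Qed.
Let ON u : O u -> O (- u).
Proof. by move=> Ou; rewrite -mulN1r -(rmorph1 iota) -rmorphN; apply: OM. Qed.
Let OX u k : O u -> O (u ^+ k).
Proof. by move=> Ou; elim: k => [|k IH]; rewrite ?expr0// exprS; apply: OM. Qed.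

(** The ideal of nonunits. The case [z = 0] is listed separately because [0^-1 = 0] lies in [O]. *)
Let m (z : K) : Prop := z = 0 \/ ~ O z^-1.

Let mO z : m z -> O z.
Proof. by case=> [->//|nz]; case: (O_total z). Qed.

Let m1 : ~ m 1.
Proof. by case=> [/eqP|]; [rewrite oner_eq0|rewrite invr1]. Qed.

Let mF a : a != 0 -> ~ m (iota a).
Proof.
by move=> a0 []; [move/eqP; rewrite fmorph_eq0 (negbTE a0)|rewrite -fmorphV; apply].
Qed.

Let mM u z : O u -> m z -> m (u * z).
Proof.
move=> Ou [->|nz]; first by left; rewrite mulr0.
have [->|u0] := eqVneq u 0; first by left; rewrite mul0r.
by right; rewrite invfM => h; apply: nz; rewrite -[z^-1](mulVKf u0); apply: OM.
Qed.

Let mD u v : m u -> m v -> m (u + v).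
Proof.
wlog : u v / O (u / v).
  move=> H mu mv; case: (O_total (u / v)) => [h|]; first exact: H.
  by rewrite invf_div addrC => h; apply: H.
move=> Ouv mu mv; have [v0|v0] := eqVneq v 0; first by rewrite v0 addr0.
have -> : u + v = (u / v + 1) * v by rewrite mulrDl mul1r divfK.
by apply: mM => //; apply: OD.
Qed.

Let mN u : m u -> m (- u).
Proof. by move=> mu; rewrite -mulN1r; apply: mM => //; apply: ON. Qed.

Let mX t k : m t -> (0 < k)%N -> m (t ^+ k).
Proof.
by case: k => // k mt _; rewrite exprSr; apply: mM => //; apply: OX; exact: mO.
Qed.

Let m_sum (I : finType) (P : pred I) (f : I -> K) :
  (forall i, P i -> m (f i)) -> m (\sum_(i | P i) f i).
Proof. by move=> mf; apply: (big_ind m) => //; left. Qed.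

Variables (y : K) (N : nat).
Hypotheses (y0 : y != 0) (Oy : O y) (my : ~ O y^-1) (finy : fin_over iota y N).

(** The powers [1, t, ..., t^N] are dependent modulo [y]. If [t^(N+1)] divided [y], every other term
    of the dependence would be divisible by a higher power of [t] than the lowest one, and a nonzero
    constant would lie in [m]. *)
Let divisor_exponent t k : t != 0 -> m t -> O (y / t ^+ k) -> (k <= N)%N.
Proof.
move=> t0 mt Oyt; rewrite leqNgt; apply/negP => Nk.
have OyN : O (y / t ^+ N.+1).
  have -> : y / t ^+ N.+1 = y / t ^+ k * t ^+ (k - N.+1).
    have -> : t ^+ k = t ^+ (k - N.+1) * t ^+ N.+1 by rewrite -exprD subnK.
    have tk : t ^+ (k - N.+1) != 0 by rewrite expf_neq0.
    by rewrite invfM -!mulrA; congr (_ * _); rewrite mulrCA mulVf// mulr1.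
  by apply: OM => //; apply: OX; apply: mO.
have [a [[j aj] [z Oz az]]] := fin_over_residues y0 finy (w := fun j => t ^+ j)
  OF OD OM Oy (fun j => OX j (mO mt)).
case: (@arg_minnP _ j (fun i => a i != 0) (fun i => nat_of_ord i) aj) => i ai imin.
apply: (mF ai).
have ti : t ^+ i != 0 by rewrite expf_neq0.
have -> : iota (a i) = (y / t ^+ N.+1) * z * t ^+ (N.+1 - i)
    - \sum_(l | l != i) iota (a l) * t ^+ (l - i).
  apply: (mulIf ti); rewrite mulrBl -[_ * t ^+ (N.+1 - i) * _]mulrA -exprD subnK; last exact: ltnW.
  rewrite mulrAC mulfVK ?expf_neq0// -az (bigD1 i)//= mulr_suml.
  apply/eqP; rewrite eq_sym subr_eq; apply/eqP; congr (_ + _).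
  apply: eq_bigr => l li; have [->|al] := eqVneq (a l) 0; first by rewrite rmorph0 !mul0r.
  by rewrite -mulrA -exprD subnK// imin.
apply: mD; last apply: mN.
  apply: mM; first exact: OM.
  by apply: mX => //; rewrite subn_gt0 ltn_ord.
apply: m_sum => l li; have [->|al] := eqVneq (a l) 0; first by left; rewrite rmorph0 mul0r.
apply: mM => //; have il : (i < l)%N.
  by rewrite ltn_neqAle imin// andbT; apply: contraNneq li => /val_inj ->.
by apply: mX => //; rewrite subn_gt0.
Qed.

(** Take [t] in [m] with the largest [k] such that [t^k] divides [y]. If [t] did not generate [m],
    it would be a product of two elements of [m]; the square of one of them divides [t], so its
    power [2 k] divides [y]. *)
Lemma uniformizer_exists : exists t, [/\ t != 0, m t & forall s, m s -> O (s / t)].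
Proof.
pose P k := `[< exists t, [/\ t != 0, m t & O (y / t ^+ k)] >].
have ub k : P k -> (k <= N)%N by move=> /asboolP[t [t0 mt]]; exact: divisor_exponent.
have P1 : P 1%N by apply/asboolP; exists y; split; rewrite ?expr1 ?divff//; right.
have exP : exists k, P k by exists 1%N.
case: (ex_maxnP exP ub) => k /asboolP[t [t0 mt Ok]] kmax.
have k0 := kmax _ P1.
exists t; split => // s ms; apply/not_notP => ns.
have s0 : s != 0 by apply/eqP => s0; apply: ns; rewrite s0 mul0r.
pose r := t / s.
have r0 : r != 0 by rewrite mulf_neq0 ?invr_eq0.
have mr : m r by right; rewrite invf_div.
have trs : t = r * s by rewrite divfK.
have key u v : u != 0 -> v != 0 -> m u -> t = u * v -> O (v / u) -> False.
  move=> u0 v0 mu tuv Ovu.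
  suff : P (2 * k)%N by move/kmax; move: k0; clear; lia.
  apply/asboolP; exists u; split => //.
  have -> : y / u ^+ (2 * k) = y / t ^+ k * (v / u) ^+ k.
    have uk : u ^+ k != 0 by rewrite expf_neq0.
    have vk : v ^+ k != 0 by rewrite expf_neq0.
    rewrite tuv mul2n -addnn exprD !expr_div_n !exprMn; field.
    by rewrite uk vk.
  by apply: OM => //; apply: OX.
case: (O_total (s / r)) => [|]; first exact: (key r s).
by rewrite invf_div; apply: (key s r) => //; rewrite mulrC.
Qed.

(** Otherwise every power of [t] divides [z]. A relation between the powers of [z] over [F[y]] makes
    its first nonzero coefficient [c(y)] a multiple of [z]; but [y] is a unit times a power of [t],
    hence so is [c(y)], a contradiction. *)
Lemma unit_part z t : z != 0 -> O z -> t != 0 -> m t -> (forall s, m s -> O (s / t)) ->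
  exists2 k : nat, O (z / t ^+ k) & ~ m (z / t ^+ k).
Proof.
move=> z0 Oz t0 mt tgen; apply/not_notP => nk.
have tO (s : K) : O s -> (forall k, O (s / t ^+ k) -> m (s / t ^+ k)) -> forall k, O (s / t ^+ k).
  move=> Os H; elim=> [|k IH]; first by rewrite expr0 divr1.
  by rewrite exprS invfM [t^-1 * _]mulrC mulrA; apply: tgen; apply: H.
have Oztk : forall k, O (z / t ^+ k).
  by apply: tO => // k Ok; apply/not_notP => nm; apply: nk; exists k.
have [k Ok nk'] : exists2 k, O (y / t ^+ k) & ~ m (y / t ^+ k).
  apply/not_notP => H; have /(_ N.+1) : forall k, O (y / t ^+ k).
    by apply: tO => // k Ok; apply/not_notP => nm; apply: H; exists k.
  by move/(divisor_exponent t0 mt); rewrite ltnn.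
have [c [[j cj] cw]] := finy (fun j => z ^+ j).
case: (@arg_minnP _ j (fun i => c i != 0) (fun i => nat_of_ord i) cj) => i ci imin.
have Oev p : O (ev iota y p).
  elim/poly_ind: p => [|p a Op]; first by rewrite rmorph0.
  by rewrite rmorphD rmorphM /= evX evC; apply: OD => //; apply: OM.
have cE : ev iota y (c i) = z * - \sum_(l | l != i) ev iota y (c l) * z ^+ (l - i).-1.
  apply: (mulIf (expf_neq0 i z0)); rewrite mulrN mulNr.
  apply/eqP; rewrite -addr_eq0 -[X in _ == X]cw [X in _ == X](bigD1 i)//= mulr_sumr mulr_suml.
  apply/eqP; congr (_ + _); apply: eq_bigr => l li.
  have [->|cl] := eqVneq (c l) 0; first by rewrite rmorph0 !(mul0r, mulr0).
  have il : (i < l)%N.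
    by rewrite ltn_neqAle imin// andbT; apply: contraNneq li => /val_inj ->.
  by rewrite mulrCA -exprS prednK ?subn_gt0// -mulrA -exprD subnK// ltnW.
have [q nq [e qE]] : exists2 q : {poly F}, q`_0 != 0 & exists e, c i = q * 'X ^+ e.
  have [e [q /implyP/(_ ci) nq qE]] := multiplicity_XsubC (c i) 0.
  exists q; first by rewrite -horner_coef0 -/(root q 0).
  by exists e; rewrite qE subr0.
(* A polynomial in [y] with nonzero constant term is a unit, since [y] lies in [m]. *)
have qu : ~ m (ev iota y q).
  have q_split : q = (\poly_(k < (size q).-1) q`_k.+1) * 'X + (q`_0)%:P.
    apply/polyP => -[|l]; rewrite coefD coefMX coefC /= ?add0r// addr0.
    by rewrite coef_poly; case: ltnP => // h; rewrite nth_default//; move: h; case: (size q).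
  move=> mq; apply: (mF nq).
  have -> : iota q`_0 = ev iota y q - ev iota y (\poly_(k < (size q).-1) q`_k.+1) * y.
    by rewrite [in X in X - _]q_split rmorphD rmorphM /= evX evC addrC addKr.
  by apply: mD => //; apply: mN; apply: mM => //; right.
have ku : ~ m (ev iota y q * (y / t ^+ k) ^+ e).
  move=> mq; have ntm (u v : K) : ~ m u -> ~ m v -> ~ m (u * v).
    move=> nu nv; have Ou' : O u^-1 by apply/not_notP => h; apply: nu; right.
    move=> /(mM Ou'); rewrite mulKf//; apply/eqP => u0; apply: nu; by left.
  suff nX : ~ m ((y / t ^+ k) ^+ e) by apply: (ntm _ _ qu nX).
  by elim: e {qE mq} => [|e IH]; [rewrite expr0|rewrite exprS; apply: ntm].
apply: ku.
have -> : ev iota y q * (y / t ^+ k) ^+ e = z / t ^+ (k * e).+1 *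
    (- \sum_(l | l != i) ev iota y (c l) * z ^+ (l - i).-1) * t.
  have tk : t ^+ (k * e) != 0 by rewrite expf_neq0.
  rewrite [z / _ * _]mulrAC -cE qE rmorphM rmorphXn /= evX expr_div_n -exprM exprSr.
  by rewrite invfM !mulrA mulfVK.
apply: mM => //; apply: OM => //; apply: ON.
apply: (big_ind O) => // l _; apply: OM => //; exact: OX.
Qed.

Lemma valuation_ring_place :
  exists p : place iota, forall z, z != 0 -> (0 <= p z) <-> O z.
Proof.
have [t [t0 mt tgen]] := uniformizer_exists.
pose U z := [/\ z != 0, O z & O z^-1].
have UM u v : U u -> U v -> U (u * v).
  by move=> [u0 Ou Ou'] [v0 Ov Ov']; split; rewrite ?mulf_neq0 ?invfM//; exact: OM.
have UV u : U u -> U u^-1 by move=> [u0 Ou Ou']; split; rewrite ?invr_eq0 ?invrK.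
have tz (k : int) : t ^ k != 0 by rewrite expfz_neq0.
have U_exists z : z != 0 -> exists k : int, U (z * t ^ (- k)).
  move=> z0; have [w [w0 Ow wz]] : exists w, [/\ w != 0, O w & w = z \/ w = z^-1].
    case: (O_total z) => h; first by exists z; split; rewrite ?invr_eq0//; left.
    by exists z^-1; split; rewrite ?invr_eq0//; right.
  have [k Ok nk] := unit_part w0 Ow t0 mt tgen.
  have Uk : U (w * t ^ (- k%:Z)).
    have -> : w * t ^ (- k%:Z) = w / t ^+ k by rewrite -invr_expz.
    split => //; first by rewrite mulf_neq0// invr_eq0 expf_neq0.
    by apply/not_notP => h; apply: nk; right.
  case: wz => wz; first by exists k; rewrite -wz.
  exists (- k%:Z); have -> : z * t ^ (- - k%:Z) = (w * t ^ (- k%:Z))^-1.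
    by rewrite wz invfM invrK invr_expz.
  exact: UV.
pose v z := if pselect (z != 0) is left z0 then projT1 (cid (U_exists z z0)) else 0.
have vU z : z != 0 -> U (z * t ^ (- v z)).
  by move=> z0; rewrite /v; case: pselect => // z0'; case: cid.
have tO (k : int) : O (t ^ k) -> 0 <= k.
  case: k => // k; rewrite NegzE -invr_expz => Ok; exfalso.
  case: (mt) => [/eqP|]; first by rewrite (negbTE t0).
  apply; have -> : t^-1 = t ^- k.+1 * t ^+ k.
    by rewrite exprS invfM -mulrA mulVf ?mulr1// expf_neq0.
  by apply: OM => //; apply: OX; exact: mO.
have Ot (k : int) : 0 <= k -> O (t ^ k).
  by case: k => // k _; apply: OX; exact: mO.
have vle z k : z != 0 -> O (z * t ^ (- k)) -> k <= v z.
  move=> z0 Oz; have [w0 Ow Ow'] := vU _ z0.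
  rewrite -subr_ge0; apply: tO.
  have -> : t ^ (v z - k) = z * t ^ (- k) * (z * t ^ (- v z))^-1.
    rewrite invfM [X in _ = _ * (_ * X)]invr_expz opprK expfzDr// mulrA.
    by rewrite [z * _]mulrC mulfK// mulrC.
  exact: OM.
have vge z k : z != 0 -> k <= v z -> O (z * t ^ (- k)).
  move=> z0; rewrite -subr_ge0 => /Ot Ok; have [w0 Ow Ow'] := vU _ z0.
  have -> : z * t ^ (- k) = z * t ^ (- v z) * t ^ (v z - k).
    by rewrite -mulrA -expfzDr//; congr (_ * t ^ _); ring.
  exact: OM.
have vP z k : z != 0 -> U (z * t ^ (- k)) -> v z = k.
  move=> z0 [w0 Ow Ow']; apply/eqP; rewrite eq_le vle// andbT.
  rewrite -subr_ge0; apply: tO; have [_ Ov _] := vU _ z0.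
  have -> : t ^ (k - v z) = z * t ^ (- v z) * (z * t ^ (- k))^-1.
    rewrite invfM [X in _ = _ * (_ * X)]invr_expz opprK expfzDr// mulrA.
    by rewrite [z * _ * _]mulrAC divff// mul1r mulrC.
  exact: OM.
have v0 : v 0 = 0 by rewrite /v; case: pselect => // h; exfalso; move: (h); rewrite eqxx.
have vM a b : a != 0 -> b != 0 -> v (a * b) = v a + v b.
  move=> a0 b0; apply: vP; first exact: mulf_neq0.
  have -> : a * b * t ^ (- (v a + v b)) = (a * t ^ (- v a)) * (b * t ^ (- v b)).
    by rewrite opprD expfzDr// mulrACA.
  by apply: UM; exact: vU.
have vD a b : a != 0 -> b != 0 -> a + b != 0 -> Num.min (v a) (v b) <= v (a + b).
  move=> a0 b0 ab0; apply: vle => //; rewrite mulrDl.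
  by apply: OD; apply: vge => //; rewrite ge_min lexx ?orbT.
have vF a : a != 0 -> v (iota a) = 0.
  move=> a0; apply: vP; first by rewrite fmorph_eq0.
  by rewrite oppr0 expr0z mulr1; split; rewrite -?fmorphV// fmorph_eq0.
have vt : exists2 t, t != 0 & v t = 1.
  by exists t => //; apply: vP => //; rewrite -invr_expz expr1z divff//; split; rewrite ?oner_eq0 ?invr1.
exists (Place v0 vM vD vF vt) => z z0 /=; split.
  by move=> /(vge _ _ z0); rewrite oppr0 expr0z mulr1.
by move=> Oz; apply: vle => //; rewrite oppr0 expr0z mulr1.
Qed.

End ValuationRing.

(** * Valuation rings avoiding a transcendental element *)

Section MaximalSubring.
Variables (F : finFieldType) (K : fieldType) (iota : {rmorphism F -> K}).
Variable z : K.
Hypothesis z_trans : ~ algebraicOver iota z.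

Let y := z^-1.

Let z0 : z != 0.
Proof.
apply/eqP => z0; apply: z_trans; exists 'X; first by rewrite polyX_eq0.
by rewrite map_polyX z0 /root hornerX.
Qed.

Let good (S : set K) := [/\ forall a, S (iota a), forall u v, S u -> S v -> S (u + v),
  forall u v, S u -> S v -> S (u * v), S y & ~ S z].

Lemma trans_notin_inverse_polys p : ev iota z^-1 p != z.
Proof.
apply/eqP => pz; apply: z_trans; pose s := size p.
(* This is the equation [z = p(z^-1)] multiplied by [z^s]. *)
exists ('X^(s.+1) - \poly_(i < s.+1) p`_(s - i)).
  rewrite -size_poly_eq0 size_polyDl size_polyXn//.
  by rewrite size_polyN; apply: leq_ltn_trans (size_poly _ _) _.
rewrite rmorphB /= map_polyXn; apply/rootP; rewrite hornerE hornerXn.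
rewrite hornerN; apply/eqP; rewrite subr_eq0 exprSr -{2}pz evE.
have -> : map_poly iota (\poly_(i < s.+1) p`_(s - i)) = \poly_(i < s.+1) iota p`_(s - i).
  by apply/polyP => i; rewrite coef_map /= !coef_poly; case: ifP => // _; rewrite rmorph0.
rewrite [X in _ == X]horner_poly (@horner_coef_wide _ s.+1 (map_poly iota p)); last first.
    by rewrite size_map_poly.
rewrite mulr_sumr [in X in _ == X](reindex_inj rev_ord_inj) /=.
apply/eqP/eq_bigr => i _; rewrite coef_map /= exprVn mulrCA.
have iS : (i <= s)%N by rewrite -ltnS.
rewrite !subSS subKn//; congr (_ * _).
by apply: (mulIf (expf_neq0 i z0)); rewrite mulfVK ?expf_neq0// -exprD subnK.
Qed.

Lemma maximal_subring : exists S, good S /\ forall B, S `<` B -> ~ good B.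
Proof.
(* The guard [S !=set0] admits the union of the empty chain. The maximal set is nonempty after all,
   because [F[z^-1]] is good. *)
have [|A [PA maxA]] := @Zorn_bigcup K (fun S => S !=set0 -> good S).
  move=> C CP Ctot [w [S CS Sw]].
  have Sg : good S by apply: CP => //; exists w.
  have up u v : (\bigcup_(X in C) X) u -> (\bigcup_(X in C) X) v ->
      exists X, [/\ C X, X u & X v].
    move=> [U CU Uu] [V CV Vv]; case: (Ctot _ _ CU CV) => h.
      by exists V; split => //; apply: h.
    by exists U; split => //; apply: h.
  have g X u : C X -> X u -> good X by move=> CX Xu; apply: CP => //; exists u.
  have [SF SD SM Sy Sz] := Sg; split.
  - by move=> a; exists S.
  - move=> u v Cu Cv; have [X [CX Xu Xv]] := up _ _ Cu Cv.
    by exists X => //; have [_ XD _ _ _] := g _ _ CX Xu; apply: XD.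
  - move=> u v Cu Cv; have [X [CX Xu Xv]] := up _ _ Cu Cv.
    by exists X => //; have [_ _ XM _ _] := g _ _ CX Xu; apply: XM.
  - by exists S.
  - by move=> [X CX Xz]; have [_ _ _ _] := g _ _ CX Xz.
pose S0 : set K := range (ev iota y).
have S0g : good S0.
  split.
  - by move=> a; exists a%:P => //; rewrite evC.
  - by move=> _ _ [p _ <-] [q _ <-]; exists (p + q) => //; rewrite rmorphD.
  - by move=> _ _ [p _ <-] [q _ <-]; exists (p * q) => //; rewrite rmorphM.
  - by exists 'X => //; rewrite evX.
  - by move=> [p _ pz]; move: (trans_notin_inverse_polys p); rewrite pz eqxx.
have A0 : A !=set0.
  apply/set0P/negP => /eqP A0; apply: (maxA S0) => [|_//].
  rewrite A0 properEneq; split => //; apply/eqP => S00.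
  by have [S0F _ _ _ _] := S0g; have := S0F 0; rewrite -S00.
exists A; split; first exact: PA.
by move=> B AB gB; apply: (maxA B AB).
Qed.

Section Maximal.
Variable S : set K.
Hypotheses (gS : good S) (maxS : forall B, S `<` B -> ~ good B).

Let SF : forall a, S (iota a). Proof. by have [] := gS. Qed.
Let SD : forall u v, S u -> S v -> S (u + v). Proof. by have [] := gS. Qed.
Let SM : forall u v, S u -> S v -> S (u * v). Proof. by have [] := gS. Qed.
Let Sy : S y. Proof. by have [] := gS. Qed.
Let Sz : ~ S z. Proof. by have [] := gS. Qed.
Let S0 : S 0. Proof. by rewrite -(rmorph0 iota). Qed.
Let S1 : S 1. Proof. by rewrite -(rmorph1 iota). Qed.
Let SN u : S u -> S (- u).
Proof. by move=> Su; rewrite -mulN1r -(rmorph1 iota) -rmorphN; apply: SM. Qed.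
Let SX u k : S u -> S (u ^+ k).
Proof. by move=> Su; elim: k => [|k IH]; rewrite ?expr0// exprS; apply: SM. Qed.

Let extension (B : set K) : S `<=` B -> (forall u v, B u -> B v -> B (u + v)) ->
  (forall u v, B u -> B v -> B (u * v)) -> (exists2 u, B u & ~ S u) -> B z.
Proof.
move=> SB BD BM [u Bu nSu]; apply/not_notP => nBz.
apply: (@maxS B); last by split => //; [move=> a; apply: SB|exact: SB].
by rewrite properEneq; split => //; apply/eqP => e; apply: nSu; rewrite e.
Qed.

(** Put [t = 1 - y s]. If [t^-1] were not in [S], adjoining it would by maximality produce [z], so
    [z t^k] is in [S] for some [k]; since [z t = z - s], the exponent [k] descends to 0. *)
Let unit_1y s : S s -> S (1 - y * s)^-1.
Proof.
move=> Ss; set t := 1 - y * s; apply/not_notP => nt.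
have St : S t by apply: SD => //; apply: SN; apply: SM.
have tV : t != 0.
  apply/eqP => /eqP; rewrite subr_eq0 => /eqP e; apply: Sz.
  by rewrite -[z]mulr1 e mulrA mulfV// mul1r.
have : exists2 k, S (z * t ^+ k) & True.
  have [||||k Sk] := @extension [set u | exists k, S (u * t ^+ k)]; last by exists k.
  - by move=> u Su; exists 0%N; rewrite expr0 mulr1.
  - move=> u v [k Sk] [l Sl]; exists (k + l)%N.
    by rewrite mulrDl exprD mulrA [X in _ + _ * X]mulrC mulrA; apply: SD; apply: SM => //; apply: SX.
  - move=> u v [k Sk] [l Sl]; exists (k + l)%N.
    by rewrite exprD mulrACA; apply: SM.
  - by exists t^-1 => //; exists 1%N; rewrite expr1 mulVf.
move=> [k + _]; elim: k => [|k IH]; first by rewrite expr0 mulr1.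
move=> Szt; apply: IH.
have -> : z * t ^+ k = z * t ^+ k.+1 + t ^+ k * s.
  by rewrite exprS {2}/t mulrBl mul1r mulrBr !mulrA mulfV// mul1r [s * _]mulrC subrK.
by apply: SD => //; apply: SM => //; apply: SX.
Qed.

Let I c := exists2 s, S s & c = y * s.
Let I0 : I 0. Proof. by exists 0; rewrite ?mulr0. Qed.
Let ID a b : I a -> I b -> I (a + b).
Proof. by move=> [s Ss ->] [t St ->]; exists (s + t); rewrite ?mulrDr//; apply: SD. Qed.
Let IM a b : S a -> I b -> I (a * b).
Proof. by move=> Sa [t St ->]; exists (a * t); rewrite 1?mulrCA//; apply: SM. Qed.
Let IS a : I a -> S a. Proof. by move=> [s Ss ->]; apply: SM. Qed.

(** Chevalley's descent on the total size. By symmetry [p] is the longer relation. As [1 - p'_0] is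
    a unit, the relation for [u^-1] expresses [u^m], with [m] the degree of [p'], by lower powers of
    [u] with coefficients in the ideal [I], and this removes the leading term of [p]. *)
Let no_two_relations (N : nat) (u : K) (p p' : {poly K}) : u != 0 ->
  (size p + size p' <= N)%N -> (forall i, I p`_i) -> (forall i, I p'`_i) ->
  p.[u] = 1 -> p'.[u^-1] = 1 -> False.
Proof.
elim: N u p p' => [|N IH] u p p' u0 pN Ip Ip' pu p'u.
  move: pN; rewrite leqn0 addn_eq0 size_poly_eq0 => /andP[/eqP p0 _].
  by move: pu; rewrite p0 horner0 => /eqP; rewrite eq_sym oner_eq0.
wlog le : u p p' u0 pN Ip Ip' pu p'u / (size p' <= size p)%N.
  move=> H; case: (leqP (size p') (size p)); first exact: (H u).
  by move=> /ltnW; apply: (H u^-1) => //; rewrite ?invr_eq0 ?invrK// addnC.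
have nz (q : {poly K}) v : q.[v] = 1 -> (0 < size q)%N.
  move=> qv; rewrite lt0n size_poly_eq0; apply/eqP => q0.
  by move: qv; rewrite q0 horner0 => /eqP; rewrite eq_sym oner_eq0.
have := nz _ _ p'u; have := nz _ _ pu.
case En : (size p) => [//|n] _; case Em : (size p') => [//|m] _.
have [s0 Ss0 p'0] := Ip' 0%N.
have u1 : S (1 - p'`_0)^-1 by rewrite p'0; apply: unit_1y.
have d0 : 1 - p'`_0 != 0.
  apply/eqP => /eqP; rewrite subr_eq0 p'0 => /eqP e; apply: Sz.
  by rewrite -[z]mulr1 e mulrA mulfV// mul1r.
pose q := \poly_(i < m) (p'`_(m - i) / (1 - p'`_0)).
have qE : q.[u] = u ^+ m.
  have e : 1 - p'`_0 = \sum_(i < m) p'`_i.+1 * u^-1 ^+ i.+1.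
    by rewrite -{1}p'u (horner_coef p') Em big_ord_recl /= expr0 mulr1 addrC addKr.
  apply: (mulIf d0); rewrite [in RHS]e.
  rewrite horner_poly mulr_suml mulr_sumr [RHS](reindex_inj rev_ord_inj) /=.
  apply: eq_bigr => i _; rewrite mulrAC mulfVK//.
  have im := ltn_ord i; rewrite subnSK// mulrCA; congr (_ * _).
  apply: (mulIf (expf_neq0 (m - i) u0)).
  by rewrite -exprD subnKC 1?ltnW// exprVn mulfVK// expf_neq0.
have mn : (m <= n)%N by move: le; rewrite En Em.
pose r := p - (p`_n)%:P * 'X^n + (p`_n)%:P * ('X^(n - m) * q).
apply: (IH u r p') => //.
- suff : (size r <= n)%N by move: pN; rewrite En; clear; lia.
  rewrite (leq_trans (size_polyD _ _))// geq_max; apply/andP; split.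
    apply/leq_sizeP => j nj; rewrite coefB coefCM coefXn.
    move: nj; rewrite leq_eqVlt => /orP[/eqP <-|nj]; first by rewrite eqxx mulr1 subrr.
    by rewrite gtn_eqF// mulr0 subr0 nth_default// En.
  apply/leq_sizeP => j nj; rewrite coefCM coefXnM.
  case: ltnP => [|h]; rewrite ?mulr0// coef_poly ifN ?mulr0// -leqNgt.
  by move: nj h mn; clear; lia.
- have nI a : I a -> I (- a).
    by move=> Ia; rewrite -mulN1r; apply: IM => //; apply: SN.
  move=> i; rewrite coefD coefB !coefCM coefXn coefXnM.
  apply: ID; first apply: ID => //; first apply: nI.
    by case: eqP => _; rewrite ?mulr1 ?mulr0.
  rewrite mulrC; apply: IM => //; case: ltnP => // h.
  by rewrite coef_poly; case: ltnP => // h'; apply: SM => //; exact: IS.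
- by rewrite /r hornerD hornerD hornerN !hornerM !hornerC !hornerXn pu qE -exprD subnK// subrK.
Qed.

(** If [u] is not in [S], then [S[u]] contains [z], and multiplying [z = p(u)] by [y] gives
    [1 = y p(u)] with coefficients in [I]. The same for [u^-1] gives the second of two incompatible
    relations. *)
Lemma maximal_subring_total u : S u \/ S u^-1.
Proof.
apply/not_notP => /not_orP[nu nu'].
have u0 : u != 0 by apply/eqP => u0; apply: nu; rewrite u0.
have key v : ~ S v -> exists2 p : {poly K}, forall i, I p`_i & p.[v] = 1.
  move=> nv; pose B : set K := [set w | exists2 p : {poly K}, forall i, S p`_i & w = p.[v]].
  have [||||p Sp zp] := @extension B.
  - move=> w Sw; exists w%:P; last by rewrite hornerC.
    by move=> [|i]; rewrite coefC.
  - move=> _ _ [p Sp ->] [q Sq ->]; exists (p + q); last by rewrite hornerD.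
    by move=> i; rewrite coefD; apply: SD.
  - move=> _ _ [p Sp ->] [q Sq ->]; exists (p * q); last by rewrite hornerM.
    by move=> i; rewrite coefM; apply: (big_ind S) => // j _; apply: SM.
  - exists v => //; exists 'X; last by rewrite hornerX.
    by move=> i; rewrite coefX; case: eqP.
  exists (y%:P * p); last by rewrite hornerM hornerC -zp mulVf.
  by move=> i; rewrite coefCM; exists p`_i.
have [p Ip pu] := key _ nu; have [p' Ip' pu'] := key _ nu'.
exact: (no_two_relations u0 (leqnn _) Ip Ip' pu pu').
Qed.

End Maximal.

Lemma valuation_ring_avoiding : exists O : set K,
  [/\ (forall a, O (iota a)), (forall u v, O u -> O v -> O (u + v)),
    (forall u v, O u -> O v -> O (u * v)), (forall u, O u \/ O u^-1) & ~ O z].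
Proof.
have [S [gS maxS]] := maximal_subring; exists S; have [SF SD SM _ Sz] := gS.
by split=> //; exact: maximal_subring_total.
Qed.

End MaximalSubring.

(** * Poles of transcendental elements *)

Section Poles.
Variables (F : finFieldType) (K : fieldType) (iota : {rmorphism F -> K}).
Variables (x : K) (n : nat) (b : 'I_n -> K).
Hypothesis x_trans : ~ algebraicOver iota x.
Hypothesis b_span : forall y : K,
  exists p q : 'I_n -> {poly F}, (forall i, q i != 0) /\
    y = \sum_(i < n) ev iota x (p i) / ev iota x (q i) * b i.

Lemma fin_over_x : fin_over iota x n.
Proof. by have := fin_over_poly x_trans b_span (f := 'X); rewrite size_polyX evX muln1; apply. Qed.

Lemma trans_neq0 : x != 0.
Proof. by rewrite -(evX iota x) transcendental_ev_neq0// polyX_eq0. Qed.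

(** If [x] is not in [O], take [x^-1]; if some nonzero [f(x)] is a nonunit of [O], take [f(x)].
    Otherwise [O] contains [F(x)], over which all of [K] is integral, and a valuation ring is
    integrally closed, so that [O] would be [K]. *)
Lemma fin_over_nonunit (O : set K) :
  (forall a, O (iota a)) -> (forall u v, O u -> O v -> O (u + v)) ->
  (forall u v, O u -> O v -> O (u * v)) -> (forall u, O u \/ O u^-1) ->
  (exists z, ~ O z) ->
  exists y N, [/\ y != 0, O y, ~ O y^-1 & fin_over iota y N].
Proof.
move=> OF OD OM Otot [z nOz].
have O0 : O 0 by rewrite -(rmorph0 iota).
have fx := fin_over_x; have x0 := trans_neq0.
have [Ox|nOx] := pselect (O x); last first.
  exists x^-1, n; split; rewrite ?invr_eq0 ?invrK//; last exact: fin_over_inv.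
  by case: (Otot x).
have Oev p : O (ev iota x p).
  elim/poly_ind: p => [|p a Op]; first by rewrite rmorph0.
  by rewrite rmorphD rmorphM /= evX evC; apply: OD => //; apply: OM.
have [[f f0 nf]|H] := pselect (exists2 f, f != 0 & ~ O (ev iota x f)^-1).
  have sf : (1 < size f)%N.
    rewrite ltnNge; apply/negP => /size1_polyC fE; apply: nf.
    by rewrite fE evC -fmorphV.
  exists (ev iota x f); eexists; split => //; first exact: transcendental_ev_neq0.
  exact: (fin_over_poly x_trans b_span sf).
have Ox' f : O (ev iota x f)^-1.
  have [->|f0] := eqVneq f 0; first by rewrite rmorph0 invr0.
  by apply/not_notP => nf; apply: H; exists f.
exfalso; apply: nOz.
have [z0|z0] := eqVneq z 0; first by rewrite z0.
have [Oz|Oz] := Otot z => //.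
have OX k : O (z^-1 ^+ k).
  elim: k => [|k IH]; last by rewrite exprS; apply: OM.
  by rewrite expr0 -(rmorph1 iota).
have [c [[j cj] cz]] := fx (fun j => z ^+ j).
case: (@arg_maxnP _ j (fun i => c i != 0) (fun i => nat_of_ord i) cj) => i ci imax.
have cx : ev iota x (c i) != 0 by exact: transcendental_ev_neq0.
have -> : z = - \sum_(l | l != i) ev iota x (c l) / ev iota x (c i) * z^-1 ^+ (i - l).-1.
  apply: (mulIf (mulf_neq0 cx (expf_neq0 i z0))).
  have cz' : z * \sum_j ev iota x (c j) * z ^+ j = 0 by rewrite cz mulr0.
  rewrite mulNr; apply/eqP; rewrite -addr_eq0 -[X in _ == X]cz'.
  rewrite [X in _ == z * X](bigD1 i)//= mulrDr mulr_sumr mulr_suml; apply/eqP; congr (_ + _).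
  apply: eq_bigr => l li; have [->|cl] := eqVneq (c l) 0.
    by rewrite rmorph0 !(mul0r, mulr0).
  have il : (l < i)%N.
    by rewrite ltn_neqAle [(l <= i)%N]imax// andbT; apply: contraNneq li => /val_inj ->.
  rewrite mulrACA mulfVK// [RHS]mulrCA; congr (_ * _).
  have -> : z ^+ i = z ^+ (i - l).-1 * z ^+ l.+1.
    by rewrite -exprD; congr (_ ^+ _); move: il; clear; lia.
  by rewrite mulrA -exprMn mulVf// expr1n mul1r exprS.
have On u : O u -> O (- u).
  by move=> Ou; rewrite -mulN1r -(rmorph1 iota) -rmorphN; apply: OM.
by apply: On; apply: (big_ind O) => // l _; apply: (OM) => //; apply: (OM).
Qed.

Lemma place_of_valuation_ring (O : set K) :
  (forall a, O (iota a)) -> (forall u v, O u -> O v -> O (u + v)) ->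
  (forall u v, O u -> O v -> O (u * v)) -> (forall u, O u \/ O u^-1) ->
  (exists z, ~ O z) ->
  exists p : place iota, forall z, z != 0 -> (0 <= p z) <-> O z.
Proof.
move=> OF OD OM Otot nO; have [y [N [y0 Oy Oy' finy]]] := fin_over_nonunit OF OD OM Otot nO.
exact: (valuation_ring_place OF OD OM Otot y0 Oy Oy' finy).
Qed.

Lemma transcendental_has_pole z : ~ algebraicOver iota z -> exists p : place iota, p z < 0.
Proof.
move=> tz; have [V [VF VD VM Vtot nVz]] := valuation_ring_avoiding tz.
have [|p pV] := place_of_valuation_ring VF VD VM Vtot; first by exists z.
exists p; rewrite ltNge; apply/negP => h; apply: nVz; apply/pV => //.
by rewrite -(evX iota z) transcendental_ev_neq0// polyX_eq0.
Qed.

End Poles.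

Lemma card_range (T : finType) (T' : choiceType) (f : T -> T') : injective f ->
  finite_set (range f) /\ #|` fset_set (range f)| = #|T|.
Proof.
move=> f_inj; have fin : finite_set (range f).
  by apply: finite_image; exact: finite_finset.
split => //; rewrite cardE -(size_map f); apply: perm_size.
apply: uniq_perm => [||y]; first exact: fset_uniq.
  by rewrite (map_inj_uniq f_inj); exact: enum_uniq.
rewrite in_fset_set//; apply/idP/mapP => [|[x _ ->]].
  by rewrite inE => -[x _ <-]; exists x; rewrite ?mem_enum.
by rewrite inE; exists x.
Qed.

(** * Dimensions of quotients of [F]-subspaces of [K] *)

Section QuotientDimension.
Variables (F : finFieldType) (K : fieldType) (iota : {rmorphism F -> K}).

Definition lincomb (I : finType) (a : I -> F) (v : I -> K) : K :=
  \sum_i iota (a i) * v i.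

Definition subspace (W : set K) : Prop :=
  [/\ W 0, forall u v, W u -> W v -> W (u + v) & forall a v, W v -> W (iota a * v)].

(** The quotient [V / W] is not formed; independence and spanning are understood modulo [W] inside
    [K]. *)
Definition independent (V W : set K) (I : finType) (v : I -> K) : Prop :=
  (forall i, V (v i)) /\ forall a, W (lincomb a v) -> forall i, a i = 0.

Definition dim_le (V W : set K) (d : nat) : Prop :=
  forall (I : finType) (v : I -> K), independent V W v -> (#|I| <= d)%N.

Definition dim_quot (V W : set K) (d : nat) : Prop :=
  exists (I : finType) (v : I -> K), [/\ #|I| = d, independent V W v &
    forall z, V z -> exists a, W (z - lincomb a v)].

Lemma lincombB (I : finType) (a b : I -> F) v :
  lincomb a v - lincomb b v = lincomb (fun i => a i - b i) v.
Proof. by rewrite -sumrB; apply: eq_bigr => i _; rewrite rmorphB mulrBl. Qed.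

Lemma lincombZ (I : finType) c (a : I -> F) v :
  iota c * lincomb a v = lincomb (fun i => c * a i) v.
Proof. by rewrite mulr_sumr; apply: eq_bigr => i _; rewrite rmorphM mulrA. Qed.

Lemma lincombM (I : finType) (a : I -> F) v c :
  c * lincomb a v = lincomb a (fun i => c * v i).
Proof. by rewrite mulr_sumr; apply: eq_bigr => i _; rewrite mulrCA. Qed.

Lemma subspaceN W u : subspace W -> W u -> W (- u).
Proof. by move=> [_ _ WZ] Wu; rewrite -mulN1r -(rmorph1 iota) -rmorphN; apply: WZ. Qed.

Lemma subspaceB W u v : subspace W -> W u -> W v -> W (u - v).
Proof. by move=> sW Wu Wv; have [_ WD _] := sW; apply: WD => //; exact: subspaceN. Qed.

Lemma subspace_lincomb W (I : finType) (a : I -> F) v :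
  subspace W -> (forall i, W (v i)) -> W (lincomb a v).
Proof. by move=> [W0 WD WZ] Wv; apply: (big_ind W) => // i _; apply: WZ. Qed.

Lemma subspace0 : subspace [set 0].
Proof. by split => //= [u v -> ->|a v ->]; rewrite ?addr0 ?mulr0. Qed.

(** Counting replaces the exchange argument: rewriting combinations of an independent family in a
    spanning one is injective on coefficient vectors, of which there are finitely many. *)
Lemma dim_quot_le V W d : subspace W -> dim_quot V W d -> dim_le V W d.
Proof.
move=> sW [J [w [<- _ span]]] I v [Vv indep].
have V_lc (a : {ffun I -> F}) : exists b : {ffun J -> F}, W (lincomb a v - lincomb b w).
  have [c cP] := choice (fun i => span _ (Vv i)).
  exists [ffun j => \sum_i a i * c i j].
  have -> : lincomb a v - lincomb [ffun j => \sum_i a i * c i j] w =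
      lincomb a (fun i => v i - lincomb (c i) w).
    rewrite /lincomb; under [RHS]eq_bigr => i _ do rewrite mulrBr mulr_sumr.
    rewrite sumrB exchange_big /=; congr (_ - _); apply: eq_bigr => j _.
    rewrite ffunE rmorph_sum mulr_suml; apply: eq_bigr => i _.
    by rewrite rmorphM mulrA.
  exact: subspace_lincomb.
have [f fP] := choice V_lc.
have : (#|{ffun I -> F}| <= #|{ffun J -> F}|)%N.
  apply: (@leq_card _ _ f) => a b fab; apply/ffunP => i; apply/eqP; rewrite -subr_eq0.
  apply/eqP/(indep (fun i => a i - b i)); rewrite -lincombB.
  have -> : lincomb a v - lincomb b v =
      (lincomb a v - lincomb (f a) w) - (lincomb b v - lincomb (f b) w).
    by rewrite fab; ring.
  exact: subspaceB.
by rewrite !card_ffun leq_exp2l// card_finNzRing_gt1.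
Qed.

Lemma dim_quot_unique V W d d' : subspace W ->
  dim_quot V W d -> dim_quot V W d' -> d = d'.
Proof.
move=> sW dd dd'; apply/eqP; rewrite eqn_leq; apply/andP; split.
  by case: (dd) => I [v [<- iv _]]; apply: dim_quot_le iv.
by case: (dd') => I [v [<- iv _]]; apply: dim_quot_le iv.
Qed.

Lemma dim_le_quot V W N : subspace W -> dim_le V W N ->
  exists2 d, (d <= N)%N & dim_quot V W d.
Proof.
move=> sW dN; have [W0 WD WZ] := sW.
pose P k := `[< exists (I : finType) (v : I -> K), #|I| = k /\ independent V W v >].
have ub k : P k -> (k <= N)%N by move=> /asboolP[I [v [<-]]]; exact: dN.
have P0 : exists k, P k.
  exists 0%N; apply/asboolP; exists 'I_0, (fun=> 0); rewrite card_ord; split => //.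
  by split => [[]//|a _ []].
case: (ex_maxnP P0 ub) => k /asboolP[I [v [Ik [Vv indep]]]] kmax.
exists k; first by apply/ub/asboolP; exists I, v.
exists I, v; split => // z Vz; apply/not_notP => nz.
suff /kmax : P k.+1 by rewrite ltnn.
apply/asboolP; exists (I + 'I_1)%type, (fun i => match i with inl i => v i | inr _ => z end).
rewrite card_sum card_ord Ik addn1; split => //; split; first by case.
move=> a; rewrite /lincomb big_sumType /= big_ord1 => Wa.
have [a0|a0] := eqVneq (a (inr fintype.ord0)) 0.
  move: Wa; rewrite a0 rmorph0 mul0r addr0 => /indep a_inl [i|i]; first exact: a_inl.
  by rewrite (fintype.ord1 i).
case: nz; exists (fun i => - (a (inr fintype.ord0))^-1 * a (inl i)).
rewrite -lincombZ rmorphN mulNr opprK.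
have -> : z + iota (a (inr fintype.ord0))^-1 * lincomb (fun i => a (inl i)) v =
  iota (a (inr fintype.ord0))^-1 * (lincomb (fun i => a (inl i)) v + iota (a (inr fintype.ord0)) * z).
  by rewrite mulrDr mulrA -rmorphM mulVf// rmorph1 mul1r addrC.
exact: WZ.
Qed.

Lemma dim_quot_trans U V W a b : subspace V -> subspace W -> V `<=` U -> W `<=` V ->
  dim_quot U V a -> dim_quot V W b -> dim_quot U W (a + b).
Proof.
move=> sV sW VU WV [I [v [Ia [Uv vV] vspan]]] [J [w [Jb [Vw wW] wspan]]].
exists (I + J)%type, (fun i => match i with inl i => v i | inr j => w j end).
have lcE c : lincomb c (fun i : I + J => match i with inl i => v i | inr j => w j end) =
    lincomb (fun i => c (inl i)) v + lincomb (fun j => c (inr j)) w.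
  by rewrite /lincomb big_sumType.
split; first by rewrite card_sum Ia Jb.
- split; first by case=> [i|j] //; exact: VU.
  move=> c; rewrite lcE => Wc.
  have c_inl : forall i, c (inl i) = 0.
    apply: vV; rewrite -[lincomb _ _](addrK (lincomb (fun j => c (inr j)) w)).
    by apply: subspaceB => //; [exact: WV|exact: subspace_lincomb].
  have c_inr : forall j, c (inr j) = 0.
    apply: wW; suff <- : lincomb (fun i => c (inl i)) v + lincomb (fun j => c (inr j)) w =
        lincomb (fun j => c (inr j)) w by [].
    rewrite [X in X + _]big1 ?add0r// => i _.
    by rewrite c_inl rmorph0 mul0r.
  by case.
- move=> z Uz; have [c Vc] := vspan z Uz; have [d Wd] := wspan _ Vc.
  exists (fun i => match i with inl i => c i | inr j => d j end).
  by rewrite lcE opprD addrA.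
Qed.

Lemma dim_le_mul c V W V' W' d : (forall z, V z -> V' (c * z)) ->
  (forall z, W' (c * z) -> W z) -> dim_le V' W' d -> dim_le V W d.
Proof.
move=> VV' WW' dd I v [Vv vW]; apply: (dd I (fun i => c * v i)); split => [i|a].
  exact: VV'.
by rewrite -lincombM => /WW'; exact: vW.
Qed.

(** Multiplication by [c] is an isomorphism from [V / W] to [V' / W']: the hypotheses say in turn
    that it is well placed, injective and surjective. *)
Lemma dim_quot_mul c V W V' W' d :
  subspace W' ->
  (forall z, V z -> V' (c * z)) -> (forall z, V z -> W' (c * z) <-> W z) ->
  (forall z', V' z' -> exists2 z, V z & W' (z' - c * z)) ->
  subspace V -> dim_quot V' W' d -> dim_quot V W d.
Proof.
move=> sW' VV' WW' surj sV dd; have [I [v [<- [Vv vW] span]]] := dd.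
have /choice[w wP] : forall i, exists z, V z /\ W' (v i - c * z).
  by move=> i; have [z Vz Wz] := surj _ (Vv i); exists z.
have Vw i : V (w i) by have [] := wP i.
have wv i : W' (v i - c * w i) by have [] := wP i.
exists I, w; split => //.
  split => // a Wa; apply: vW.
  have Va : V (lincomb a w) by exact: subspace_lincomb.
  have -> : lincomb a v = c * lincomb a w + lincomb a (fun i => v i - c * w i).
    by rewrite lincombM -big_split; apply: eq_bigr => i _ /=; ring.
  have [_ WD _] := sW'; apply: WD; first by apply/WW'.
  exact: subspace_lincomb.
move=> z Vz; have [a Wa] := span _ (VV' _ Vz).
exists a; apply/WW'; first by apply: subspaceB => //; exact: subspace_lincomb.
have -> : c * (z - lincomb a w) = (c * z - lincomb a v) + lincomb a (fun i => v i - c * w i).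
  rewrite mulrBr lincombM -addrA; congr (_ + _).
  rewrite /lincomb -sumrN -sumrN -big_split; apply: eq_bigr => i _ /=; ring.
have [_ WD _] := sW'; apply: WD => //; exact: subspace_lincomb.
Qed.

Lemma dim_quot_set0_card V d : subspace V -> dim_quot V [set 0] d ->
  finite_set V /\ #|` fset_set V| = (#|F| ^ d)%N.
Proof.
move=> sV [I [v [<- [Vv indep] span]]].
pose f (a : {ffun I -> F}) : K := lincomb a v.
have f_inj : injective f.
  move=> a b ab; apply/ffunP => i; apply/eqP; rewrite -subr_eq0; apply/eqP.
  apply: (indep (fun i => a i - b i)); rewrite -lincombB /=.
  by rewrite -/(f a) -/(f b) ab subrr.
have VE : V = range f.
  apply/seteqP; split => [z Vz|_ [a _ <-]]; last exact: subspace_lincomb.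
  have [a /eqP] := span z Vz; rewrite subr_eq0 => /eqP zE.
  exists (finfun a) => //; rewrite zE /f /lincomb.
  by apply: eq_bigr => i _; rewrite ffunE.
by rewrite VE; have [? ->] := card_range f_inj; rewrite card_ffun.
Qed.

End QuotientDimension.

(** * Independence of places and approximation *)

Section PlaceTheory.
Variables (F : finFieldType) (K : fieldType) (iota : {rmorphism F -> K}).
Implicit Types (p : place iota) (k l : int).

(** The disjunct [z = 0] stands for the valuation +oo of 0, which the convention [p 0 = 0] hides. *)
Definition ord_ge p k : set K := [set z | z = 0 \/ k <= p z].

Lemma ord_ge0 p k : ord_ge p k 0. Proof. by left. Qed.

Lemma ord_ge_le p k l z : l <= k -> ord_ge p k z -> ord_ge p l z.
Proof. by move=> lk [->|kz]; [left|right; exact: le_trans kz]. Qed.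

Lemma ord_geD p k u v : ord_ge p k u -> ord_ge p k v -> ord_ge p k (u + v).
Proof.
have [->|u0] := eqVneq u 0; first by rewrite add0r.
have [->|v0] := eqVneq v 0; first by rewrite addr0.
have [->|uv0] := eqVneq (u + v) 0; first by left.
move=> [/eqP|ku]; first by rewrite (negbTE u0).
move=> [/eqP|kv]; first by rewrite (negbTE v0).
by right; apply: le_trans (ordD p u0 v0 uv0); rewrite le_min ku.
Qed.

Lemma ord_geM p k l u v : ord_ge p k u -> ord_ge p l v -> ord_ge p (k + l) (u * v).
Proof.
have [->|u0] := eqVneq u 0; first by rewrite mul0r; left.
have [->|v0] := eqVneq v 0; first by rewrite mulr0; left.
move=> [/eqP|ku]; first by rewrite (negbTE u0).
move=> [/eqP|kv]; first by rewrite (negbTE v0).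
by right; rewrite ordM//; apply: lerD.
Qed.

Lemma ord_geC p a : ord_ge p 0 (iota a).
Proof.
by have [->|a0] := eqVneq a 0; [left; rewrite rmorph0|right; rewrite ord_const].
Qed.

Lemma subspace_ord_ge p k : subspace iota (ord_ge p k).
Proof.
split; [exact: ord_ge0|by move=> u v; exact: ord_geD|move=> a v kv].
by rewrite -[k]add0r; apply: ord_geM => //; exact: ord_geC.
Qed.

Lemma ord_geN p k u : ord_ge p k u -> ord_ge p k (- u).
Proof. exact: subspaceN (subspace_ord_ge p k). Qed.

Lemma ord_geE p k z : z != 0 -> ord_ge p k z <-> k <= p z.
Proof. by move=> z0; split; [case=> // /eqP; rewrite (negbTE z0)|right]. Qed.

Lemma ordX p z n : z != 0 -> p (z ^+ n) = p z *+ n.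
Proof.
move=> z0; elim: n => [|n IH]; first by rewrite expr0 ord1.
by rewrite exprS mulrS ordM ?IH// expf_neq0.
Qed.

Lemma ordXz p z k : z != 0 -> p (z ^ k) = p z * k.
Proof.
move=> z0; case: k => n; first by rewrite /exprz ordX// -mulr_natr pmulrn intz.
rewrite NegzE -invr_expz ordV ?expf_neq0// ordX// mulrN.
by rewrite -mulr_natr pmulrn intz.
Qed.

Lemma ord_add p u v : u != 0 -> v != 0 -> p u < p v -> u + v != 0 /\ p (u + v) = p u.
Proof.
move=> u0 v0 uv; have uv0 : u + v != 0.
  by apply: contraTneq uv => /eqP; rewrite addr_eq0 => /eqP ->; rewrite ordN ltxx.
split => //; apply/eqP; rewrite eq_le; apply/andP; split; last first.
  by apply: le_trans (ordD p u0 v0 uv0); rewrite le_min lexx ltW.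
have nv0 : - v != 0 by rewrite oppr_eq0.
have := @ordD _ _ _ p (u + v) (- v) uv0 nv0; rewrite addrK ordN => /(_ u0).
by rewrite ge_min => /orP[//|]; rewrite leNgt uv.
Qed.

Lemma place_ext p p' : (forall z, p z = p' z) -> p = p'.
Proof.
case: p p' => [f f0 fM fD fF ft] [g g0 gM gD gF gt] /= /funext fg.
by subst g; congr Place; exact: Prop_irrelevance.
Qed.

Lemma ord_unit_decomposition p t z : t != 0 -> p t = 1 -> z != 0 ->
  z = t ^ p z * (z * t ^ (- p z)) /\ p (z * t ^ (- p z)) = 0.
Proof.
move=> t0 pt z0; have tz k : t ^ k != 0 by rewrite expfz_neq0.
split; first by rewrite mulrCA -expfzDr// subrr expr0z mulr1.
by rewrite ordM// ordXz// pt mul1r subrr.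
Qed.

(** If the valuation ring of [p] were contained in that of [p'], then [p'] would be a multiple of
    [p]; as both are normalized, they would agree. *)
Lemma place_separation p p' : p != p' -> exists z, [/\ z != 0, 0 <= p z & p' z < 0].
Proof.
move=> /eqP pp'; apply/not_notP => H; apply: pp'; apply: place_ext.
have sub z : z != 0 -> 0 <= p z -> 0 <= p' z.
  by move=> z0 pz; rewrite leNgt; apply/negP => p'z; apply: H; exists z.
have sub0 z : z != 0 -> p z = 0 -> p' z = 0.
  move=> z0 pz; apply/eqP; rewrite eq_le sub ?pz// andbT -oppr_ge0 -ordV//.
  by apply: sub; rewrite ?invr_eq0// ordV// pz oppr0.
have [t t0 pt] := ord_uniformizer p; have [s s0 p's] := ord_uniformizer p'.
have p'E z : z != 0 -> p' z = p' t * p z.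
  move=> z0; have [zE pz0] := ord_unit_decomposition t0 pt z0.
  have w0 : z * t ^ (- p z) != 0 by rewrite mulf_neq0// expfz_neq0.
  have := congr1 (ord p') zE; rewrite ordM ?expfz_neq0// => ->.
  by rewrite (sub0 _ w0 pz0) addr0 ordXz.
have p't : p' t = 1.
  have := p'E s s0; rewrite p's; have := sub t t0; rewrite pt => /(_ isT).
  move: (p' t) (p s) => a b a0 ab1.
  by have : (b <= 0 \/ 1 <= b)%R; [clear; lia|case; clear -a0 ab1; nia].
move=> z; have [->|z0] := eqVneq z 0; first by rewrite !ord0.
by rewrite p'E// p't mul1r.
Qed.

(** Let [y] serve for [s], and let [z] have a zero at [p] and a pole at the new place [r]. If [y]
    has no pole at [r], then [y + z^k] serves for both, once [k] excludes equal orders, hence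
    cancellation, at the places of [s]. *)
Lemma separating_element p (s : seq (place iota)) : p \notin s ->
  exists u, [/\ u != 0, 0 < p u & forall p', p' \in s -> p' u < 0].
Proof.
elim: s => [|r s IH].
  by move=> _; have [t t0 pt] := ord_uniformizer p; exists t; rewrite pt.
rewrite inE negb_or => /andP[pr /IH[y [y0 py ys]]].
have [z1 [z10 pz1 rz1]] := place_separation pr.
have [z2 [z20 rz2 pz2]] : exists z, [/\ z != 0, 0 <= r z & p z < 0].
  by apply: place_separation; rewrite eq_sym.
pose z := z1 / z2.
have z0 : z != 0 by rewrite mulf_neq0 ?invr_eq0.
have pz : 0 < p z.
  by rewrite ordM ?invr_eq0// ordV// ltr_wpDl// oppr_gt0.
have rz : r z < 0.
  by rewrite ordM ?invr_eq0// ordV// ltr_wnDr// oppr_le0.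
have [ry|ry] := ltP (r y) 0.
  by exists y; split => // p'; rewrite inE => /orP[/eqP ->//|/ys].
(* Since [k] exceeds every [|q y|], the equality [k |q z| = |q y|] is impossible when [q y] is
   nonzero. *)
pose k := (1 + \sum_(q <- s) `|q y|)%N.
have k0 : (0 < k)%N by rewrite /k.
have kq q : q \in s -> (`|q y| < k)%N.
  by move=> qs; rewrite /k add1n ltnS (big_rem q)//= leq_addr.
have zk0 : z ^+ k != 0 by rewrite expf_neq0.
have sumneg (q : place iota) : q y < 0 \/ q z < 0 -> q (z ^+ k) != q y ->
    (q y < 0 \/ q (z ^+ k) < 0) -> y + z ^+ k != 0 /\ q (y + z ^+ k) < 0.
  move=> _; rewrite neq_lt => /orP[lt|lt] h.
    rewrite addrC; have [? ->] := ord_add zk0 y0 lt; split => //.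
    by case: h => // h; exact: lt_trans h.
  have [? ->] := ord_add y0 zk0 lt; split => //.
  by case: h => // h; exact: lt_trans h.
have rzk : r (z ^+ k) < 0 by rewrite ordX// pmulrn_llt0.
have [yz0 ryz] : y + z ^+ k != 0 /\ r (y + z ^+ k) < 0.
  by apply: sumneg; [right|rewrite lt_eqF// (lt_le_trans rzk)|right].
exists (y + z ^+ k); split => //.
  apply: lt_le_trans (ordD p y0 zk0 yz0); rewrite lt_min py ordX//.
  by rewrite pmulrn_lgt0.
move=> q; rewrite inE => /orP[/eqP -> //|qs].
have qy := ys q qs; have := kq q qs.
suff ne : q (z ^+ k) != q y by move=> _; apply: (sumneg q _ ne _).2; left.
rewrite ordX//; apply/eqP => e; have := kq q qs; rewrite -e.
rewrite -mulr_natr abszM natz absz_nat.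
case qz : (q z == 0); first by move: qy; rewrite -e (eqP qz) mul0rn ltxx.
have : (0 < `|q z|)%N by rewrite absz_gt0 qz.
by move=> h; rewrite ltnNge leq_pmull.
Qed.

(** If [u] has a zero at [p] and poles at the places of [s], then [1 / (1 + u^(m+1))] is close to 1
    at [p] and close to 0 on [s]. *)
Lemma approximation p (s : seq (place iota)) (m : nat) : p \notin s ->
  exists z, ord_ge p 1 (z - 1) /\ forall p', p' \in s -> ord_ge p' m z.
Proof.
move=> /separating_element[u [u0 pu us]].
pose w := u ^+ m.+1; have w0 : w != 0 by rewrite expf_neq0.
have pw : 0 < p w by rewrite ordX// pmulrn_lgt0.
have [w10 pw1] : 1 + w != 0 /\ p (1 + w) = 0.
  by have := @ord_add p 1 w; rewrite oner_eq0 ord1 => /(_ isT w0 pw).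
exists (1 + w)^-1; split.
  have -> : (1 + w)^-1 - 1 = - (w / (1 + w)) by field.
  apply: ord_geN; right; rewrite ordM ?invr_eq0// ordV// pw1 subr0.
  by move: pw; rewrite gtz0_ge1.
move=> q /us qu; right; rewrite ordV//.
have qw : q w < q 1 by rewrite ord1 ordX// pmulrn_llt0.
have n10 : (1 : K) != 0 by exact: oner_neq0.
have [_] := ord_add w0 n10 qw; rewrite addrC => ->.
rewrite ordX// -mulNrn; apply: (@le_trans _ _ (m.+1)%:Z); first by rewrite lez_nat.
have : 1 <= - q u by move: qu; rewrite -oppr_gt0 gtz0_ge1.
by move=> h; rewrite -[X in X <= _]mulr1 -[_ *+ m.+1]mulr_natl natz ler_pM2l.
Qed.

End PlaceTheory.

(** * Divisors and Riemann's theorem *)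

Lemma fin_over_dim_le (F : finFieldType) (K : fieldType) (iota : {rmorphism F -> K})
    (O : set K) (y : K) (N : nat) :
  (forall a, O (iota a)) -> (forall u v, O u -> O v -> O (u + v)) ->
  (forall u v, O u -> O v -> O (u * v)) -> O y -> y != 0 -> fin_over iota y N ->
  dim_le iota O [set z | exists2 w, O w & z = y * w] N.
Proof.
move=> OF OD OM Oy y0 finy I v [Ov indep]; rewrite leqNgt; apply/negP => NI.
pose f (j : 'I_N.+1) : I := enum_val (widen_ord NI j).
have f_inj : injective f by move=> i j /enum_val_inj /(congr1 val) /= /val_inj.
have [a [[j aj] [z Oz az]]] := fin_over_residues y0 finy OF OD OM Oy (fun j => Ov (f j)).
pose c i := \sum_(j | f j == i) a j.
have cf l : c (f l) = a l.
  by rewrite /c (bigD1 l)//= big1 ?addr0// => l' /andP[/eqP /f_inj -> /eqP].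
move/eqP: aj; apply; rewrite -cf; apply: indep; exists z => //; rewrite -az /lincomb.
rewrite (partition_big f xpredT)//=; apply: eq_bigr => i _.
by rewrite rmorph_sum mulr_suml; apply: eq_bigr => l /eqP ->.
Qed.

Section ResidueDegree.
Variables (F : finFieldType) (K : fieldType) (iota : {rmorphism F -> K}).
Implicit Types p : place iota.

(** The default 0 is never taken for a function field: [residue_deg_exists] provides the dimension,
    which is positive. *)
Definition residue_deg p : nat :=
  xget 0%N [set d | dim_quot iota (ord_ge p 0) (ord_ge p 1) d].

Lemma place_norm_card p d :
  dim_quot iota (ord_ge p 0) (ord_ge p 1) d -> place_norm p = (#|F| ^ d)%N.
Proof.
move=> [I [v [<- [Vv indep] span]]].
have in_local (z : K) : ord_ge p 0 z -> z \in valuation_ring p.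
  by case=> [->|//]; rewrite unfold_in /= ord0.
have lc_ge0 (a : {ffun I -> F}) : ord_ge p 0 (lincomb iota a v).
  by apply: subspace_lincomb => //; exact: subspace_ord_ge.
pose g (a : {ffun I -> F}) : local_ring p := Sub (lincomb iota a v) (in_local _ (lc_ge0 a)).
pose f (a : {ffun I -> F}) : residue_field p := \pi_(residue_field p)%qT (g a).
have piE (u w : local_ring p) :
    (\pi_(residue_field p)%qT u == \pi_(residue_field p)%qT w) = (u - w \in @maximal_ideal _ _ _ p).
  by rewrite Quotient.idealrBE.
have mE (u : local_ring p) : u \in @maximal_ideal _ _ _ p <-> ord_ge p 1 (val u).
  rewrite unfold_in /maximal_ideal; split=> [/orP[/eqP|]|[->|]]; rewrite ?eqxx ?orbT//.
  - by left.
  - by rewrite gtz0_ge1; right.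
  - by rewrite -gtz0_ge1 => ->; rewrite orbT.
have f_inj : injective f.
  move=> a b /eqP; rewrite piE => /mE /=; rewrite lincombB => /indep ab.
  by apply/ffunP => i; apply/eqP; rewrite -subr_eq0; apply/eqP/ab.
have fT : [set: residue_field p] = range f.
  apply/seteqP; split => // u _.
  have ru : ord_ge p 0 (val (repr u)) by right; exact: (valP (repr u)).
  have [a au] := span _ ru; exists (finfun a) => //.
  rewrite -[u]reprK; apply/eqP; rewrite eq_sym piE; apply/mE => /=.
  have -> : lincomb iota (finfun a) v = lincomb iota a v.
    by apply: eq_bigr => i _; rewrite ffunE.
  exact: au.
by rewrite /place_norm fT; have [_ ->] := card_range f_inj; rewrite card_ffun.
Qed.

End ResidueDegree.

Section EffectiveInduction.
Variables (T : choiceType).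
Implicit Types D : {freeg T / int}.

Lemma effective_ind (P : {freeg T / int} -> Prop) : P 0 ->
  (forall D p, (forall q, 0 <= coeff q D) -> P D -> P (D + << p >>)) ->
  forall D, (forall q, 0 <= coeff q D) -> P D.
Proof.
move=> P0 PS; elim/freeg_ind_dom0 => // k p D pD k0 IH D0.
have Dp : coeff p D = 0 by exact: coeff_outdom.
have Dge q : 0 <= coeff q D.
  have [->|qp] := eqVneq q p; first by rewrite Dp.
  by have := D0 q; rewrite coeffD coeffU eq_sym (negbTE qp) mulr0 add0r.
have k_ge0 : 0 <= k by have := D0 p; rewrite coeffD coeffU eqxx mulr1 Dp addr0.
case: k k_ge0 {k0 D0} => // m _; elim: m => [|m IHm].
  by rewrite freegU0 add0r; exact: IH.
rewrite -addn1 PoszD -freegUD addrAC; apply: PS => // q.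
by rewrite coeffD coeffU; apply: addr_ge0 => //; case: eqP => _; rewrite ?mulr1 ?mulr0.
Qed.

End EffectiveInduction.

Section Divisors.
Variables (F : finFieldType) (K : fieldType) (iota : {rmorphism F -> K}).
Implicit Types (p : place iota) (A B D : divisor iota) (S : set (place iota)).

Definition div_deg D : int := fglift (fun p => (residue_deg p)%:Z : int^o) D.

Lemma div_deg_is_additive : additive div_deg.
Proof. exact: (@lift_is_additive _ _ int^o). Qed.

HB.instance Definition _ :=
  GRing.isAdditive.Build (divisor iota) int div_deg div_deg_is_additive.

Lemma div_deg0 : div_deg 0 = 0.
Proof. exact: raddf0. Qed.

Lemma div_degD : {morph div_deg : A B / A + B}.
Proof. exact: raddfD. Qed.

Lemma div_degN : {morph div_deg : A / - A}.
Proof. exact: raddfN. Qed.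

Lemma div_degU k p : div_deg << k *g p >> = k * (residue_deg p)%:Z.
Proof. by rewrite /div_deg liftU. Qed.

Definition effective D : Prop := forall p, 0 <= coeff p D.

Lemma div_deg_ge0 D : effective D -> 0 <= div_deg D.
Proof.
move: D; apply: effective_ind => [|D p _ IH]; first by rewrite raddf0.
by rewrite div_degD div_degU mul1r addr_ge0.
Qed.

(* With [S] all places this is the Riemann-Roch space of [A]. *)
Definition rr_space S A : set K :=
  [set z | forall p, S p -> ord_ge p (- coeff p A) z].

Lemma subspace_rr S A : subspace iota (rr_space S A).
Proof.
split=> [p _|u v Au Av p Sp|a v Av p Sp]; first exact: ord_ge0.
  by apply: ord_geD; [exact: Au|exact: Av].
by have [_ _] := subspace_ord_ge p (- coeff p A); apply; exact: Av.
Qed.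

Lemma rr_space_le S A B : (forall p, S p -> coeff p A <= coeff p B) ->
  rr_space S A `<=` rr_space S B.
Proof. by move=> AB z Az p Sp; apply: ord_ge_le (Az p Sp); rewrite lerN2 AB. Qed.

Hypothesis residue_deg_exists : forall p,
  exists d, dim_quot iota (ord_ge p 0) (ord_ge p 1) d.

Lemma residue_degP p : dim_quot iota (ord_ge p 0) (ord_ge p 1) (residue_deg p).
Proof. exact: (xgetPex 0%N (residue_deg_exists p)). Qed.

Lemma place_normE p : place_norm p = (#|F| ^ residue_deg p)%N.
Proof. exact: place_norm_card (residue_degP p). Qed.

Lemma residue_deg_gt0 p : (0 < residue_deg p)%N.
Proof.
have := dim_quot_le (subspace_ord_ge p 1) (residue_degP p).
move=> /(_ 'I_1 (fun=> 1)); rewrite card_ord; apply; split=> [_|a].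
  by right; rewrite ord1.
rewrite /lincomb big_ord1 mulr1 => h i; rewrite (fintype.ord1 i).
have [->//|a0] := eqVneq (a fintype.ord0) 0.
by case: h => [/eqP|]; [rewrite fmorph_eq0|rewrite ord_const// ltr10]; move=> // /eqP.
Qed.

Section Step.
Variables (S : set (place iota)) (A : divisor iota) (p : place iota).
Hypothesis Sp : S p.

(** Multiplication by this power of [t] turns the order at [p] allowed by [A + << p >>] into 0 and
    the one allowed by [A] into 1. At the other places both spaces impose the same condition. *)
Let step_mul t z : t != 0 -> p t = 1 -> rr_space S (A + << p >>) z ->
  ord_ge p 0 (t ^ (coeff p A + 1) * z) /\
  (ord_ge p 1 (t ^ (coeff p A + 1) * z) <-> rr_space S A z).
Proof.
move=> t0 pt Az; have tz k : t ^ k != 0 by rewrite expfz_neq0.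
have [->|z0] := eqVneq z 0.
  rewrite mulr0; split; first by left.
  by split => _; [move=> q _|]; left.
have tzz k : t ^ k * z != 0 by rewrite mulf_neq0.
have pE k : p (t ^ k * z) = k + p z by rewrite ordM// ordXz// pt mul1r.
have := Az p Sp; rewrite coeffD coeffU eqxx mulr1 => /(ord_geE _ _ z0) pz; split.
  by apply/ord_geE => //; rewrite pE; move: pz; clear; lia.
split=> [/(ord_geE _ _ (tzz _))|/(_ p Sp) /(ord_geE _ _ z0) h]; last first.
  by apply/ord_geE => //; rewrite pE; move: h; clear; lia.
rewrite pE => h q Sq; apply/ord_geE => //.
have [->|qp] := eqVneq q p; first by move: h; clear; lia.
have /(ord_geE _ _ z0) := Az q Sq.
by rewrite coeffD coeffU eq_sym (negbTE qp) mulr0 addr0.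
Qed.

Lemma rr_step_le : dim_le iota (rr_space S (A + << p >>)) (rr_space S A) (residue_deg p).
Proof.
have [t t0 pt] := ord_uniformizer p.
move=> I v [Vv indep].
apply: (dim_quot_le (subspace_ord_ge p 1) (residue_degP p) (v := fun i => t ^ (coeff p A + 1) * v i)).
split=> [i|a]; first by have [] := step_mul t0 pt (Vv i).
rewrite -lincombM => h; apply: indep.
by apply/(step_mul t0 pt _).2 => //; apply: subspace_lincomb => //; exact: subspace_rr.
Qed.

(** For finite [S] every residue at [p] is attained: a lift is multiplied by an element that is
    close to 1 at [p] and vanishes to high order on the rest of [S]. *)
Lemma rr_step_eq : finite_set S ->
  dim_quot iota (rr_space S (A + << p >>)) (rr_space S A) (residue_deg p).
Proof.
move=> finS; have [t t0 pt] := ord_uniformizer p.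
have tz k : t ^ k != 0 by rewrite expfz_neq0.
apply: (@dim_quot_mul _ _ _ (t ^ (coeff p A + 1)) _ _ _ _ _ (subspace_ord_ge p 1)
  _ _ _ (subspace_rr _ _) (residue_degP p)).
- by move=> z /(step_mul t0 pt) [].
- by move=> z /(step_mul t0 pt) [].
move=> z' z'0; set k := coeff p A + 1.
pose s := [seq q <- fset_set S | q != p].
have ps : p \notin s by rewrite mem_filter eqxx.
(* At each remaining place, a zero of order [M] outweighs the poles of [z'] and of [t ^ (- k)] and
   the order required by [A]. *)
pose M := (\sum_(q <- s) (`|coeff q A| + `|q (t ^ (- k))%R| + `|q z'|))%N.
have [w [w1 ws]] := approximation M ps.
exists (t ^ (- k) * (z' * w)); last first.
  rewrite mulrA -expfzDr// subrr expr0z mul1r.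
  have -> : z' - z' * w = - (z' * (w - 1)) by rewrite mulrBr mulr1 opprB.
  by apply: ord_geN; rewrite -[1]add0r; exact: ord_geM.
have [->|z'n0] := eqVneq z' 0; first by rewrite mul0r mulr0 => q _; left.
move=> q Sq; have [->|qp] := eqVneq q p.
  have wp : ord_ge p 0 w.
    rewrite -[w](subrK 1); apply: ord_geD; first exact: ord_ge_le w1.
    by right; rewrite ord1.
  rewrite coeffD coeffU eqxx mulr1.
  apply: (@ord_ge_le _ _ _ _ (- k + (0 + 0))); first by rewrite !addr0.
  apply: ord_geM; last exact: ord_geM.
  by right; rewrite ordXz// pt mul1r.
have qs : q \in s by rewrite mem_filter qp in_fset_set// inE.
have [->|w0] := eqVneq w 0; first by left; rewrite !mulr0.
have /(ord_geE _ _ w0) := ws q qs.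
rewrite coeffD coeffU eq_sym (negbTE qp) mulr0 addr0 => qw; right.
rewrite !ordM ?mulf_neq0//.
have : (`|coeff q A| + `|q (t ^ (- k))%R| + `|q z'| <= M)%N.
  by rewrite /M (big_rem q)//= leq_addr.
move: qw; generalize (coeff q A) (q (t ^ (- k))) (q z') (q w) M; clear; lia.
Qed.

End Step.

Lemma rr_dim_le S A D : (forall p, coeff p D != 0 -> S p) -> effective D ->
  exists2 d : nat, d%:Z <= div_deg D & dim_quot iota (rr_space S (A + D)) (rr_space S A) d.
Proof.
move=> SD D0; move: D D0 SD; apply: effective_ind => [_|D p D0 IH SD].
  exists 0%N; first by rewrite div_deg0.
  rewrite addr0; exists 'I_0, (fun=> 0); rewrite card_ord; split => //.
    by split => [[]//|a _ []].
  by move=> z Az; exists (fun=> 0); rewrite /lincomb big_ord0 subr0.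
have [|d dD dimD] := IH.
  move=> q qD; apply: SD; rewrite coeffD coeffU mul1r.
  by rewrite gt_eqF// ltr_wpDr// lt_neqAle eq_sym qD D0.
have Sp : S p.
  by apply: SD; rewrite coeffD coeffU mul1r eqxx gt_eqF// ltr_wpDl.
have [e ep dime] := dim_le_quot (subspace_rr S (A + D)) (@rr_step_le S (A + D) p Sp).
exists (e + d)%N; first by rewrite div_degD div_degU mul1r PoszD addrC lerD// lez_nat.
rewrite addrA; apply: (dim_quot_trans (subspace_rr _ _) (subspace_rr _ _) _ _ dime dimD).
  by apply: rr_space_le => q _; rewrite !coeffD lerDl coeffU mul1r.
by apply: rr_space_le => q _; rewrite coeffD lerDl.
Qed.

Lemma rr_dim_eq S A D : finite_set S -> (forall p, coeff p D != 0 -> S p) -> effective D ->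
  exists2 d : nat, d%:Z = div_deg D & dim_quot iota (rr_space S (A + D)) (rr_space S A) d.
Proof.
move=> finS SD D0; move: D D0 SD; apply: effective_ind => [_|D p D0 IH SD].
  exists 0%N; first by rewrite div_deg0.
  rewrite addr0; exists 'I_0, (fun=> 0); rewrite card_ord; split => //.
    by split => [[]//|a _ []].
  by move=> z Az; exists (fun=> 0); rewrite /lincomb big_ord0 subr0.
have [|d dD dimD] := IH.
  move=> q qD; apply: SD; rewrite coeffD coeffU mul1r.
  by rewrite gt_eqF// ltr_wpDr// lt_neqAle eq_sym qD D0.
have Sp : S p.
  by apply: SD; rewrite coeffD coeffU mul1r eqxx gt_eqF// ltr_wpDl.
exists (residue_deg p + d)%N; first by rewrite div_degD div_degU mul1r PoszD addrC dD.
rewrite addrA; apply: (dim_quot_trans (subspace_rr _ _) (subspace_rr _ _) _ _ _ dimD).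
- by apply: rr_space_le => q _; rewrite !coeffD lerDl coeffU mul1r.
- by apply: rr_space_le => q _; rewrite coeffD lerDl.
- exact: rr_step_eq.
Qed.

(** Let [O] be the ring of elements integral on [s], and [D] the part of the zero divisor of [y]
    supported there. Then [O / L_S(-D)] has dimension [deg D]; since [L_S(-D)] contains [y O], this
    is at most the dimension of [O / y O], hence at most [N]. *)
Lemma sum_zeros_le y N (s : seq (place iota)) : y != 0 -> fin_over iota y N -> uniq s ->
  (forall p, p \in s -> 0 < p y) ->
  \sum_(p <- s) p y * (residue_deg p)%:Z <= N%:Z.
Proof.
move=> y0 finy us sy; pose S : set (place iota) := [set` s].
pose D : divisor iota := \sum_(p <- s) << p y *g p >>.
have coeffDE q : coeff q D = if q \in s then q y else 0.
  rewrite /D raddf_sum /=; case: ifP => qs.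
    rewrite (bigD1_seq q)//= coeffU eqxx mulr1 big1 ?addr0// => p pq.
    by rewrite coeffU (negbTE pq) mulr0.
  rewrite big_seq big1// => p ps; rewrite coeffU.
  by case: eqP => [pq|_]; [rewrite pq qs in ps|rewrite mulr0].
have -> : \sum_(p <- s) p y * (residue_deg p)%:Z = div_deg D.
  by rewrite /D raddf_sum; apply: eq_bigr => p _ /=; rewrite div_degU.
have D0 : effective D by move=> q; rewrite coeffDE; case: ifP => // /sy/ltW.
have SD p : coeff p D != 0 -> S p by rewrite coeffDE; case: ifP; rewrite ?eqxx.
have [d <- dimd] := @rr_dim_eq S (- D) D (finite_seq s) SD D0.
rewrite lez_nat addNr in dimd *.
have [I [v [<- iv _]]] := dimd.
have := @fin_over_dim_le F K iota (rr_space S 0) y N; apply => //.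
- by move=> a p _; rewrite coeff0 oppr0; exact: ord_geC.
- by have [] := subspace_rr S 0.
- move=> u w Au Aw p Sp; have := ord_geM (Au p Sp) (Aw p Sp).
  by rewrite coeff0 oppr0 addr0.
- by move=> p Sp; right; rewrite coeff0 oppr0 ltW// sy.
case: iv => Vv indep; split => // a [w Aw E]; apply: indep => p Sp.
rewrite E coeffN opprK -[coeff p D]addr0; apply: ord_geM.
  by right; rewrite coeffDE ifT.
by have := Aw p Sp; rewrite coeff0 oppr0.
Qed.

Lemma finite_zeros y N : y != 0 -> fin_over iota y N -> finite_set [set p : place iota | 0 < p y].
Proof.
move=> y0 finy; apply/not_notP => /(infinite_set_fset N.+1)[B Bsub NB].
have Bpos p : p \in (B : seq _) -> 0 < p y by move=> pB; exact: Bsub.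
have := sum_zeros_le y0 finy (fset_uniq B) Bpos; apply/negP; rewrite -ltNge.
apply: (@lt_le_trans _ _ (size (B : seq _))%:Z); first by rewrite ltz_nat.
have -> : (size (B : seq _))%:Z = \sum_(p <- (B : seq _)) 1 :> int.
  by rewrite big_const_seq count_predT iter_addr addr0 natz.
rewrite [leLHS]big_seq [leRHS]big_seq; apply: ler_sum => p /Bpos py.
by have := residue_deg_gt0 p; move: py; clear; nia.
Qed.

End Divisors.

(** * Degrees of principal divisors and Riemann's theorem *)

Section RiemannTheorem.
Variables (F : finFieldType) (K : fieldType) (iota : {rmorphism F -> K}).
Variables (x : K) (n : nat) (b : 'I_n -> K).
Hypothesis x_trans : ~ algebraicOver iota x.
Hypothesis b_span : forall y : K,
  exists p q : 'I_n -> {poly F}, (forall i, q i != 0) /\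
    y = \sum_(i < n) ev iota x (p i) / ev iota x (q i) * b i.
Hypothesis b_free : forall c : 'I_n -> {poly F},
  \sum_i ev iota x (c i) * b i = 0 -> forall i, c i = 0.
Implicit Types (p : place iota) (A D : divisor iota).

Let x0 : x != 0. Proof. exact: trans_neq0 x_trans. Qed.
Let fx : fin_over iota x n. Proof. exact: fin_over_x x_trans b_span. Qed.

(** The residue field is a quotient of [O / y O] for a nonunit [y] of the valuation ring [O] over
    which [K] is finite. *)
Lemma residue_deg_exists p : exists d, dim_quot iota (ord_ge p 0) (ord_ge p 1) d.
Proof.
have [t t0 pt] := ord_uniformizer p.
have OM u v : ord_ge p 0 u -> ord_ge p 0 v -> ord_ge p 0 (u * v).
  by move=> pu pv; have := ord_geM pu pv; rewrite addr0.
have [|| y [N [y0 Oy nOy finy]]] :=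
    fin_over_nonunit x_trans b_span (ord_geC p) (@ord_geD _ _ _ p 0) OM.
- move=> u; have [pu|pu] := leP 0 (p u); first by left; right.
  have [->|u0] := eqVneq u 0; first by left; left.
  by right; right; rewrite ordV// oppr_ge0 ltW.
- exists t^-1; case => [/eqP|]; first by rewrite invr_eq0 (negbTE t0).
  by rewrite ordV// pt.
have py : 0 < p y.
  rewrite ltNge; apply/negP => py; apply: nOy; right.
  by rewrite ordV// oppr_ge0.
have [|d _ dd] := @dim_le_quot _ _ iota (ord_ge p 0) (ord_ge p 1) N (subspace_ord_ge p 1); last by exists d.
apply: (dim_le_mul (c := 1) _ _ (fin_over_dim_le (ord_geC p) (@ord_geD _ _ _ p 0) OM Oy y0 finy)).
  by move=> z; rewrite mul1r.
move=> z [w Ow]; rewrite mul1r => ->; rewrite -[1]addr0; apply: ord_geM => //.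
by right; move: py; rewrite gtz0_ge1.
Qed.

Let degE := residue_deg_exists.

Lemma ev_ord_ge p z f : 0 <= p z -> ord_ge p 0 (ev iota z f).
Proof.
move=> pz; elim/poly_ind: f => [|f a IH]; first by rewrite rmorph0; left.
rewrite rmorphD rmorphM /= evX evC; apply: ord_geD; last exact: ord_geC.
by rewrite -[0]addr0; apply: ord_geM => //; right.
Qed.

(** At a pole of [z] the leading term of [f(z)] dominates. *)
Lemma ord_ev_pole p z f : p z < 0 -> f != 0 ->
  ev iota z f != 0 /\ p (ev iota z f) = p z *+ (size f).-1.
Proof.
move=> pz; have z0 : z != 0 by apply: contraTneq pz => ->; rewrite ord0.
elim/poly_ind: f => [|f a IH]; first by rewrite eqxx.
move=> fa0; rewrite rmorphD rmorphM /= evX evC.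
have [f0|f0] := eqVneq f 0.
  move: fa0; rewrite f0 mul0r add0r rmorph0 mul0r add0r polyC_eq0 => a0.
  by rewrite fmorph_eq0 size_polyC a0 ord_const.
have [ef0 pef] := IH f0; rewrite size_MXaddC (negbTE f0) /=.
have efz0 : ev iota z f * z != 0 by rewrite mulf_neq0.
have pefz : p (ev iota z f * z) = p z *+ size f.
  by rewrite ordM// pef -mulrSr prednK// lt0n size_poly_eq0.
have [->|a0] := eqVneq a 0; first by rewrite rmorph0 addr0.
rewrite -pefz; apply: ord_add; rewrite ?fmorph_eq0// pefz ord_const//.
by rewrite pmulrn_llt0// lt0n size_poly_eq0.
Qed.

Lemma algebraic_ord_eq0 p z : algebraicOver iota z -> p z = 0.
Proof.
have [->|z0] := eqVneq z 0; first by rewrite ord0.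
have pos u : algebraicOver iota u -> 0 <= p u.
  move=> [f f0 /rootP fu]; rewrite leNgt; apply/negP => pu.
  by have [/eqP] := ord_ev_pole pu f0.
move=> az; apply/eqP; rewrite eq_le pos// andbT -oppr_ge0 -ordV// pos//.
exact: algebraic_inv.
Qed.

Lemma transcendental_pole z : ~ algebraicOver iota z -> exists p : place iota, p z < 0.
Proof. exact: transcendental_has_pole x_trans b_span z. Qed.

Lemma finite_poles_x : finite_set [set p : place iota | p x < 0].
Proof.
have := finite_zeros degE (y := x^-1) _ (fin_over_inv x0 fx).
rewrite invr_eq0 => /(_ x0); apply: sub_finite_set => p /=.
by rewrite ordV// oppr_gt0.
Qed.

Lemma finite_zeros_poly f : f != 0 -> finite_set [set p : place iota | 0 < p (ev iota x f)].
Proof.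
move=> f0; have [sf|sf] := ltnP 1 (size f).
  apply: (finite_zeros degE _ (fin_over_poly x_trans b_span sf)).
  exact: transcendental_ev_neq0.
rewrite [X in finite_set X](_ : _ = set0)//; apply/seteqP; split => p //=.
have fE := size1_polyC sf; rewrite fE evC ord_const ?ltxx//.
by apply: contra_neq f0 => e; rewrite fE e.
Qed.

(** At a zero of [z] where [x] has no pole, a relation between the powers of [z] over [F[x]] forces
    its first nonzero coefficient to vanish as well. *)
Lemma finite_zeros_all z : z != 0 -> finite_set [set p : place iota | 0 < p z].
Proof.
move=> z0; have [c [[j cj] cz]] := fx (fun j => z ^+ j).
case: (@arg_minnP _ j (fun i => c i != 0) (fun i => nat_of_ord i) cj) => i ci imin.
apply: (@sub_finite_set _ _ ([set p : place iota | p x < 0] `|`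
    [set p : place iota | 0 < p (ev iota x (c i))])); last first.
  by rewrite finite_setU; split; [exact: finite_poles_x|exact: finite_zeros_poly].
move=> p /= pz; have [px|px] := ltP (p x) 0; [by left|right] => /=.
have : ord_ge p 1 (ev iota x (c i)).
  have -> : ev iota x (c i) = - (z * \sum_(l | l != i) ev iota x (c l) * z ^+ (l - i).-1).
    apply: (mulIf (expf_neq0 i z0)); rewrite mulNr.
    apply/eqP; rewrite -addr_eq0 -[X in _ == X]cz [X in _ == X](bigD1 i)//= mulr_sumr mulr_suml.
    apply/eqP; congr (_ + _); apply: eq_bigr => l li.
    have [->|cl] := eqVneq (c l) 0; first by rewrite rmorph0 !(mul0r, mulr0).
    have il : (i < l)%N.
      by rewrite ltn_neqAle imin// andbT; apply: contraNneq li => /val_inj ->.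
    by rewrite mulrCA -exprS prednK ?subn_gt0// -mulrA -exprD subnK// ltnW.
  apply: ord_geN; rewrite -[1]addr0; apply: ord_geM; first by right; rewrite -gtz0_ge1.
  apply: (big_ind (ord_ge p 0)); [exact: ord_ge0|by move=> u v; exact: ord_geD|].
  move=> l _; rewrite -[0]addr0; apply: ord_geM; first exact: ev_ord_ge.
  by right; rewrite ordX// mulrn_wge0// ltW.
move=> /(ord_geE _ _ (transcendental_ev_neq0 x_trans ci)).
by rewrite gtz0_ge1.
Qed.

Lemma finite_support z : z != 0 -> finite_set [set p : place iota | p z != 0].
Proof.
move=> z0; apply: (@sub_finite_set _ _ ([set p : place iota | 0 < p z] `|` [set p | 0 < p z^-1])).
  by move=> p /=; rewrite ordV// oppr_gt0 neq_lt => /orP[]; [right|left].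
by rewrite finite_setU; split; apply: finite_zeros_all; rewrite ?invr_eq0.
Qed.

Definition divisor_on (S : set (place iota)) (f : place iota -> int) : divisor iota :=
  \sum_(p <- fset_set S) << f p *g p >>.

Lemma coeff_divisor_on S f q : finite_set S ->
  coeff q (divisor_on S f) = if `[< S q >] then f q else 0.
Proof.
move=> finS; rewrite /divisor_on raddf_sum /=; case: asboolP => Sq.
  rewrite (bigD1_seq q) ?fset_uniq ?in_fset_set ?inE//= coeffU eqxx mulr1.
  by rewrite big1 ?addr0// => p pq; rewrite coeffU (negbTE pq) mulr0.
rewrite big_seq big1// => p; rewrite in_fset_set// inE => Sp; rewrite coeffU.
by case: eqP => [pq|_]; [rewrite pq in Sp|rewrite mulr0].
Qed.

Lemma div_deg_divisor_on S f :
  div_deg (divisor_on S f) = \sum_(p <- fset_set S) f p * (residue_deg p)%:Z.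
Proof. by rewrite /divisor_on raddf_sum; apply: eq_bigr => p _ /=; rewrite div_degU. Qed.

Definition div_of z : divisor iota := divisor_on [set p | p z != 0] (fun p => p z).

Lemma coeff_div_of p z : z != 0 -> coeff p (div_of z) = p z.
Proof.
move=> z0; rewrite coeff_divisor_on; last exact: finite_support.
by case: asboolP => //= /negP/negPn/eqP.
Qed.

Lemma div_of_eq z D : z != 0 -> (forall p, coeff p D = p z) -> D = div_of z.
Proof.
by move=> z0 Dz; apply/eqP/freeg_eqP => p; rewrite coeff_div_of.
Qed.

Lemma div_ofM u v : u != 0 -> v != 0 -> div_of (u * v) = div_of u + div_of v.
Proof.
move=> u0 v0; apply/esym/div_of_eq; first exact: mulf_neq0.
by move=> p; rewrite coeffD !coeff_div_of// ordM.
Qed.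

Lemma div_ofX u k : u != 0 -> div_of (u ^+ k) = div_of u *+ k.
Proof.
move=> u0; apply/esym/div_of_eq; first exact: expf_neq0.
by move=> p; rewrite coeffMn !coeff_div_of// ordX.
Qed.

Lemma div_ofV u : u != 0 -> div_of u^-1 = - div_of u.
Proof.
move=> u0; apply/esym/div_of_eq; first by rewrite invr_eq0.
by move=> p; rewrite coeffN !coeff_div_of// ordV.
Qed.

Definition rr A := rr_space setT A.

Lemma rrE A z : z != 0 -> rr A z <-> effective (A + div_of z).
Proof.
move=> z0; split=> [Az p|Az p _].
  have /(ord_geE _ _ z0) := Az p I.
  by rewrite coeffD coeff_div_of// addrC -lerBlDr sub0r.
apply/(ord_geE _ _ z0); have := Az p; rewrite coeffD coeff_div_of//.
by rewrite addrC -lerBlDr sub0r.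
Qed.

Lemma effective_bound A : exists2 D, effective D & forall p, coeff p A <= coeff p D.
Proof.
exists (fgpos A) => p; rewrite coeff_fgposE; first by rewrite le_max lexx.
by rewrite le_max lexx orbT.
Qed.

(** A nonzero element of [L(-p0)] has no pole, so it is algebraic over [F] and has order 0
    everywhere, against its zero at [p0]. From [L(-p0) = 0] the dimension grows at most by the
    degree. *)
Lemma rr_finite A : exists d, dim_quot iota (rr A) [set 0] d.
Proof.
have [p0 p0x] := transcendental_pole x_trans.
have [D D0 AD] := effective_bound (A + << p0 >>).
have rr0 : rr (- << p0 >>) = [set 0].
  apply/seteqP; split=> [z Az|_ -> p _]; last by left.
  have [//|z0] := eqVneq z 0.
  have pge p : p != p0 -> 0 <= p z.
    move=> pp0; have /(ord_geE _ _ z0) := Az p I.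
    by rewrite coeffN opprK coeffU eq_sym (negbTE pp0).
  have p0z : 1 <= p0 z.
    have /(ord_geE _ _ z0) := Az p0 I.
    by rewrite coeffN opprK coeffU eqxx.
  have [az|tz] := pselect (algebraicOver iota z).
    by move: p0z; rewrite (algebraic_ord_eq0 p0 az).
  have [p pz] := transcendental_pole tz; move: pz.
  have [->|/pge pz] := eqVneq p p0; rewrite ltNge; last by rewrite pz.
  by rewrite (le_trans _ p0z).
have [d _ dd] := @rr_dim_le _ _ _ degE setT (- << p0 >>) D (fun _ _ => I) D0.
have dle := dim_quot_le (subspace0 iota) (eq_ind _ (fun W => dim_quot iota _ W d) dd _ rr0).
have [|e _ de] := @dim_le_quot _ _ iota (rr A) [set 0] d (subspace0 iota); last by exists e.
apply: (dim_le_mul (c := 1) _ _ dle) => z; rewrite mul1r//.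
apply: rr_space_le => p _; rewrite coeffD -lerBlDl -coeffB opprK; exact: AD.
Qed.

(** The dimension is over [F]; thus [ell 0] is the degree over [F] of the field of constants of
    [K]. *)
Definition ell A : nat := xget 0%N [set d | dim_quot iota (rr A) [set 0] d].

Lemma ellP A : dim_quot iota (rr A) [set 0] (ell A).
Proof. exact: (xgetPex 0%N (rr_finite A)). Qed.

Lemma ell_uniq A d : dim_quot iota (rr A) [set 0] d -> ell A = d.
Proof. exact: dim_quot_unique (subspace0 iota) (ellP A). Qed.

Lemma ell_le A D : effective D ->
  (ell A <= ell (A + D)%R)%N /\ (ell (A + D))%:Z <= (ell A)%:Z + div_deg D.
Proof.
move=> D0; have [d dD dd] := @rr_dim_le _ _ _ degE setT A D (fun _ _ => I) D0.
have sub0 : [set 0] `<=` rr A by move=> _ -> p _; left.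
have subA : rr A `<=` rr (A + D).
  by apply: rr_space_le => p _; rewrite coeffD lerDl.
have /ell_uniq -> := dim_quot_trans (subspace_rr _ _) (subspace0 iota) subA sub0 dd (ellP A).
by rewrite leq_addl PoszD addrC lerD2l.
Qed.

Lemma ell_div A z : z != 0 -> ell (A - div_of z) = ell A.
Proof.
move=> z0; apply: ell_uniq; have zV0 : z^-1 != 0 by rewrite invr_eq0.
have mulE B u w : u != 0 -> rr (B + div_of u) w -> rr B (u * w).
  move=> u0; have [->|w0] := eqVneq w 0; first by rewrite mulr0 => _ p _; left.
  move=> /(rrE _ w0) h; apply/rrE; first exact: mulf_neq0.
  by rewrite div_ofM// addrA.
apply: (@dim_quot_mul _ _ iota z^-1 _ _ _ _ _ (subspace0 iota) _ _ _ (subspace_rr _ _) (ellP A)).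
- move=> w Aw; apply: mulE => //; rewrite div_ofV//; exact: Aw.
- move=> w _ /=; split=> [/eqP|->]; last by rewrite mulr0.
  by rewrite mulf_eq0 (negbTE zV0) => /eqP.
- move=> w Aw; exists (z * w); last by rewrite mulKf// subrr.
  by apply: mulE => //; rewrite subrK.
Qed.

(** Riemann's inequality bounds this number from above. When [F] is the full field of constants, its
    maximum is the genus minus one. *)
Definition defect A : int := div_deg A - (ell A)%:Z.

Lemma defect_mono A A' : (forall p, coeff p A <= coeff p A') -> defect A <= defect A'.
Proof.
move=> AA'; have D0 : effective (A' - A) by move=> p; rewrite coeffB subr_ge0.
have [_] := ell_le A D0; rewrite addrC subrK div_degD div_degN /defect.
by clear; lia.
Qed.

Lemma defect_div A z : z != 0 -> defect (A - div_of z) = defect A - div_deg (div_of z).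
Proof. by move=> z0; rewrite /defect ell_div// div_degD div_degN; ring. Qed.

Definition poles_x : divisor iota := divisor_on [set p | p x < 0] (fun p => - p x).

Lemma coeff_poles_x p : coeff p poles_x = if p x < 0 then - p x else 0.
Proof.
rewrite coeff_divisor_on; last exact: finite_poles_x.
by congr (if _ then _ else _); apply/asboolP/idP.
Qed.

Lemma poles_x_ge0 : effective poles_x.
Proof. by move=> p; rewrite coeff_poles_x; case: ltP => // /ltW; rewrite oppr_ge0. Qed.

Lemma deg_poles_x_le : div_deg poles_x <= n%:Z.
Proof.
rewrite div_deg_divisor_on.
have := @sum_zeros_le _ _ _ degE x^-1 n (fset_set [set p : place iota | p x < 0]).
rewrite invr_eq0 => /(_ x0 (fin_over_inv x0 fx) (fset_uniq _)).
rewrite (eq_bigr (fun p : place iota => - p x * (residue_deg p)%:Z)); last by move=> p _; rewrite ordV.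
apply => p; rewrite in_fset_set; last exact: finite_poles_x.
by rewrite inE /= ordV// oppr_gt0.
Qed.

(** The products [x^j b_i] with [j <= l] are independent over [F], and the fixed divisor [C] takes
    up the poles of the [b_i]. *)
Lemma basis_bound : exists2 C, effective C & forall l : nat, (n * l.+1 <= ell (poles_x *+ l + C)%R)%N.
Proof.
have b0 i : b i != 0.
  apply/eqP => bi; have : forall j, (if j == i then 1 else 0 : {poly F}) = 0.
    apply: b_free; rewrite (bigD1 i)//= eqxx bi mulr0 big1 ?addr0// => j /negbTE ->.
    by rewrite rmorph0 mul0r.
  by move/(_ i)/eqP; rewrite eqxx oner_eq0.
have [C C0 Cb] : exists2 C, effective C & forall i p, - coeff p C <= p (b i).
  have /choice[D DP] : forall i, exists D : divisor iota, effective D /\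
      forall p, coeff p (- div_of (b i)) <= coeff p D.
    by move=> i; have [D ? ?] := effective_bound (- div_of (b i)); exists D.
  exists (\sum_i D i).
    move=> p; rewrite raddf_sum /= sumr_ge0// => i _; have [D0 _] := DP i; exact: D0.
  move=> i p; rewrite raddf_sum /= (bigD1 i)//=; have [_ /(_ p)] := DP i.
  rewrite coeffN coeff_div_of// lerNl => h; rewrite opprD; apply: le_trans h.
  rewrite gerDl oppr_le0 sumr_ge0// => j _; have [h' _] := DP j; exact: h'.
exists C => // l.
pose w (ij : 'I_n * 'I_l.+1) := x ^+ ij.2 * b ij.1.
have := dim_quot_le (subspace0 iota) (ellP (poles_x *+ l + C)) (v := w).
rewrite card_prod !card_ord; apply; split.
  move=> [i j] p _; right; rewrite /w /= ordM ?expf_neq0// ordX//.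
  rewrite coeffD coeffMn coeff_poles_x opprD; apply: lerD => //.
  have jl : (j <= l)%N by rewrite -ltnS.
  have [px|px] := ltP (p x) 0; last by rewrite mul0rn oppr0 mulrn_wge0.
  rewrite mulNrn opprK; move: (nat_of_ord j) jl => k kl; rewrite -(subnK kl) mulrnDr gerDr.
  by rewrite -oppr_ge0 -mulNrn mulrn_wge0// oppr_ge0 ltW.
move=> a a0; pose c i := \poly_(j < l.+1) a (i, inord j).
have ca i : c i = 0.
  apply: b_free; transitivity (\sum_i \sum_j iota (a (i, j)) * w (i, j)); last first.
    by rewrite pair_bigA /= -[RHS]a0; apply: eq_bigr => -[].
  apply: eq_bigr => {}i _; rewrite /c poly_def rmorph_sum /= mulr_suml.
  apply: eq_bigr => j _; rewrite -mul_polyC rmorphM /= evC rmorphXn /= evX -mulrA.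
  by rewrite inord_val.
by move=> [i j]; have := congr1 (fun q : {poly F} => q`_j) (ca i); rewrite coef_poly ltn_ord inord_val coef0.
Qed.

(** The upper bound counts the zeros of [x^-1]. For the lower one, [n (l + 1)] is at most
    [l deg(poles_x)] plus a constant, for every [l]. *)
Lemma deg_poles_x : div_deg poles_x = n%:Z.
Proof.
apply/eqP; rewrite eq_le deg_poles_x_le /=.
have [C C0 Cl] := basis_bound.
have Bl l : effective (poles_x *+ l + C).
  by move=> p; rewrite coeffD coeffMn addr_ge0// mulrn_wge0// poles_x_ge0.
have bound (l : nat) : (n * l.+1)%:Z <= l%:Z * div_deg poles_x + div_deg C + (ell 0)%:Z.
  have [_] := ell_le 0 (Bl l); rewrite add0r div_degD.
  have -> : div_deg (poles_x *+ l) = l%:Z * div_deg poles_x by rewrite raddfMn /= -mulr_natl natz.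
  by move: (Cl l) => h1 h2; apply: le_trans (le_trans h2 _); [rewrite lez_nat|rewrite addrC].
rewrite leNgt; apply/negP => lt.
have B0 := div_deg_ge0 poles_x_ge0.
have [l lE] : exists l : nat, l%:Z = div_deg C + (ell 0)%:Z.
  by exists `|(div_deg C + (ell 0)%:Z)%R|%N; rewrite gez0_abs// addr_ge0// div_deg_ge0.
have := bound l; rewrite -addrA -lE; move: B0 lt; move: (div_deg poles_x).
by clear; move=> e e0 en; nia.
Qed.

Let degMn A k : div_deg (A *+ k) = k%:Z * div_deg A.
Proof. by rewrite raddfMn /= -mulr_natl natz. Qed.

Lemma defect_poles_x : exists g : int, forall l, defect (poles_x *+ l) <= g.
Proof.
have [C C0 Cl] := basis_bound.
exists (div_deg C - n%:Z) => l.
have [_ h] := ell_le (poles_x *+ l) C0; have := Cl l.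
rewrite /defect degMn deg_poles_x; move: h; move: (ell _) (ell _) (div_deg C).
by clear; move=> a c d; nia.
Qed.

(** The powers of [x] with exponent at most [residue_deg p] are too many to be independent in the
    residue field. *)
Lemma residue_algebraic p : 0 <= p x ->
  exists g : {poly F}, [/\ g != 0, (size g <= (residue_deg p).+1)%N & ord_ge p 1 (ev iota x g)].
Proof.
move=> px; apply/not_notP => H.
have := dim_quot_le (subspace_ord_ge p 1) (residue_degP degE p)
  (v := fun i : 'I_(residue_deg p).+1 => x ^+ i).
rewrite card_ord ltnn => h; suff : false by []; apply: h; split.
  by move=> i; right; rewrite ordX// mulrn_wge0.
move=> a aw; apply/not_notP => /existsNP[i ai]; apply: H.
exists (\poly_(j < (residue_deg p).+1) a (inord j)); split.
- apply: contra_notN ai => /eqP e; have := congr1 (fun q : {poly F} => q`_i) e.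
  by rewrite coef_poly ltn_ord inord_val coef0.
- exact: size_poly.
- rewrite poly_def rmorph_sum /=.
  rewrite (eq_bigr (fun j => iota (a j) * x ^+ j)) => [//|j _].
  by rewrite -mul_polyC rmorphM /= evC rmorphXn /= evX inord_val.
Qed.

(** The zeros of [f(x)] have total degree at most [n deg f], by the bound on the degree of [K] over
    [F(f(x))]; its poles are [deg f] times those of [x], of degree exactly [n deg f]. *)
Lemma div_poly_le0 f : f != 0 -> div_deg (div_of (ev iota x f)) <= 0.
Proof.
move=> f0; have ef0 := transcendental_ev_neq0 x_trans f0.
have [sf|sf] := ltnP 1 (size f); last first.
  have fE := size1_polyC sf; have -> : div_of (ev iota x f) = 0.
    apply/esym/div_of_eq => // p; rewrite coeff0 fE evC ord_const//.
    by apply: contra_neq f0 => e; rewrite fE e.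
  by rewrite div_deg0.
pose d := (size f).-1.
have -> : div_of (ev iota x f) =
    divisor_on [set p | 0 < p (ev iota x f)] (fun p => p (ev iota x f)) - poles_x *+ d.
  apply/eqP/freeg_eqP => p; rewrite coeff_div_of// coeffB coeffMn coeff_poles_x.
  rewrite coeff_divisor_on; last exact: finite_zeros_poly.
  have [px|px] := ltP (p x) 0.
    have [_ ->] := ord_ev_pole px f0; rewrite mulNrn opprK; case: asboolP => /=; last by rewrite add0r.
    have [_ ->] := ord_ev_pole px f0; rewrite pmulrn_lgt0 ?(ltNge 0) ?(ltW px)//.
    by rewrite -subn1 subn_gt0.
  rewrite mul0rn subr0; case: asboolP => //= /negP; rewrite -leNgt => h.
  apply/eqP; rewrite eq_le h; have [/eqP|//] := ev_ord_ge f px.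
  by rewrite (negbTE ef0).
rewrite div_degD div_degN degMn deg_poles_x div_deg_divisor_on subr_le0 -PoszM.
apply: le_trans (sum_zeros_le degE ef0 (fin_over_poly x_trans b_span sf) (fset_uniq _) _) _.
  by move=> p; rewrite in_fset_set ?inE//; exact: finite_zeros_poly.
by rewrite mulnC.
Qed.

(** A place where [x] is finite is cancelled by a polynomial in [x] vanishing there, at the cost of
    poles of [x] only. *)
Lemma absorb_in_poles A : effective A -> exists (f : {poly F}) (l : nat), f != 0 /\
  forall p, coeff p (A - div_of (ev iota x f)) <= coeff p (poles_x *+ l).
Proof.
move: A; apply: effective_ind => [|A q A0 [f [l [f0 fl]]]].
  exists 1, 0%N; rewrite oner_neq0; split => // p.
  by rewrite rmorph1 sub0r coeffN coeff_div_of ?oner_neq0// ord1 oppr0 mulr0n coeff0.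
have [g [g0 gq1 gq2]] : exists g : {poly F}, [/\ g != 0, (0 <= q x -> ord_ge q 1 (ev iota x g)) & True].
  have [qx|qx] := leP 0 (q x); last by exists 1; rewrite oner_neq0.
  by have [g [g0 _ gq]] := residue_algebraic qx; exists g.
have ef0 := transcendental_ev_neq0 x_trans f0.
have eg0 := transcendental_ev_neq0 x_trans g0.
(* The new factor [g(x)] has poles [deg g] times those of [x]; one further copy absorbs [q] when [q]
   is itself a pole of [x]. *)
exists (f * g), (l + (size g).-1.+1)%N; split; first exact: mulf_neq0.
move=> p; have := fl p; rewrite rmorphM /= div_ofM// !(coeffB, coeffD) !coeffMn !coeff_div_of// coeffU mul1r.
rewrite coeff_poles_x; have [px|px] := ltP (p x) 0.
  have [_ ->] := ord_ev_pole px g0; rewrite mulrnDr mulrSr => h.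
  have qp1 : (q == p)%:R <= - p x :> int.
    by apply: (@le_trans _ _ 1); [case: (q == p)|rewrite -gtz0_ge1 oppr_gt0].
  rewrite !mulNrn in h *; move: h qp1.
  by move: (p x *+ l) (p x *+ (size g).-1) => u v; clear; lia.
rewrite !mul0rn => h; have [qp|qp] := eqVneq q p.
  have /(ord_geE _ _ eg0) : ord_ge p 1 (ev iota x g) by rewrite -qp; apply: gq1; rewrite qp.
  by move: h; clear; lia.
have /(ord_geE _ _ eg0) := ev_ord_ge g px.
by move: h; clear; lia.
Qed.

Lemma defect_bounded : exists g : int, forall A, defect A <= g.
Proof.
have [g gP] := defect_poles_x; exists g => A.
have [A1 A10 AA1] := effective_bound A.
have [f [l [f0 fl]]] := absorb_in_poles A10.
have ef0 := transcendental_ev_neq0 x_trans f0.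
apply: le_trans (defect_mono AA1) _.
have := defect_mono fl; rewrite defect_div// => h; have := gP l.
have := div_poly_le0 f0; move: h; move: (defect _) (defect _) (div_deg _); clear; lia.
Qed.

(** The defect of [k div(u)] is [k deg(div u) - ell 0], unbounded in [k] if the degree is positive.
    Passing to [u^-1] excludes a negative degree. *)
Lemma div_deg_principal z : z != 0 -> div_deg (div_of z) = 0.
Proof.
have [g gP] := defect_bounded.
suff le0 u : u != 0 -> div_deg (div_of u) <= 0.
  move=> z0; apply/eqP; rewrite eq_le le0// -oppr_le0 -div_degN -div_ofV// le0//.
  by rewrite invr_eq0.
move=> u0; rewrite leNgt; apply/negP => d0.
pose k := (`|g|%N + ell 0).+1.
have := gP (div_of u *+ k); rewrite /defect.
have -> : ell (div_of u *+ k) = ell 0.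
  rewrite -(@ell_div 0 (u^-1 ^+ k)) ?expf_neq0 ?invr_eq0// div_ofX ?invr_eq0//.
  by rewrite div_ofV// mulNrn sub0r opprK.
rewrite degMn /k; move: d0; move: (div_deg _) (ell 0); clear; move=> d e; nia.
Qed.

(** Let [A0] have maximal defect. For [deg A] large, [L(A - A0)] contains some [z != 0]; then
    [A0 <= A + div(z)], and by monotonicity the defect of [A] is maximal too. *)
Lemma riemann : exists (g : int) (N : int), forall A, N <= div_deg A -> (ell A)%:Z = div_deg A - g.
Proof.
have [g0 g0P] := defect_bounded.
pose P k := `[< exists A, `|g0 - defect A|%N = k >].
have exP : exists k, P k by exists `|(g0 - defect 0)%R|%N; apply/asboolP; exists 0.
case: (ex_minnP exP) => k /asboolP[A0 A0k] kmin.
have A0max A : defect A <= defect A0.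
  have : (k <= `|g0 - defect A|)%N by apply: kmin; apply/asboolP; exists A.
  by have := g0P A; have := g0P A0; move: A0k; clear; lia.
exists (defect A0), (div_deg A0 + defect A0 + 1) => A AN.
have ellpos : (0 < ell (A - A0)%R)%N.
  have := A0max (A - A0); rewrite {1}/defect div_degD div_degN.
  by move: AN; clear; lia.
have [z z0 Lz] : exists2 z, z != 0 & rr (A - A0) z.
  have [I [v [Ik [Vv indep] _]]] := ellP (A - A0); rewrite -Ik in ellpos.
  have /card_gt0P[i _] := ellpos; exists (v i) => //; apply/eqP => vi.
  have : forall j, (if j == i then 1 else 0 : F) = 0.
    apply: indep; rewrite /lincomb (bigD1 i)//= eqxx vi mulr0 big1 ?addr0// => j /negbTE ->.
    by rewrite rmorph0 mul0r.
  by move/(_ i)/eqP; rewrite eqxx oner_eq0.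
have : defect A0 <= defect (A + div_of z).
  apply: defect_mono => p; have /(rrE _ z0) := Lz => /(_ p).
  by rewrite !coeffD coeffN addrAC subr_ge0.
have -> : A + div_of z = A - div_of z^-1 by rewrite div_ofV// opprK.
have zV0 : z^-1 != 0 by rewrite invr_eq0.
rewrite defect_div// div_deg_principal// subr0 => h.
have := A0max A; move: h; rewrite /defect; move: (div_deg _) (ell _) (div_deg _) (ell _); clear; lia.
Qed.

End RiemannTheorem.

(** * Effective divisors in a linear equivalence class *)

Section EffectiveDivisors.
Variables (F : finFieldType) (K : fieldType) (iota : {rmorphism F -> K}).
Variables (x : K) (n : nat) (b : 'I_n -> K).
Hypothesis x_trans : ~ algebraicOver iota x.
Hypothesis b_span : forall y : K,
  exists p q : 'I_n -> {poly F}, (forall i, q i != 0) /\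
    y = \sum_(i < n) ev iota x (p i) / ev iota x (q i) * b i.
Hypothesis b_free : forall c : 'I_n -> {poly F},
  \sum_i ev iota x (c i) * b i = 0 -> forall i, c i = 0.
Implicit Types (p : place iota) (A D E : divisor iota).

Let degE := residue_deg_exists x_trans b_span.

(** Such a place is a pole of [x] or a zero of [g(x)] for one of the finitely many nonzero
    polynomials [g] of degree at most [m]. *)
Lemma finite_places_le m : finite_set [set p : place iota | (residue_deg p <= m)%N].
Proof.
pose f (u : 'rV[F]_m.+1) := [set p : place iota | (rVpoly u != 0) && (0 < p (ev iota x (rVpoly u)))].
apply: (@sub_finite_set _ _ ([set p : place iota | p x < 0] `|` \bigcup_(u in setT) f u)).
  move=> p /= pm; have [px|px] := ltP (p x) 0; [by left|right].
  have [g [g0 gs pg]] := residue_algebraic x_trans b_span px.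
  exists (poly_rV g) => //; rewrite /f /= poly_rV_K; last by rewrite (leq_trans gs).
  rewrite g0 /= gtz0_ge1.
  by move/(ord_geE _ _ (transcendental_ev_neq0 x_trans g0)): pg.
rewrite finite_setU; split; first exact: finite_poles_x x_trans b_span.
apply: bigcup_finite => [|u _]; first exact: finite_finset.
have [u0|u0] := eqVneq (rVpoly u) 0.
  by rewrite [X in finite_set X](_ : _ = set0)//; apply/seteqP; split => p //; rewrite /f /= u0 eqxx.
apply: sub_finite_set (finite_zeros_poly x_trans b_span u0) => p /= /andP[_ //].
Qed.

Lemma effective_pred D : effective D -> D != 0 ->
  exists2 p, effective (D - << p >>) & (residue_deg p)%:Z <= div_deg D.
Proof.
move=> D0 Dn0; have [p pD] : exists p, coeff p D != 0.
  apply/not_notP => H; move/eqP: Dn0; apply; apply/eqP/freeg_eqP => p.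
  rewrite coeff0; apply/eqP/negPn/negP => pD; by apply: H; exists p.
have Dp : effective (D - << p >>).
  move=> q; rewrite coeffB coeffU mul1r; case: eqP => [<-|_]; last by rewrite subr0.
  by rewrite subr_ge0 -gtz0_ge1 lt_neqAle eq_sym pD D0.
exists p => //; have := div_deg_ge0 Dp; rewrite div_degD div_degN div_degU mul1r.
by rewrite subr_ge0.
Qed.

Lemma effective_deg_eq0 D : effective D -> div_deg D = 0 -> D = 0.
Proof.
move=> D0 dD; apply/eqP; rewrite -[_ == _]negbK; apply/negP.
move=> /(effective_pred D0)[p _]; rewrite dD; have := residue_deg_gt0 degE p.
by clear; lia.
Qed.

Lemma finite_effective_le m : finite_set [set D : divisor iota | effective D /\ div_deg D <= m%:Z].
Proof.
elim: m => [|m IH].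
  apply: (@sub_finite_set _ _ [set 0]); last exact: finite_set1.
  move=> D [D0 dD] /=; apply: effective_deg_eq0 => //.
  by apply/eqP; rewrite eq_le dD div_deg_ge0.
apply: (@sub_finite_set _ _ ([set 0] `|`
    \bigcup_(p in [set p : place iota | (residue_deg p <= m.+1)%N])
      ((fun D => D + << p >>) @` [set D | effective D /\ div_deg D <= m%:Z]))); last first.
  rewrite finite_setU; split; first exact: finite_set1.
  by apply: bigcup_finite => [|p _]; [exact: finite_places_le|exact: finite_image].
move=> D [D0 dD]; have [->|Dn0] := eqVneq D 0; [by left|right].
have [p Dp pD] := effective_pred D0 Dn0.
exists p => /=; first by rewrite -lez_nat (le_trans pD).
exists (D - << p >>); last by rewrite subrK.
split=> //; rewrite div_degD div_degN div_degU mul1r.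
have := residue_deg_gt0 degE p; move: dD; clear; lia.
Qed.

Lemma period_exists : exists d : nat, [/\ (0 < d)%N, exists D, div_deg D = d%:Z &
  forall D, exists k : int, div_deg D = k * d%:Z].
Proof.
pose P d := `[< (0 < d)%N /\ exists D, div_deg D = d%:Z >].
have exP : exists d, P d.
  have [p px] := transcendental_pole x_trans b_span x_trans.
  exists (residue_deg p); apply/asboolP; split; first exact: residue_deg_gt0 degE p.
  by exists (<< p >>); rewrite div_degU mul1r.
case: (ex_minnP exP) => d /asboolP[d0 [D1 D1d]] dmin.
exists d; split => //; first by exists D1.
move=> D; exists (div_deg D %/ d%:Z)%Z.
have dn0 : d%:Z != 0 by rewrite eqz_nat -lt0n.
have modE := divz_eq (div_deg D) d; rewrite {1}modE.
suff -> : (div_deg D %% d)%Z = 0 by rewrite addr0.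
have r0 := modz_ge0 (div_deg D) dn0; have rd := ltz_pmod (div_deg D) (_ : 0 < d%:Z).
move: (rd); rewrite ltz_nat => /(_ d0) {}rd.
apply/eqP; rewrite eq_le r0 andbT leNgt; apply/negP => r1.
have /dmin : P `|(div_deg D %% d)%Z|%N.
  apply/asboolP; split; first by rewrite absz_gt0 gt_eqF.
  exists (D - D1 *~ (div_deg D %/ d%:Z)%Z); rewrite gez0_abs//.
  rewrite div_degD div_degN raddfMz /= D1d -mulrzl intz {1}modE.
  by rewrite addrC addKr.
by rewrite leqNgt -ltz_nat gez0_abs// rd.
Qed.

Definition lin_equiv D E : bool := `[< exists2 z, z != 0 & E = D + div_of iota z >].

Lemma lin_equiv_deg D E : lin_equiv D E -> div_deg E = div_deg D.
Proof.
move=> /asboolP[z z0 ->].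
by rewrite div_degD (div_deg_principal x_trans b_span b_free z0) addr0.
Qed.

Lemma lin_equiv_sym D E : lin_equiv D E = lin_equiv E D.
Proof.
have sub A B : lin_equiv A B -> lin_equiv B A.
  move=> /asboolP[z z0 ->]; apply/asboolP; exists z^-1; rewrite ?invr_eq0//.
  by rewrite (div_ofV x_trans b_span z0) addrK.
by apply/idP/idP; exact: sub.
Qed.

Lemma lin_equivD D E A : lin_equiv (D + A) (E + A) = lin_equiv D E.
Proof.
apply/asboolP/asboolP => -[z z0 e]; exists z => //; last by rewrite e addrAC.
by apply: (addIr A); rewrite e addrAC.
Qed.

Definition eff_divs (m : int) : {fset divisor iota} :=
  fset_set [set D : divisor iota | effective D /\ div_deg D = m].

Lemma in_eff_divs m D : D \in eff_divs m <-> effective D /\ div_deg D = m.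
Proof.
rewrite /eff_divs in_fset_set ?inE//.
apply: sub_finite_set (finite_effective_le `|m|%N) => E [E0 Em]; split => //.
by rewrite Em lez_abs.
Qed.

Definition rr_nonzero A : {fset K} := (fset_set (rr A) `\ 0)%fset.

Lemma in_rr_nonzero A z : z \in rr_nonzero A <-> z != 0 /\ rr A z.
Proof.
have [fin _] := dim_quot_set0_card (subspace_rr _ _) (ellP x_trans b_span A).
rewrite /rr_nonzero in_fsetD1 in_fset_set//; split=> [/andP[z0 /set_mem]//|[z0 Az]].
by rewrite z0; exact: mem_set.
Qed.

Lemma card_rr_nonzero A : #|` rr_nonzero A| = (#|F| ^ ell A).-1.
Proof.
have [fin cardE] := dim_quot_set0_card (subspace_rr _ _) (ellP x_trans b_span A).
rewrite -cardE (cardfsD1 0 (fset_set _)) in_fset_set//.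
by rewrite mem_set ?add1n// => p _; left.
Qed.

(** The map from [z] to [D + div(z)] sends the nonzero elements of [L(D)] onto the effective
    divisors equivalent to [D]. Its fibres are the orbits of the nonzero constants, the nonzero
    elements of [L(0)]. *)
Lemma count_lin_equiv D :
  (count (lin_equiv D) (eff_divs (div_deg D)) * (#|F| ^ ell (0%R : divisor iota)).-1)%N
  = (#|F| ^ ell D).-1.
Proof.
rewrite -!card_rr_nonzero -sum1_count big_distrl /=.
rewrite -[RHS]sum1_size.
have mapE z : z \in rr_nonzero D -> lin_equiv D (D + div_of iota z) /\
    D + div_of iota z \in eff_divs (div_deg D).
  move=> /in_rr_nonzero[z0 Dz]; have le : lin_equiv D (D + div_of iota z).
    by apply/asboolP; exists z.
  split => //; apply/in_eff_divs; split; last exact: lin_equiv_deg.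
  by apply/(rrE x_trans b_span _ z0).
transitivity (\sum_(E <- eff_divs (div_deg D) | lin_equiv D E)
    \sum_(z <- rr_nonzero D | (D + div_of iota z)%R == E) 1)%N; last first.
  rewrite (exchange_big_dep xpredT)//= [LHS]big_seq [RHS]big_seq; apply: eq_bigr => z zD.
  have [le inE] := mapE z zD.
  rewrite (eq_bigl (pred1 (D + div_of iota z))) => [|E /=].
    by rewrite sum1_count count_uniq_mem ?fset_uniq// inE.
  by rewrite eq_sym; case: eqP => [->|]; rewrite ?andbT ?andbF.
rewrite big_seq_cond [RHS]big_seq_cond; apply: eq_bigr => E /andP[/in_eff_divs[E0 _] /asboolP[w w0 EE]].
rewrite mul1n -sum1_size -[RHS]big_filter.
rewrite -(big_map (fun z => w * z) xpredT (fun=> 1%N)); apply: perm_big.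
apply: uniq_perm.
- by rewrite map_inj_uniq ?fset_uniq//; exact: mulfI.
- by rewrite filter_uniq// fset_uniq.
move=> z; rewrite mem_filter.
apply/mapP/andP => [[u /in_rr_nonzero[u0 ru] ->]|[/eqP zE /in_rr_nonzero[z0 Dz]]].
  have wu0 : w * u != 0 by rewrite mulf_neq0.
  have du : div_of iota u = 0.
    apply: effective_deg_eq0; last exact: (div_deg_principal x_trans b_span b_free u0).
    by have := (rrE x_trans b_span 0 u0).1 ru; rewrite add0r.
  have dwu : D + div_of iota (w * u) = E.
    by rewrite (div_ofM x_trans b_span w0 u0) du addr0 EE.
  by rewrite dwu; split => //; apply/in_rr_nonzero; split=> //; apply/(rrE x_trans b_span _ wu0); rewrite dwu.
exists (z / w); last by rewrite mulrCA divff// mulr1.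
have zw0 : z / w != 0 by rewrite mulf_neq0 ?invr_eq0.
apply/in_rr_nonzero; split => //; apply/(rrE x_trans b_span _ zw0).
rewrite (div_ofM x_trans b_span) ?invr_eq0// (div_ofV x_trans b_span w0) add0r.
have -> : div_of iota z = div_of iota w by apply: (addrI D); rewrite zE.
by rewrite subrr => p; rewrite coeff0.
Qed.

End EffectiveDivisors.

(** * Character sums over effective divisors *)

Section ClassCharacters.
Variables (F : finFieldType) (K : fieldType) (iota : {rmorphism F -> K}).
Variables (x : K) (n : nat) (b : 'I_n -> K).
Hypothesis x_trans : ~ algebraicOver iota x.
Hypothesis b_span : forall y : K,
  exists p q : 'I_n -> {poly F}, (forall i, q i != 0) /\
    y = \sum_(i < n) ev iota x (p i) / ev iota x (q i) * b i.
Hypothesis b_free : forall c : 'I_n -> {poly F},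
  \sum_i ev iota x (c i) * b i = 0 -> forall i, c i = 0.
Variable dl : nat.
Hypothesis dl_gt0 : (0 < dl)%N.
Hypothesis dl_deg : exists D : divisor iota, div_deg D = dl%:Z.
Hypothesis dl_dvd : forall D : divisor iota, exists k : int, div_deg D = k * dl%:Z.
Implicit Types (p : place iota) (A D E : divisor iota).

Let degE := residue_deg_exists x_trans b_span.

(* A quadratic character of the Picard group, with values written additively
   in [bool] and pulled back to divisors. *)
Definition quad_char (chi : divisor iota -> bool) : Prop :=
  (forall A D, chi (A + D) = chi A (+) chi D) /\
  (forall z : K, z != 0 -> chi (div_of iota z) = false).

Definition sgb (c : bool) : int := (-1) ^+ c.

Lemma sgb_addb c d : sgb (c (+) d) = sgb c * sgb d.
Proof. by case: c; case: d. Qed.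

Definition eff (k : nat) : {fset divisor iota} := eff_divs iota (k * dl)%N%:Z.

Definition char_sum (chi : divisor iota -> bool) (k : nat) : int :=
  \sum_(D <- eff k) sgb (chi D).

Lemma in_eff k D : D \in eff k <-> effective D /\ div_deg D = (k * dl)%N%:Z.
Proof. exact: in_eff_divs x_trans b_span _ _. Qed.

Lemma lin_equiv_char chi D E : quad_char chi -> lin_equiv D E -> chi D = chi E.
Proof. by move=> [chiD chi0] /asboolP[z z0 ->]; rewrite chiD chi0// addbF. Qed.

(** In large degree [ell D] depends on [deg D] alone, so all classes of that degree have equally
    many effective divisors. The factor [w] counts the nonzero constants. *)
Lemma class_count : exists (w k0 : nat) (g : int) (M : nat -> nat), (0 < w)%N /\
  forall k, (k0 <= k)%N -> exists l : nat,
    [/\ l%:Z = (k * dl)%N%:Z - g, (0 < M k)%N, (M k * w)%N = (#|F| ^ l).-1 &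
      forall D, div_deg D = (k * dl)%N%:Z -> count (lin_equiv D) (eff k) = M k].
Proof.
have [g [N gN]] := riemann x_trans b_span b_free.
have [D1 D1d] := dl_deg.
have degk k : div_deg (D1 *+ k) = (k * dl)%N%:Z.
  by rewrite raddfMn /= D1d -mulr_natl natz PoszM.
pose w := (#|F| ^ ell (0 : divisor iota)).-1.
have q1 : (1 < #|F|)%N by exact: card_finNzRing_gt1.
have w0 : (0 < w)%N.
  rewrite /w -(card_rr_nonzero x_trans b_span 0) cardfs_gt0; apply/fset0Pn; exists 1.
  apply/(in_rr_nonzero x_trans b_span); rewrite oner_neq0; split => // p _.
  by right; rewrite coeff0 ord1 oppr0.
(* From this index on [k dl] is at least [N], so Riemann's formula applies, and larger than [g], so
   every class contains an effective divisor. *)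
exists w, (`|N|%N + `|g|%N + 1)%N, g, (fun k => count (lin_equiv (D1 *+ k)) (eff k)); split => //.
move=> k kk0; exists `|((k * dl)%N%:Z - g)%R|%N.
have kdl : (k <= k * dl)%N by rewrite leq_pmulr.
have kg : 0 < (k * dl)%N%:Z - g by move: kk0 kdl; clear; lia.
have kN : N <= (k * dl)%N%:Z by move: kk0 kdl; clear; lia.
have cnt D : div_deg D = (k * dl)%N%:Z ->
    (count (lin_equiv D) (eff k) * w)%N = (#|F| ^ `|((k * dl)%N%:Z - g)%R|).-1.
  move=> dD; have := count_lin_equiv x_trans b_span b_free D; rewrite dD -/(eff k) -/w => ->.
  congr (_ ^ _).-1; apply/eqP; rewrite -eqz_nat gN ?dD//.
  by rewrite gez0_abs// ltW.
split; first by rewrite gez0_abs// ltW.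
- have : (1 < #|F| ^ `|((k * dl)%N%:Z - g)%R|)%N.
    by rewrite -[X in (X < _)%N](expn0 #|F|) ltn_exp2l// absz_gt0 gt_eqF.
  by have := cnt _ (degk k); case: (count _ _) => //; rewrite mul0n; clear; lia.
- by rewrite cnt.
- by move=> D dD; apply/eqP; rewrite -(eqn_pmul2r w0) !cnt.
Qed.

(** Double counting of pairs of [D] in [eff k] and [E] in [eff k.+1] with [E] equivalent to
    [D + D1]: each [E] occurs [M k] times and each [D] occurs [M k.+1] times. The recurrence of [M]
    holds because [M k * w + 1] is multiplied by [Q] at each step. *)
Lemma char_sum_step : exists (k0 : nat) (M : nat -> nat),
  [/\ forall k, (k0 <= k)%N -> (0 < M k)%N /\ (M k < M k.+1)%N,
      forall k, (k0 <= k)%N -> (M k.+2 + #|F| ^ dl * M k = (1 + #|F| ^ dl) * M k.+1)%N,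
      forall D, div_deg D = (k0 * dl)%N%:Z -> (0 < count (lin_equiv D) (eff k0))%N &
      forall chi D1 k, quad_char chi -> div_deg D1 = dl%:Z -> (k0 <= k)%N ->
        (M k)%:Z * char_sum chi k.+1 = sgb (chi D1) * ((M k.+1)%:Z * char_sum chi k)].
Proof.
have [w [k0 [g [M [w0 HM]]]]] := class_count.
have q1 : (1 < #|F|)%N by exact: card_finNzRing_gt1.
have Q1 : (1 < #|F| ^ dl)%N by rewrite -[X in (X < _)%N](expn0 #|F|) ltn_exp2l.
have Mstep k : (k0 <= k)%N -> exists l : nat,
    (M k * w).+1 = (#|F| ^ l)%N /\ (M k.+1 * w).+1 = (#|F| ^ dl * #|F| ^ l)%N.
  move=> kk0; have [l [le _ Mk _]] := HM k kk0.
  have [l' [l'e _ Mk' _]] := HM k.+1 (leqW kk0).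
  have l'l : l' = (dl + l)%N by move: le l'e; rewrite mulSn; clear; lia.
  by exists l; rewrite Mk Mk' l'l expnD !prednK// ?muln_gt0 ?expn_gt0 ?(ltnW q1)// -?expnD.
exists k0, M; split.
- move=> k kk0; have [l [_ M0 _ _]] := HM k kk0; split => //.
  have [l' [e e']] := Mstep k kk0; rewrite -(ltn_pmul2r w0) -ltnS e e'.
  by rewrite -[X in (X < _)%N]mul1n ltn_pmul2r// expn_gt0 (ltnW q1).
- move=> k kk0; have [l [e e']] := Mstep k kk0; have [l' [f f']] := Mstep k.+1 (leqW kk0).
  apply/eqP; rewrite -(eqn_pmul2r w0); apply/eqP.
  move: e e' f f' Q1; clear; move: (_ ^ dl)%N (_ ^ l)%N (_ ^ l')%N (M k) (M k.+1) (M k.+2) w.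
  by move=> Q X Y m m' m'' w; nia.
- by move=> D dD; have [l [_ M0 _ ->]] := HM k0 (leqnn _).
move=> chi D1 k chiP dD1 kk0; have [chiD chi0] := chiP.
have [_ [_ _ _ Mk]] := HM k kk0; have [_ [_ _ _ Mk']] := HM k.+1 (leqW kk0).
have degS D : div_deg D = (k * dl)%N%:Z <-> div_deg (D + D1) = (k.+1 * dl)%N%:Z.
  by rewrite div_degD dD1 mulSn; split; lia.
transitivity (\sum_(E <- eff k.+1) \sum_(D <- eff k | lin_equiv (D + D1) E) sgb (chi E)).
  rewrite mulr_sumr big_seq [RHS]big_seq; apply: eq_bigr => E /in_eff[_ dE].
  rewrite big_const_seq iter_addr addr0 -mulr_natl natz; congr (_%:Z * _).
  rewrite -(Mk (E - D1)); last by apply/degS; rewrite subrK.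
  by apply: eq_count => D; rewrite (lin_equiv_sym x_trans b_span) -(lin_equivD _ _ D1) subrK
    (lin_equiv_sym x_trans b_span).
rewrite (exchange_big_dep xpredT)//= !mulr_sumr big_seq [RHS]big_seq.
apply: eq_bigr => D /in_eff[_ dD].
transitivity (\sum_(E <- eff k.+1 | lin_equiv (D + D1) E) sgb (chi D1) * sgb (chi D)).
  apply: eq_bigr => E /(lin_equiv_char chiP) <-.
  by rewrite chiD sgb_addb mulrC.
have dS := (degS D).1 dD.
by rewrite big_const_seq iter_addr addr0 -mulr_natl natz (Mk' _ dS) mulrCA.
Qed.

Lemma quad_charMn chi D k : quad_char chi -> chi (D *+ k) = odd k && chi D.
Proof.
move=> [chiD chi0]; elim: k => [|k IH].
  by have := chiD 0 0; rewrite addr0 mulr0n; case: (chi 0).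
by rewrite mulrS chiD IH /=; case: (odd k); case: (chi D).
Qed.

Lemma quad_charN chi D : quad_char chi -> chi (- D) = chi D.
Proof.
move=> chiP; have [chiD _] := chiP.
have := chiD (- D) D; rewrite addNr.
have -> : chi 0 = false by have := quad_charMn D 0 chiP; rewrite mulr0n.
by case: (chi D); case: (chi _).
Qed.

(** If [chi] is [false] on [D1], subtracting multiples of [D1] moves any [D] to degree [dl] without
    changing its value. *)
Lemma nontrivial_char_deg1 chi : quad_char chi -> (exists D, chi D) ->
  exists2 D1, div_deg D1 = dl%:Z & chi D1.
Proof.
move=> chiP [D chiDt]; have [chiD _] := chiP.
have [D1 D1d] := dl_deg; have [c1|c1] := boolP (chi D1); first by exists D1.
have [k kD] := dl_dvd D.
exists (D - D1 *~ (k - 1)).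
  by rewrite div_degD div_degN raddfMz /= D1d kD -mulrzl intz; ring.
rewrite chiD chiDt quad_charN//; case: (k - 1) => j.
  by rewrite -pmulrn quad_charMn// (negbTE c1) andbF.
by rewrite NegzE mulrNz -pmulrn quad_charN// quad_charMn// (negbTE c1) andbF.
Qed.

(** Two successive steps of [char_sum_step] eliminate [M] through its own recurrence. The sign
    [chi(D1)] enters the coefficient of [char_sum chi k] squared, so only the middle coefficient
    sees it. *)
Lemma char_sum_recurrence : exists k0 : nat,
  [/\ forall k, (k0 <= k)%N ->
        char_sum (fun=> false) k.+2 = (1 + (#|F| ^ dl)%N%:Z) * char_sum (fun=> false) k.+1
          - (#|F| ^ dl)%N%:Z * char_sum (fun=> false) k,
      char_sum (fun=> false) k0 < char_sum (fun=> false) k0.+1 &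
      forall chi, quad_char chi -> (exists D, chi D) -> forall k, (k0 <= k)%N ->
        char_sum chi k.+2 = - (1 + (#|F| ^ dl)%N%:Z) * char_sum chi k.+1
          - (#|F| ^ dl)%N%:Z * char_sum chi k].
Proof.
have [k0 [M [M0 MS cnt step]]] := char_sum_step.
have rec chi D1 k : quad_char chi -> div_deg D1 = dl%:Z -> (k0 <= k)%N ->
    char_sum chi k.+2 = sgb (chi D1) * (1 + (#|F| ^ dl)%N%:Z) * char_sum chi k.+1
          - (#|F| ^ dl)%N%:Z * char_sum chi k.
  move=> chiP dD1 kk0; have [Mk _] := M0 k.+1 (leqW kk0).
  have := step chi D1 k chiP dD1 kk0; have := step chi D1 k.+1 chiP dD1 (leqW kk0).
  have /(congr1 Posz) := MS k kk0; rewrite !(PoszD, PoszM).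
  have M'n0 : (M k.+1)%:Z != 0 by rewrite eqz_nat -lt0n.
  have sg2 : sgb (chi D1) * sgb (chi D1) = 1 by case: (chi D1).
  move: sg2 M'n0; move: (sgb _) (M k)%:Z (M k.+1)%:Z (M k.+2)%:Z (char_sum chi k).
  move: (char_sum chi k.+1) (char_sum chi k.+2) (#|F| ^ dl)%N%:Z.
  clear; move=> a1 a2 Q e m0 m1 m2 a0 e2 m1n0 mS s1 s0; apply: (mulfI m1n0).
  have -> : m1 * a2 = e * (m2 * a1) by [].
  have m2E : m2 = (1 + Q) * m1 - Q * m0 by rewrite -mS; ring.
  have s0' : m1 * a0 = e * (m0 * a1).
    by rewrite s0 mulrA e2 mul1r.
  rewrite m2E mulrBr [m1 * (Q * a0)]mulrCA s0'; ring.
have triv : quad_char (fun=> false) by split.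
have [D1 D1d] := dl_deg; exists k0; split.
- by move=> k kk0; rewrite (rec _ D1)// mul1r.
- have := step _ D1 k0 triv D1d (leqnn _); rewrite mul1r.
  have [Mk0 Mk1] := M0 k0 (leqnn _).
  have : 0 < char_sum (fun=> false) k0.
    rewrite /char_sum (eq_bigr (fun=> 1))// big_const_seq count_predT iter_addr addr0 natz ltz_nat.
    apply: leq_trans (cnt (D1 *+ k0) _) (count_size _ _).
    by rewrite raddfMn /= D1d -mulr_natl natz PoszM.
  move: Mk0 Mk1; move: (M k0) (M k0.+1) (char_sum _ _) (char_sum _ _).
  by clear; move=> m m' a a' m0 mm' a0 e; nia.
- move=> chi chiP /(nontrivial_char_deg1 chiP)[D2 D2d chiD2] k kk0.
  by rewrite (rec _ D2)// chiD2 /sgb mulN1r.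
Qed.

Definition places_deg (d : nat) : {fset place iota} :=
  fset_set [set p : place iota | residue_deg p = (d * dl)%N].

Definition place_sum (chi : divisor iota -> bool) (d : nat) : int :=
  \sum_(p <- places_deg d) sgb (chi << p >>).

Lemma in_places_deg d p : p \in places_deg d = (residue_deg p == d * dl)%N.
Proof.
rewrite /places_deg in_fset_set; first by apply/idP/eqP; rewrite inE.
apply: sub_finite_set (finite_places_le x_trans b_span (d * dl)) => q /= ->.
exact: leqnn.
Qed.

Lemma residue_deg_dvd p : exists2 d, (0 < d)%N & residue_deg p = (d * dl)%N.
Proof.
have [k] := dl_dvd << p >>; rewrite div_degU mul1r => kp.
have := residue_deg_gt0 degE p; move: kp dl_gt0; clear; move: (residue_deg p) => r.
case: k => d; last by nia.
by move=> e l0 r0; exists d; nia.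
Qed.

Lemma div_deg_sum (S : {fset place iota}) D : effective D ->
  (forall p, coeff p D != 0 -> p \in S) ->
  div_deg D = \sum_(p <- S) coeff p D * (residue_deg p)%:Z.
Proof.
move=> D0; move: D D0; apply: effective_ind => [|D p D0 IH] SD.
  by rewrite div_deg0 big1// => p _; rewrite coeff0 mul0r.
rewrite div_degD IH => [|q qD]; last first.
  by apply: SD; rewrite coeffD coeffU mul1r gt_eqF// ltr_wpDr// lt_neqAle eq_sym qD D0.
have pS : p \in S.
  by apply: SD; rewrite coeffD coeffU mul1r eqxx gt_eqF// ltr_wpDl.
under [RHS]eq_bigr => q _ do rewrite coeffD mulrDl.
rewrite big_split /=; congr (_ + _).
rewrite div_degU mul1r (bigD1_seq p)//= coeffU eqxx !mul1r big1 ?addr0// => q qp.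
by rewrite coeffU eq_sym (negbTE qp) mulr0 mul0r.
Qed.

Lemma coeff_deg_le p D : effective D -> coeff p D * (residue_deg p)%:Z <= div_deg D.
Proof.
move=> D0; have Dp : effective (D - << coeff p D *g p >>).
  move=> q; rewrite coeffB coeffU; case: eqP => [->|_]; rewrite ?mulr1 ?subrr//.
  by rewrite mulr0 subr0.
by have := div_deg_ge0 Dp; rewrite div_degD div_degN div_degU subr_ge0.
Qed.

Lemma deg_sum_places k D : D \in eff k ->
  k%:Z = \sum_(1 <= d < k.+1) \sum_(p <- places_deg d) d%:Z * coeff p D.
Proof.
move=> /in_eff[D0 dD].
have dln0 : dl%:Z != 0 by rewrite eqz_nat -lt0n.
apply: (mulIf dln0); rewrite -PoszM -dD mulr_suml.
pose S := fset_set [set p : place iota | (residue_deg p <= k * dl)%N].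
have inS p : p \in S = (residue_deg p <= k * dl)%N.
  rewrite /S in_fset_set; first by apply/idP/idP; rewrite inE.
  exact: finite_places_le x_trans b_span _.
rewrite (@div_deg_sum S)// => [|p pD]; last first.
  rewrite inS -lez_nat -dD.
  have Dp : effective (D - << p >>).
    move=> q; rewrite coeffB coeffU mul1r; case: eqP => [<-|_]; last by rewrite subr0.
    by rewrite subr_ge0 -gtz0_ge1 lt_neqAle eq_sym pD D0.
  by have := div_deg_ge0 Dp; rewrite div_degD div_degN div_degU mul1r subr_ge0.
transitivity (\sum_(1 <= d < k.+1) \sum_(p <- S | (residue_deg p == d * dl)%N)
    coeff p D * (residue_deg p)%:Z).
  rewrite (exchange_big_dep xpredT)//= big_seq [RHS]big_seq; apply: eq_bigr => p.
  rewrite inS; have [d d0 ->] := residue_deg_dvd p; rewrite leq_pmul2r// => dk.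
  rewrite (big_rem d) ?mem_index_iota ?d0//= eqxx big_seq_cond big1 ?addr0// => e.
  by rewrite mem_rem_uniq ?iota_uniq// inE eqn_pmul2r// eq_sym => /andP[/andP[/negbTE ->]].
rewrite big_seq [RHS]big_seq; apply: eq_bigr => d; rewrite mem_index_iota => /andP[d1 dk].
rewrite mulr_suml -big_filter; apply: etrans (perm_big _ _) _.
  apply: (@uniq_perm _ _ (places_deg d : seq _)); rewrite ?filter_uniq ?fset_uniq// => p.
  rewrite mem_filter inS in_places_deg; case: eqP => //= ->.
  by rewrite leq_pmul2r.
rewrite big_seq [RHS]big_seq; apply: eq_bigr => p; rewrite in_places_deg => /eqP ->.
by rewrite PoszM mulrCA mulrA.
Qed.

(** Subtracting [j] times [p] is a bijection onto [eff (k - j * d)], and it changes the character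
    value by [chi(p)^j]. *)
Lemma char_sum_ge chi p d j k : quad_char chi -> residue_deg p = (d * dl)%N ->
  \sum_(D <- eff k | j%:Z <= coeff p D) sgb (chi D) =
    if (j * d <= k)%N then sgb (chi << p >>) ^+ j * char_sum chi (k - j * d) else 0.
Proof.
move=> chiP pd; have [chiD _] := chiP.
have jpdeg : div_deg (<< p >> *+ j : divisor iota) = (j * d * dl)%N%:Z.
  by rewrite raddfMn /= div_degU mul1r pd -mulr_natl natz -PoszM mulnA.
have coeffj q : coeff q (<< p >> *+ j : divisor iota) = if q == p then j%:Z else 0.
  rewrite coeffMn coeffU mul1r eq_sym; case: eqP => _; last by rewrite mul0rn.
  by rewrite -mulr_natl mulr1 natz.
case: leqP => jk; last first.
  rewrite big_seq_cond big1// => D /andP[/in_eff[D0 dD] jD].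
  have Dj : effective (D - << p >> *+ j).
    by move=> q; rewrite coeffB coeffj; case: eqP => [->|_]; rewrite ?subr0 ?subr_ge0.
  have := div_deg_ge0 Dj; rewrite div_degD div_degN jpdeg dD subr_ge0 lez_nat.
  by rewrite leq_pmul2r// leqNgt jk.
have sgj : sgb (chi << p >>) ^+ j = sgb (chi (<< p >> *+ j)).
  by rewrite quad_charMn// /sgb; case: (chi _); rewrite ?andbT ?andbF ?signr_odd ?expr0 ?expr1 ?expr1n.
rewrite /char_sum mulr_sumr sgj.
under [RHS]eq_bigr => D _ do rewrite -sgb_addb -chiD.
rewrite -[RHS](big_map (fun D => << p >> *+ j + D) xpredT (fun D => sgb (chi D))).
rewrite -[LHS]big_filter; apply: perm_big; apply: uniq_perm.
- by rewrite filter_uniq// fset_uniq.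
- by rewrite map_inj_uniq ?fset_uniq//; exact: addrI.
move=> D; rewrite mem_filter; apply/andP/mapP => [[jD /in_eff[D0 dD]]|[E /in_eff[E0 dE] ->]].
  exists (D - << p >> *+ j); last by rewrite addrC subrK.
  apply/in_eff; split.
    by move=> q; rewrite coeffB coeffj; case: eqP => [->|_]; rewrite ?subr0 ?subr_ge0.
  by rewrite div_degD div_degN jpdeg dD mulnBl -subzn// leq_mul2r jk orbT.
split; first by rewrite coeffD coeffj eqxx lerDl.
apply/in_eff; split.
  by move=> q; rewrite coeffD coeffj addr_ge0//; case: eqP.
by rewrite div_degD jpdeg dE -PoszD -mulnDl subnKC.
Qed.

(** The logarithmic derivative of the Euler product, on coefficients. The degree [k] of [D] is the
    sum of [d] over all places [p] and all [j] from 1 to [coeff p D]; summing over [D] first applies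
    [char_sum_ge]. Even powers of [chi] are trivial. *)
Lemma char_sum_log_derivative chi k : quad_char chi ->
  k%:Z * char_sum chi k = \sum_(1 <= d < k.+1) \sum_(1 <= j < k.+1)
    if (j * d <= k)%N then d%:Z * place_sum (if odd j then chi else fun=> false) d *
      char_sum chi (k - j * d) else 0.
Proof.
move=> chiP; rewrite /char_sum mulr_sumr big_seq.
transitivity (\sum_(D <- eff k) \sum_(1 <= d < k.+1) \sum_(p <- places_deg d)
    \sum_(1 <= j < k.+1 | j%:Z <= coeff p D) d%:Z * sgb (chi D)).
  rewrite [RHS]big_seq; apply: eq_bigr => D Dk; rewrite {1}(deg_sum_places Dk) mulr_suml.
  rewrite big_seq [RHS]big_seq; apply: eq_bigr => d; rewrite mem_index_iota => /andP[d1 dk].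
  rewrite mulr_suml big_seq [RHS]big_seq; apply: eq_bigr => p pd.
  have [D0 dD] := (in_eff _ _).1 Dk.
  have [c cE] : exists c : nat, coeff p D = c%:Z.
    by exists `|coeff p D|%N; rewrite gez0_abs.
  have ck : (c < k.+1)%N.
    have := coeff_deg_le p D0; rewrite cE dD.
    move: pd; rewrite in_places_deg => /eqP -> h.
    rewrite ltnS -(leq_pmul2r dl_gt0) -lez_nat; apply: le_trans h.
    by rewrite -PoszM lez_nat leq_mul2l leq_pmull ?orbT.
  under [RHS]eq_bigl => j do rewrite cE lez_nat -ltnS.
  rewrite -(big_nat_widen 1 c.+1 k.+1 xpredT)// sumr_const_nat subn1 /= cE.
  by rewrite -[in RHS]mulr_natl natz; ring.
rewrite exchange_big /=; apply: eq_bigr => d _; rewrite exchange_big /=.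
transitivity (\sum_(p <- places_deg d) \sum_(1 <= j < k.+1)
    if (j * d <= k)%N then d%:Z * (sgb (chi << p >>) ^+ j * char_sum chi (k - j * d)) else 0).
  rewrite big_seq [RHS]big_seq; apply: eq_bigr => p; rewrite in_places_deg => /eqP pd.
  rewrite (exchange_big_dep xpredT)//=; apply: eq_bigr => j _.
  rewrite -mulr_sumr (char_sum_ge j k chiP pd).
  by case: ifP; rewrite ?mulr0.
rewrite exchange_big /=; apply: eq_bigr => j _.
case: ifP => _; last by rewrite big1.
rewrite -mulr_sumr -mulr_suml mulrA; congr (_ * _ * _); apply: eq_bigr => p _.
by case oj: (odd j); rewrite /sgb; case: (chi _); rewrite ?expr0 ?expr1n// expr1 -signr_odd oj.
Qed.

Lemma char_sum0 chi : quad_char chi -> char_sum chi 0 = 1.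
Proof.
move=> chiP; have chi0 : chi 0 = false by have := quad_charMn 0 0 chiP; rewrite mulr0n.
rewrite /char_sum; have -> : eff 0 = [fset (0 : divisor iota)]%fset; last first.
  by rewrite big_seq_fset1 chi0.
apply/fsetP => D; rewrite in_fset1; apply/idP/eqP => [/in_eff[D0 dD]|->].
  exact: effective_deg_eq0 x_trans b_span _ D0 dD.
by apply/in_eff; split; [move=> p; rewrite coeff0|rewrite div_deg0].
Qed.

Lemma place_sum_le chi d : `|place_sum chi d| <= place_sum (fun=> false) d.
Proof.
apply: le_trans (ler_norm_sum _ _ _) _; apply: ler_sum => p _.
by rewrite /sgb; case: (chi _).
Qed.

Lemma place_sum_le_char_sum d : (0 < d)%N ->
  place_sum (fun=> false) d <= char_sum (fun=> false) d.
Proof.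
move=> d0; rewrite /place_sum /char_sum !big_const_seq !count_predT !iter_addr !addr0.
rewrite !natz lez_nat -(size_map (fun p => << p >> : divisor iota)).
apply: uniq_leq_size.
  rewrite map_inj_uniq ?fset_uniq// => p q pq.
  have := congr1 (coeff p) pq; rewrite !coeffU eqxx !mul1r.
  by case: eqP => [->//|_ /eqP]; rewrite oner_eq0.
move=> _ /mapP[p pd ->]; apply/in_eff; split.
  by move=> q; rewrite coeffU mul1r.
by rewrite div_degU mul1r; move: pd; rewrite in_places_deg => /eqP ->.
Qed.

End ClassCharacters.

(** * Power series and Euler products *)

Section Convolution.
Variable R : realType.
Implicit Types (u v f g a c : nat -> R) (t Q : R).

Definition conv f g (k : nat) : R := \sum_(i < k.+1) f i * g (k - i)%N.

Lemma conv_coef (p q : {poly R}) f g k :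
  (forall i, (i <= k)%N -> p`_i = f i) -> (forall i, (i <= k)%N -> q`_i = g i) ->
  (p * q)`_k = conv f g k.
Proof.
move=> pf qg; rewrite coefM; apply: eq_bigr => i _.
by rewrite pf ?qg ?leq_subr// -ltnS.
Qed.

(** Truncation transfers ring identities from polynomials to convolutions, one coefficient at a
    time. *)
Let tr k f : {poly R} := \poly_(i < k.+1) f i.

Let trE k f i : (i <= k)%N -> (tr k f)`_i = f i.
Proof. by move=> ik; rewrite coef_poly ltnS ik. Qed.

Lemma convC f g k : conv f g k = conv g f k.
Proof.
rewrite /conv (reindex_inj rev_ord_inj) /=; apply: eq_bigr => i _.
have ik : (i <= k)%N by rewrite -ltnS.
by rewrite subSS subKn// mulrC.
Qed.

Lemma convA f g h k : conv f (conv g h) k = conv (conv f g) h k.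
Proof.
rewrite -(@conv_coef (tr k f) (tr k g * tr k h)).
- rewrite mulrA; apply: conv_coef => i ik; last exact: trE.
  by apply: conv_coef => j ji; apply: trE; exact: leq_trans ik.
- by move=> i; exact: trE.
- by move=> i ik; apply: conv_coef => j ji; apply: trE; exact: leq_trans ik.
Qed.

Lemma convDl f g h k : conv (fun i => f i + g i) h k = conv f h k + conv g h k.
Proof. by rewrite /conv -big_split; apply: eq_bigr => i _; rewrite mulrDl. Qed.

Lemma eq_conv f f' g g' k : (forall i, (i <= k)%N -> f i = f' i) ->
  (forall i, (i <= k)%N -> g i = g' i) -> conv f g k = conv f' g' k.
Proof.
by move=> ff gg; apply: eq_bigr => i _; rewrite ff ?gg ?leq_subr// -ltnS.
Qed.

(* The operator [f -> (k f_k)_k] is a derivation of the convolution algebra. *)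
Lemma conv_derivation f g phi psi k :
  (forall i, i%:R * f i = conv phi f i) -> (forall i, i%:R * g i = conv psi g i) ->
  k%:R * conv f g k = conv (fun i => phi i + psi i) (conv f g) k.
Proof.
move=> fE gE; rewrite convDl convA.
have -> : conv psi (conv f g) k = conv f (conv psi g) k.
  by rewrite convA (@eq_conv (conv psi f) (conv f psi) g g)// -?convA// => i _; exact: convC.
rewrite mulr_sumr -big_split; apply: eq_bigr => i _ /=.
rewrite -fE -gE natrB; first by ring.
by rewrite -ltnS.
Qed.

Lemma conv_triangle f g N :
  \sum_(k < N) conv f g k = \sum_(i < N) \sum_(j < N | (i + j < N)%N) f i * g j.
Proof.
transitivity (\sum_(k < N) \sum_(i < N) \sum_(j < N | (i + j == k)%N) f i * g j).
  apply: eq_bigr => k _; rewrite /conv (big_ord_widen _ (fun i => f i * g (k - i)%N) (ltn_ord k)).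
  rewrite big_mkcond; apply: eq_bigr => i _; case: ifP => ik.
    have kiN : (k - i < N)%N by rewrite (leq_ltn_trans (leq_subr _ _)).
    rewrite (big_pred1 (Ordinal kiN))// => j /=.
    by rewrite -val_eqE /=; move: ik; clear; lia.
  by rewrite big_pred0// => j; move: ik; clear; lia.
rewrite exchange_big; apply: eq_bigr => i _ /=.
rewrite (exchange_big_dep xpredT)//= [RHS]big_mkcond; apply: eq_bigr => j _.
case: ltnP => ij.
  by rewrite (big_pred1 (Ordinal ij))// => k /=; rewrite -val_eqE /= eq_sym.
by rewrite big_pred0// => k; have := ltn_ord k; move: ij; clear; lia.
Qed.

(** The square partial sums differ from the triangular ones by at most the same difference [U V - W]
    for absolute values. The latter tends to 0, because [W_N <= U_N V_N <= W_(2N)] and [W]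
    converges. *)
Lemma cauchy_product u v :
  cvgn [series `|u k|]_k -> cvgn [series `|v k|]_k ->
  [series conv u v k]_k @ \oo --> limn (series u) * limn (series v).
Proof.
move=> cu cv.
have su : series u @ \oo --> limn (series u) by exact: normed_cvg.
have sv : series v @ \oo --> limn (series v) by exact: normed_cvg.
pose U := [series `|u k|]_k; pose V := [series `|v k|]_k.
pose W := [series conv (fun i => `|u i|) (fun i => `|v i|) k]_k.
have triE f g N : [series conv f g k]_k N = \sum_(i < N) \sum_(j < N | (i + j < N)%N) f i * g j.
  by rewrite -conv_triangle /series /= big_mkord.
have prodE f g N : series f N * series g N = \sum_(i < N) \sum_(j < N) f i * g j.
  rewrite /series /= !big_mkord mulr_suml; apply: eq_bigr => i _.
  by rewrite mulr_sumr.
have diffE f g N : series f N * series g N - [series conv f g k]_k N =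
    \sum_(i < N) \sum_(j < N | (N <= i + j)%N) f i * g j.
  rewrite prodE triE -sumrB; apply: eq_bigr => i _.
  rewrite (bigID (fun j : 'I_N => (i + j < N)%N))/= addrAC subrr add0r.
  by apply: eq_bigl => j; rewrite -leqNgt.
have W_le N : W N <= U N * V N.
  rewrite -subr_ge0 diffE sumr_ge0// => i _; rewrite sumr_ge0// => j _.
  by apply: mulr_ge0 => /=; exact: normr_ge0.
have W_nd : nondecreasing_seq W.
  apply/nondecreasing_seqP => N; rewrite /W /series /= big_nat_recr//= lerDl.
  by rewrite sumr_ge0// => i _; rewrite mulr_ge0.
have UV_le N : U N * V N <= W N.*2.
  rewrite /U /V /W prodE triE -addnn.
  rewrite (big_ord_widen (N + N) (fun i => \sum_(j < N) `|u i| * `|v j|)) ?leq_addr//.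
  rewrite [leRHS](bigID (fun i : 'I_(N + N) => (i < N)%N))/= -[leLHS]addr0.
  apply: lerD; last by rewrite sumr_ge0// => i _; rewrite sumr_ge0// => j _; apply: mulr_ge0.
  apply: ler_sum => i iN.
  rewrite (big_ord_widen (N + N) (fun j => `|u i| * `|v j|)) ?leq_addr//.
  rewrite [leRHS](bigID (fun j : 'I_(N + N) => (j < N)%N))/= -[leLHS]addr0.
  apply: lerD; last by rewrite sumr_ge0// => j _; apply: mulr_ge0.
  rewrite le_eqVlt; apply/orP; left; apply/eqP; apply: eq_bigl => j.
  by move: iN; clear; lia.
have UV_cvg : (fun N => U N * V N) @ \oo --> limn U * limn V by exact: cvgM.
have W_cvg : cvgn W.
  apply: nondecreasing_is_cvgn => //.
  have [M [_ MP]] := cvg_seq_bounded (cvgP _ UV_cvg).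
  exists (M + 1) => _ [N _ <-]; apply: le_trans (W_le N) _; apply: le_trans (ler_norm _) _.
  by apply: MP => //; rewrite ltrDl.
have d0 : (fun N => U N * V N - W N) @ \oo --> (0 : R).
  apply: (@squeeze_cvgr _ _ _ _ (fun=> 0) (fun N => W N.*2 - W N)).
  - by near=> N; rewrite subr_ge0 W_le /= lerD2r UV_le.
  - exact: cvg_cst.
  - rewrite -[X in _ --> X](subrr (limn W)); apply: cvgB => //.
    have dbl : (fun N : nat => N.*2) @ \oo --> \oo.
      under eq_fun do rewrite -mul2n.
      exact: cvg_mulnl.
    exact: (cvg_comp _ _ dbl W_cvg).
rewrite -[X in _ --> X]subr0.
have -> : [series conv u v k]_k =
    (fun N => series u N * series v N - (series u N * series v N - [series conv u v k]_k N)).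
  by apply/funext => N; rewrite opprB addrCA subrr addr0.
apply: cvgB; first exact: cvgM.
apply: norm_cvg0; apply: (@squeeze_cvgr _ _ _ _ (fun=> 0) (fun N => U N * V N - W N)) => //.
  near=> N; rewrite normr_ge0 /= !diffE.
  apply: le_trans (ler_norm_sum _ _ _) _; apply: ler_sum => i _.
  apply: le_trans (ler_norm_sum _ _ _) _; apply: ler_sum => j _.
  by rewrite normrM.
exact: cvg_cst.
Unshelve. all: by end_near.
Qed.

End Convolution.

(** * Power series with coefficients of exponential growth *)

Section PowerSeries.
Variable R : realType.
Implicit Types (f g a c : nat -> R) (t Q C : R).

Definition psum f t : R := limn (pseries f t).

Definition growth Q f : Prop := exists2 C, 0 <= C & forall k, `|f k| <= C * Q ^+ k.

Lemma growthW Q Q' f : 0 <= Q -> Q <= Q' -> growth Q f -> growth Q' f.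
Proof.
move=> Q0 QQ [C C0 fC]; exists C => // k; apply: le_trans (fC k) _.
by rewrite ler_wpM2l// lerXn2r// nnegrE (le_trans Q0).
Qed.

Lemma growth_cvg_norm Q f t : 0 <= Q -> `|t| * Q < 1 -> growth Q f ->
  cvgn [series `|f k * t ^+ k|]_k.
Proof.
move=> Q0 tQ [C C0 fC].
apply: (@series_le_cvg _ _ (geometric C (`|t| * Q))) => [k|k|k|] //=.
- by rewrite mulr_ge0// exprn_ge0// mulr_ge0.
- by rewrite normrM normrX exprMn mulrCA [leLHS]mulrC ler_wpM2l// exprn_ge0.
- by apply: is_cvg_geometric_series; rewrite ger0_norm// mulr_ge0.
Qed.

Lemma growth_cvg Q f t : 0 <= Q -> `|t| * Q < 1 -> growth Q f -> cvgn (pseries f t).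
Proof. by move=> Q0 tQ fQ; apply: normed_cvg; exact: growth_cvg_norm tQ fQ. Qed.

Lemma psum_le Q C f t : 0 <= Q -> `|t| * Q < 1 -> 0 <= C ->
  (forall k, `|f k| <= C * Q ^+ k) -> `|psum f t| <= C / (1 - `|t| * Q).
Proof.
move=> Q0 tQ C0 fC; have fQ : growth Q f by exists C.
have tQn : `| `|t| * Q| < 1 by rewrite ger0_norm// mulr_ge0.
apply: le_trans (lim_series_norm (growth_cvg_norm Q0 tQ fQ)) _.
rewrite -(cvg_lim _ (@cvg_geometric_series _ C _ tQn))//.
apply: lim_series_le (growth_cvg_norm Q0 tQ fQ) _ _.
  exact: is_cvg_geometric_series.
by move=> k /=; rewrite normrM normrX exprMn mulrCA [leLHS]mulrC ler_wpM2l// exprn_ge0.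
Qed.

Lemma psum_ge_partial f t n : 0 <= t -> (forall k, 0 <= f k) -> cvgn (pseries f t) ->
  \sum_(k < n) f k * t ^+ k <= psum f t.
Proof.
move=> t0 f0 fc; have -> : \sum_(k < n) f k * t ^+ k = pseries f t n.
  by rewrite /pseries /series /= big_mkord.
apply: nondecreasing_cvgn_le => //; apply/nondecreasing_seqP => N.
by rewrite /pseries /series /= big_nat_recr//= lerDl mulr_ge0// exprn_ge0.
Qed.

Lemma psumB f g t : cvgn (pseries f t) -> cvgn (pseries g t) ->
  psum (fun k => f k - g k) t = psum f t - psum g t.
Proof.
move=> fc gc; rewrite /psum -lim_seriesB//; congr (limn _).
rewrite /pseries; congr series; apply/funext => k.
exact: mulrBl.
Qed.

Lemma psum_finite f t n : (forall k, (n <= k)%N -> f k = 0) ->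
  psum f t = \sum_(k < n) f k * t ^+ k.
Proof.
move=> f0; apply: cvg_lim => //; apply: (cvg_near_cst); near=> N.
have nN : (n <= N)%N by near: N; exists n.
rewrite /pseries /series /= (big_cat_nat (n := n))//= big_mkord [X in _ + X]big1_seq ?addr0//.
by move=> k; rewrite mem_index_iota => /andP[_ /andP[/f0 -> _]]; rewrite mul0r.
Unshelve. all: by end_near.
Qed.

Lemma psum0 f : psum f 0 = f 0%N.
Proof.
apply: cvg_lim => //; apply: (cvg_near_cst); near=> N.
rewrite /pseries /series /= (big_cat_nat (n := 1%N))//=; last by near: N; exists 1%N.
rewrite big_nat1 expr0 mulr1 big1_seq ?addr0// => k.
by rewrite mem_index_iota => /andP[_ /andP[k0 _]]; rewrite expr0n eqn0Ngt k0 mulr0.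
Unshelve. all: by end_near.
Qed.

Lemma psum_conv Q f g t : 0 <= Q -> `|t| * Q < 1 -> growth Q f -> growth Q g ->
  pseries (conv f g) t @ \oo --> psum f t * psum g t.
Proof.
move=> Q0 tQ fQ gQ.
have := cauchy_product (growth_cvg_norm Q0 tQ fQ) (growth_cvg_norm Q0 tQ gQ).
have <- // : pseries (conv f g) t =
  [series conv (fun i => f i * t ^+ i) (fun i => g i * t ^+ i) k]_k.
rewrite /pseries; congr series; apply/funext => k /=.
rewrite /conv mulr_suml; apply: eq_bigr => i _; rewrite mulrACA -exprD subnKC//.
by rewrite -ltnS.
Qed.

(* Bernoulli's inequality [k e <= (1 + e) ^ k] absorbs the factor [k.+1]. *)
Lemma growth_diffs Q Q' f : 0 < Q -> Q < Q' -> growth Q f -> growth Q' (pseries_diffs f).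
Proof.
move=> Q0 QQ [C C0 fC]; set e := Q' / Q - 1.
have e0 : 0 < e by rewrite subr_gt0 ltr_pdivlMr// mul1r.
have bern k : 1 + k%:R * e <= (1 + e) ^+ k.
  elim: k => [|k IH]; first by rewrite mul0r addr0 expr0.
  rewrite exprS; apply: (@le_trans _ _ ((1 + e) * (1 + k%:R * e))); last first.
    by rewrite ler_wpM2l// addr_ge0// ltW.
  have : 0 <= k%:R * e * e by rewrite !mulr_ge0// ltW.
  rewrite -natr1; lra.
have le_k k : k.+1%:R <= (1 + e^-1) * (1 + e) ^+ k.
  apply: le_trans (ler_wpM2l _ (bern k)); last by rewrite addr_ge0// invr_ge0 ltW.
  have -> : (1 + e^-1) * (1 + k%:R * e) = 1 + k%:R + e^-1 + k%:R * e by field; rewrite gt_eqF.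
  have := mulr_ge0 (ler0n R k) (ltW e0); have : 0 <= e^-1 by rewrite invr_ge0 ltW.
  rewrite -natr1; lra.
exists (C * Q * (1 + e^-1)); first by rewrite !mulr_ge0 ?addr_ge0 ?invr_ge0// ltW.
move=> k; rewrite /pseries_diffs normrM ger0_norm ?ler0n//.
apply: le_trans (ler_wpM2l _ (fC k.+1)) _ => //.
apply: le_trans (ler_wpM2r _ (le_k k)) _; first by rewrite mulr_ge0// exprn_ge0// ltW.
have Q'E : Q' = (1 + e) * Q by rewrite /e addrC subrK divfK// gt_eqF.
rewrite [in leRHS]Q'E exprMn exprS le_eqVlt; apply/orP; left; apply/eqP; ring.
Qed.

(** Termwise differentiation asks for convergence of the series and of its first two formal
    derivatives at some [K] beyond [|t|]; the rates [Q < Q1 < Q2 < 1/K] leave room for them. *)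
Lemma is_derive_psum Q f t : 0 < Q -> `|t| * Q < 1 -> growth Q f ->
  is_derive t (1 : R) (psum f) (psum (pseries_diffs f) t).
Proof.
move=> Q0 tQ fQ.
have [K tK KQ] : exists2 K, `|t| < K & K * Q < 1.
  have : `|t| < Q^-1 by rewrite -[Q^-1]mul1r ltr_pdivlMr.
  move=> /midf_lt[h1 h2]; exists ((`|t| + Q^-1) / 2%:R) => //.
  by rewrite -ltr_pdivlMr// mul1r.
have K0 : 0 < K by apply: le_lt_trans tK.
have [Q1 QQ1 Q1K] : exists2 Q1, Q < Q1 & K * Q1 < 1.
  have : Q < K^-1 by rewrite -[K^-1]mul1r ltr_pdivlMr// mulrC.
  move=> /midf_lt[h1 h2]; exists ((Q + K^-1) / 2%:R) => //.
  by rewrite mulrC -ltr_pdivlMr// mul1r.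
have Q10 : 0 < Q1 by exact: lt_trans QQ1.
have [Q2 QQ2 Q2K] : exists2 Q2, Q1 < Q2 & K * Q2 < 1.
  have : Q1 < K^-1 by rewrite -[K^-1]mul1r ltr_pdivlMr// mulrC.
  move=> /midf_lt[h1 h2]; exists ((Q1 + K^-1) / 2%:R) => //.
  by rewrite mulrC -ltr_pdivlMr// mul1r.
have f1 := growth_diffs Q0 QQ1 fQ; have f2 := growth_diffs Q10 QQ2 f1.
have KE : `|K| = K by rewrite ger0_norm// ltW.
apply: (@pseries_snd_diffs _ f K t).
- by apply: growth_cvg fQ; rewrite ?KE// ltW.
- by apply: growth_cvg f1; rewrite ?KE// ltW.
- by apply: growth_cvg f2; rewrite ?KE// (ltW (lt_trans Q10 QQ2)).
- by rewrite KE.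
Qed.

(** The relation between the coefficients says [a' = g' a], so [a exp(-g)] has derivative 0 on
    [[0, t]] and keeps its value 1 at 0. *)
Lemma psum_exp Q a g t : 0 < Q -> 0 <= t -> t * Q < 1 -> growth Q a -> growth Q g ->
  a 0%N = 1 -> g 0%N = 0 -> (forall k, k%:R * a k = conv (fun i => i%:R * g i) a k) ->
  psum a t = expR (psum g t).
Proof.
move=> Q0 t0 tQ aQ gQ a0 g0 aE.
have diffE : pseries_diffs a = conv (pseries_diffs g) a.
  apply/funext => k; rewrite /pseries_diffs aE /conv big_ord_recl /= !mul0r add0r.
  by apply: eq_bigr => i _; rewrite /bump /= add1n subSS.
pose h x := psum a x * expR (- psum g x).
have h' x : `|x| * Q < 1 -> is_derive x (1 : R) h 0.
  move=> xQ; have ga := is_derive_psum Q0 xQ aQ; have gg := is_derive_psum Q0 xQ gQ.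
  have -> : 0 = psum a x *: (- (psum (pseries_diffs g) x) * expR (- psum g x)) +
      expR (- psum g x) *: psum (pseries_diffs a) x.
    have [Q1 QQ1 xQ1] : exists2 Q1, Q < Q1 & `|x| * Q1 < 1.
      have [x0|x0] := eqVneq x 0.
        by exists (Q + 1); rewrite ?ltrDl// x0 normr0 mul0r.
      have x0' : 0 < `|x| by rewrite normr_gt0.
      have : Q < `|x|^-1 by rewrite -[_^-1]mul1r ltr_pdivlMr// mulrC.
      move=> /midf_lt[h1 h2]; exists ((Q + `|x|^-1) / 2%:R) => //.
      by rewrite mulrC -ltr_pdivlMr// mul1r.
    have Q10 : 0 <= Q1 by apply: ltW; exact: lt_trans QQ1.
    have := psum_conv Q10 xQ1 (growth_diffs Q0 QQ1 gQ) (growthW (ltW Q0) (ltW QQ1) aQ).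
    rewrite -diffE => /(cvg_lim (@Rhausdorff R)); rewrite -/(psum _ _) => ->.
    by rewrite /GRing.scale /=; ring.
  have ge : is_derive x (1 : R) (expR \o (fun y => - psum g y))
      (- psum (pseries_diffs g) x * expR (- psum g x)).
    rewrite mulrC; apply: is_derive1_comp.
  exact: (is_deriveM ga ge).
have h0 : h 0 = 1 by rewrite /h !psum0 a0 g0 oppr0 expR0 mulr1.
have ht : h t = 1.
  have [c _ ] : exists2 c, c \in `[0, t]%R & h t - h 0 = (fun=> 0) c * (t - 0).
    apply: MVT_segment => // [x /itvP xt|].
      by apply: h'; rewrite ger0_norm ?xt// (le_lt_trans _ tQ)// ler_pM2r// ltW// xt.
    apply: derivable_within_continuous => x /itvP xt.
    have : is_derive x (1 : R) h 0.
      by apply: h'; rewrite ger0_norm ?xt// (le_lt_trans _ tQ)// ler_pM2r// xt.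
    by case.
  by rewrite /= mul0r h0 => /eqP; rewrite subr_eq0 => /eqP.
by rewrite -[LHS]mulr1 -(expRxMexpNx_1 (psum g t)) mulrA mulrAC -/(h t) ht mul1r.
Qed.

End PowerSeries.

(** * Coefficients of Euler products and linear recurrences *)

Section EulerProducts.
Variable R : realType.
Implicit Types (A B a b f : nat -> R) (t Q C : R).

Lemma sum_multiples (V : nmodType) (F : nat -> V) d k : (0 < d)%N ->
  \sum_(1 <= j < k.+1) (if (j * d <= k)%N then F (j * d)%N else 0) =
  \sum_(1 <= m < k.+1 | (d %| m)%N) F m.
Proof.
move=> d0; transitivity (\sum_(1 <= j < k.+1) \sum_(1 <= m < k.+1 | m == (j * d)%N) F m).
  rewrite !big_nat; apply: eq_bigr => j /andP[j0 jk].
  by rewrite big_nat1_eq muln_gt0 j0 d0 /= ltnS.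
rewrite (exchange_big_dep_nat (fun m => d %| m)%N)/=; last first.
  by move=> j m _ _ _ /eqP ->; rewrite dvdn_mull.
rewrite big_nat_cond [RHS]big_nat_cond; apply: eq_bigr => m /andP[/andP[m0 mk] dm].
have -> : \sum_(1 <= j < k.+1 | m == (j * d)%N) F m =
    \sum_(1 <= j < k.+1 | j == (m %/ d)%N) F m.
  by apply: eq_bigl => j; rewrite eq_sym -{2}(mulnK j d0) -eqn_div// eq_sym mulnK// eq_sym.
rewrite big_nat1_eq divn_gt0// (dvdn_leq m0 dm)/= ltnS (leq_trans (leq_div _ _) _)//.
Qed.

(* [lam m / m] is the [m]-th coefficient of the logarithm of the Euler product
   with [d]-th factor [(1 - t ^ d) ^ - ((B d + b d) / 2) * (1 + t ^ d) ^ - ((B d - b d) / 2)]. *)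
Definition lam b B (m : nat) : R :=
  \sum_(1 <= d < m.+1 | (d %| m)%N) d%:R * (if odd (m %/ d) then b d else B d).

Definition euler_coef a b B :=
  forall k, k%:R * a k = conv (lam b B) a k.

Lemma lam0 b B : lam b B 0 = 0.
Proof. by rewrite /lam big_geq. Qed.

Lemma euler_coefP a b B :
  (forall k, k%:R * a k = \sum_(1 <= d < k.+1) \sum_(1 <= j < k.+1)
     if (j * d <= k)%N then d%:R * (if odd j then b d else B d) * a (k - j * d)%N else 0) ->
  euler_coef a b B.
Proof.
move=> aE k; rewrite aE /conv big_ord_recl lam0 mul0r add0r.
transitivity (\sum_(1 <= d < k.+1) \sum_(1 <= m < k.+1 | (d %| m)%N)
    d%:R * (if odd (m %/ d) then b d else B d) * a (k - m)%N).
  rewrite !big_nat; apply: eq_bigr => d /andP[d0 _].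
  rewrite -sum_multiples//; apply: eq_bigr => j _; by rewrite mulnK.
rewrite (exchange_big_dep_nat xpredT)//= big_add1 /= big_mkord; apply: eq_bigr => i _.
rewrite /bump add1n mulr_suml [RHS](big_nat_widen _ _ k.+1)/=; last by rewrite !ltnS.
apply: eq_big => // d; rewrite andbC; case: ltnP => //; rewrite ltnNge => id.
by apply/negbTE; apply: contraNN id => /dvdn_leq ->.
Qed.

Definition recurrence_from k0 (p q : R) f :=
  forall k, (k0 <= k)%N -> f k.+2 = p * f k.+1 - q * f k.

(** The characteristic roots are 1 and [Q], and taking differences removes the root 1. *)
Lemma recurrence_diff Q k0 f : recurrence_from k0 (1 + Q) Q f ->
  forall i, f (k0 + i).+1 - f (k0 + i)%N = (f k0.+1 - f k0) * Q ^+ i.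
Proof.
move=> fE; elim=> [|i IH]; first by rewrite addn0 expr0 mulr1.
rewrite addnS fE ?leq_addr// exprS mulrCA -IH; ring.
Qed.

Lemma recurrence_ge Q k0 f : (forall k, 0 <= f k) -> recurrence_from k0 (1 + Q) Q f ->
  forall i, (f k0.+1 - f k0) * Q ^+ i <= f (k0 + i).+1.
Proof. by move=> f0 /recurrence_diff fE i; rewrite -fE gerBl. Qed.

Lemma recurrence_growth Q k0 f : 2 <= Q -> (forall k, 0 <= f k) -> f k0 <= f k0.+1 ->
  recurrence_from k0 (1 + Q) Q f -> growth Q f.
Proof.
move=> Q2 f0 f_le fE; set D := f k0.+1 - f k0.
have D0 : 0 <= D by rewrite subr_ge0.
have s0 : 0 <= \sum_(i < k0) f i by apply: sumr_ge0.
have Q1 k : 1 <= Q ^+ k by rewrite exprn_ege1//; lra.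
have le1 i : f (k0 + i)%N <= f k0 + D * Q ^+ i.
  elim: i => [|i IH]; first by rewrite addn0 expr0 mulr1 lerDl.
  have := recurrence_diff fE i; rewrite -/D addnS => fi.
  (* Here [Q >= 2] enters: [Q^i + Q^i <= Q^(i+1)]. *)
  have : 0 <= D * Q ^+ i * (Q - 2) by rewrite mulr_ge0 ?mulr_ge0 ?subr_ge0// (le_trans ler01).
  rewrite exprS; lra.
have C0 : 0 <= \sum_(i < k0) f i + f k0 + D by exact: addr_ge0 (addr_ge0 s0 _) D0.
exists (\sum_(i < k0) f i + f k0 + D) => // k; rewrite ger0_norm//.
have [kk|kk] := leqP k0 k.
  rewrite -(subnKC kk); apply: le_trans (le1 _) _.
  apply: (@le_trans _ _ ((f k0 + D) * Q ^+ (k0 + (k - k0)))).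
    rewrite [leRHS]mulrDl; apply: lerD; first by rewrite ler_peMr.
    by rewrite ler_wpM2l// ler_weXn2l ?leq_addl//; lra.
  rewrite ler_wpM2r//; first exact: le_trans (Q1 _).
  by rewrite -addrA lerDr.
apply: (@le_trans _ _ (\sum_(i < k0) f i + f k0 + D)); last by rewrite ler_peMr.
rewrite (bigD1 (Ordinal kk))//= -!addrA lerDl addr_ge0 ?sumr_ge0//.
exact: addr_ge0 _ D0.
Qed.

Lemma conv_vanish u v n m : (forall k, (n <= k)%N -> u k = 0) ->
  (forall k, (m <= k)%N -> v k = 0) -> forall k, (n + m <= k)%N -> conv u v k = 0 :> R.
Proof.
move=> u0 v0 k nmk; apply: big1 => i _; have [ni|ni] := leqP n i.
  by rewrite u0// mul0r.
by rewrite v0 ?mulr0//; move: nmk ni; clear; lia.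
Qed.

Lemma conv_nth (s : seq R) f k : (size s <= k.+1)%N ->
  conv (nth 0 s) f k = \sum_(i < size s) s`_i * f (k - i)%N.
Proof.
move=> sk; rewrite (big_ord_widen k.+1 (fun i => s`_i * f (k - i)%N) sk) big_mkcond.
by apply: eq_bigr => i _; case: ltnP => // si; rewrite nth_default// mul0r.
Qed.

(** In terms of power series, multiplication by [1 - p X + q X^2] leaves a polynomial. *)
Lemma recurrence_conv k0 p q f : recurrence_from k0 p q f ->
  forall k, (k0.+2 <= k)%N -> conv (nth 0 [:: 1; - p; q]) f k = 0.
Proof.
move=> fE [|[|k]]// kk; rewrite conv_nth// !big_ord_recl big_ord0 /= /bump /= fE//.
rewrite !addn0 !subSS !subn0; ring.
Qed.

(* [(1 - (1 + Q) X + Q X^2) (1 + (1 + Q) X + Q X^2) = 1 - (1 + Q^2) X^2 + Q^2 X^4] *)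
Lemma conv_recurrence Q k0 f g : recurrence_from k0 (1 + Q) Q f ->
  recurrence_from k0 (- (1 + Q)) Q g -> forall k, (k0.*2.+4 <= k.+4)%N ->
  conv f g k.+4 = (1 + Q ^+ 2) * conv f g k.+2 - Q ^+ 2 * conv f g k.
Proof.
move=> /recurrence_conv uf /recurrence_conv vg k kk.
set u := nth 0 _ in uf; set v := nth 0 _ in vg.
have uvE i : conv u v i = [:: 1; 0; - (1 + Q ^+ 2); 0; Q ^+ 2]`_i.
  have [i6|i6] := leqP 6 i.
    rewrite [RHS]nth_default; last by move: i6; clear; case: i => [|[|[|[|[|]]]]].
    apply: (@conv_vanish _ _ 3 3) => // j j3; first by rewrite /u nth_default.
    by rewrite /v nth_default.
  case: i i6 => [|[|[|[|[|[|//]]]]]] _;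
    by rewrite /conv !big_ord_recl big_ord0 /= /bump /= /u /v /=; ring.
have : conv (conv u f) (conv v g) k.+4 = 0.
  by apply: (conv_vanish uf vg); move: kk; clear; lia.
have -> : conv (conv u f) (conv v g) k.+4 = conv (conv u v) (conv f g) k.+4.
  rewrite convA [RHS]convA; apply: eq_conv => // i _.
  rewrite -!convA; apply: eq_conv => // j _; exact: convC.
rewrite (@eq_conv _ _ (nth 0 [:: 1; 0; - (1 + Q ^+ 2); 0; Q ^+ 2]) _ (conv f g))//.
rewrite conv_nth// !big_ord_recl big_ord0 /= /bump /= !addn0 !subSS !subn0.
move: (conv f g k.+4) (conv f g k.+2) (conv f g k.+1) (conv f g k.+3) (conv f g k).
by move=> x y z w r H; lra.
Qed.

(** A divisor [d] contributes [d (B d + b d)] or [2 d (B d)]. The sum belongs to the logarithmic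
    derivative of [Z(t) L(t, chi)]. *)
Lemma lam_ge0 b B m : (forall d, `|b d| <= B d) -> 0 <= lam B B m + lam b B m.
Proof.
move=> bB; rewrite /lam -big_split sumr_ge0// => d _ /=; rewrite -mulrDr mulr_ge0//.
have B0 : 0 <= B d by exact: le_trans (bB d).
have := bB d; rewrite ler_norml => /andP[b1 b2]; case: ifP => _; lra.
Qed.

(** If [d] divides [m], then [2 m / d] is even and the twist disappears, so the divisors of [m]
    alone already contribute the left side. This makes [Z(t) L(t, chi)] dominate [Z(t^2)]. *)
Lemma lam_double b B m : (0 < m)%N -> (forall d, `|b d| <= B d) ->
  lam B B m *+ 2 <= lam B B m.*2 + lam b B m.*2.
Proof.
move=> m0 bB; have B0 d : 0 <= B d by exact: le_trans (bB d).
rewrite /lam -sumrMnl -big_split /=.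
rewrite (big_nat_widen _ _ m.*2.+1)/=; last by rewrite ltnS -addnn leq_addr.
rewrite big_mkcond [leRHS]big_mkcond; apply: ler_sum => d _.
have [/andP[dm _]|_] := ifP; last first.
  case: ifP => // _; rewrite -mulrDr mulr_ge0//.
  by have := bB d; rewrite ler_norml => /andP[b1 b2]; have := B0 d; case: ifP => _; lra.
have d0 : (0 < d)%N by apply: dvdn_gt0 dm.
rewrite -muln2 dvdn_mulr// muln2.
have -> : (m.*2 %/ d = (m %/ d).*2)%N by rewrite -!mul2n muln_divA.
by rewrite odd_double !if_same mulr2n.
Qed.

End EulerProducts.

(** * Behaviour of the zeta and twisted series near 1/Q *)

Section AnalyticEstimates.
Variables (R : realType) (Q : R) (A B : nat -> R) (k0 : nat).
Hypothesis Q2 : 2 <= Q.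
Hypothesis A0 : A 0 = 1.
Hypothesis A_ge0 : forall k, 0 <= A k.
Hypothesis B_ge0 : forall d, 0 <= B d.
Hypothesis BA : forall d, B d <= A d.
Hypothesis A_lt : A k0 < A k0.+1.
Hypothesis A_rec : recurrence_from k0 (1 + Q) Q A.
Hypothesis A_euler : euler_coef A B B.
Implicit Types (a b : nat -> R).

Let Q_gt0 : 0 < Q. Proof. by apply: lt_le_trans Q2. Qed.
Let Q_ge0 : 0 <= Q. Proof. exact: ltW. Qed.
Let Q_exp_ge1 k : 1 <= Q ^+ k. Proof. by rewrite exprn_ege1//; have := Q2; lra. Qed.
Let A_growth : growth Q A. Proof. exact: recurrence_growth (ltW A_lt) A_rec. Qed.

Section Twist.
Variables (a b : nat -> R).
Hypothesis a0 : a 0 = 1.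
Hypothesis aA : forall k, `|a k| <= A k.
Hypothesis bB : forall d, `|b d| <= B d.
Hypothesis a_euler : euler_coef a b B.

Let a_growth : growth Q a.
Proof.
have [C C0 A_le] := A_growth; exists C => // k.
exact: le_trans (aA k) (le_trans (ler_norm _) (A_le k)).
Qed.

Lemma sum_exp_le n : \sum_(1 <= d < n.+1) Q ^+ d <= Q ^+ n *+ 2.
Proof.
elim: n => [|n IH]; first by rewrite big_geq// mulrn_wge0.
rewrite big_nat_recr//=; have := Q_exp_ge1 n; have : 0 <= Q ^+ n * (Q - 2).
  by rewrite mulr_ge0 ?exprn_ge0// subr_ge0.
by move: IH; rewrite exprS; lra.
Qed.

Lemma sum_even_le (f : nat -> R) n : (forall i, 0 <= f i) ->
  \sum_(i < n.+1) f i.*2 <= \sum_(j < n.*2.+1) f j.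
Proof.
move=> f0; elim: n => [|n IH]; first by rewrite !big_ord1.
by rewrite big_ord_recr doubleS /= [leRHS]big_ord_recr [X in _ <= X + _]big_ord_recr /=
  -addrA lerD// lerDr.
Qed.

(** The term [d = m] is [m * b m]; all other divisors are at most [m / 2], and their terms are
    bounded by a geometric sum. *)
Lemma lam_approx : exists2 C, 0 <= C & forall m,
  `|lam b B m - m%:R * b m| <= m%:R * (C * Q ^+ m./2).
Proof.
have [C C0 A_le] := A_growth; exists (C *+ 2) => [|[|m]]; first by rewrite mulrn_wge0.
  by rewrite lam0 !mul0r subrr normr0.
rewrite /lam big_mkcond big_nat_recr//= dvdnn divnn/= addrK.
apply: le_trans (ler_norm_sum _ _ _) _.
have BC d : B d <= C * Q ^+ d by exact: le_trans (BA d) (le_trans (ler_norm _) (A_le d)).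
apply: (@le_trans _ _ (\sum_(1 <= d < (m.+1)./2.+1) m.+1%:R * (C * Q ^+ d))); last first.
  rewrite -mulr_sumr ler_wpM2l// -mulr_sumr mulrnAl -mulrnAr ler_wpM2l//; exact: sum_exp_le.
rewrite [leRHS](big_nat_widen _ _ m.+1)/=; last first.
  by rewrite ltnS; clear; case: m => // m; lia.
rewrite [leRHS]big_mkcond [leLHS]big_nat_cond [leRHS]big_nat_cond.
apply: ler_sum => d; rewrite andbT => /andP[d0 dm].
have B0 : 0 <= B d by exact: le_trans (bB d).
have C1 : 0 <= m.+1%:R * (C * Q ^+ d) by rewrite !mulr_ge0// exprn_ge0.
case: ifP => dvd; last by rewrite normr0; case: ifP.
have -> : (d < (m.+1)./2.+1)%N.
  case/dvdnP: dvd => -[|[|j]] jE; [by []|by move: jE dm; rewrite mul1n => ->; rewrite ltnn|].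
  by rewrite ltnS jE geq_half_double -mul2n leq_mul2r orbT.
rewrite normrM normr_nat ler_pM//; first by rewrite ler_nat ltnW.
by case: ifP => _; [exact: le_trans (bB d) (BC d)|rewrite ger0_norm].
Qed.

(** The coefficients [g] of the logarithm differ from [b] by terms of order [Q^(m/2)]. As [t Q < 1]
    implies [t sqrt(Q) < 1 / sqrt(Q)], the difference of the two series is bounded up to [1/Q]. *)
Lemma psum_log : exists2 g : nat -> R,
  (forall t, 0 <= t -> t * Q < 1 -> psum a t = expR (psum g t)) &
  exists C, forall t, 0 <= t -> t * Q < 1 -> `|psum g t - psum b t| <= C.
Proof.
have [C C0 b_lam] := lam_approx; have [D D0 A_le] := A_growth.
pose q := Num.sqrt Q; have qq : q ^+ 2 = Q by rewrite sqr_sqrtr.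
have q1 : 1 < q.
  rewrite -sqrtr1 ltr_sqrt ?ltr01//; have := Q2; lra.
have q0 : 0 < q by exact: lt_trans q1.
pose g m : R := lam b B m / m%:R.
have gE m : m%:R * g m = lam b B m.
  case: m => [|m]; first by rewrite lam0 mul0r.
  by rewrite /g mulrC divfK// pnatr_eq0.
have b_ge0 d : 0 <= B d by exact: le_trans (bB d).
(* The summand 1 covers [m = 0], where [g 0 = 0] and [|b 0| <= A 0 = 1]. *)
have gb m : `|g m - b m| <= (C + 1) * q ^+ m.
  case: m => [|m].
    rewrite expr0 mulr1 /g lam0 mul0r sub0r normrN.
    by apply: le_trans (bB 0) (le_trans (BA 0) _); rewrite A0 lerDr.
  have : m.+1%:R * `|g m.+1 - b m.+1| <= m.+1%:R * (C * Q ^+ m.+1./2).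
    by rewrite -{1}normr_nat -normrM mulrBr gE b_lam.
  rewrite ler_pM2l ?ltr0n// => /le_trans; apply.
  apply: (@le_trans _ _ (C * q ^+ m.+1)).
    by rewrite ler_wpM2l// -qq -exprM ler_weXn2l ?(ltW q1)//; clear; lia.
  by rewrite ler_wpM2r ?exprn_ge0 ?lerDl// ltW.
have b_growth : growth Q b.
  exists D => // k; apply: le_trans (bB k) (le_trans (BA k) _).
  exact: le_trans (ler_norm _) (A_le k).
have qQ : q <= Q by rewrite -qq expr2 ler_peMl// ltW.
have gb_growth : growth q (fun k => g k - b k) by exists (C + 1) => //; rewrite addr_ge0.
have g_growth : growth Q g.
  have [E E0 gbE] := growthW (ltW q0) qQ gb_growth; have [E' E'0 bE] := b_growth.
  exists (E + E') => [|k]; first by rewrite addr_ge0.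
  rewrite -[g k](subrK (b k)) mulrDl; exact: le_trans (ler_normD _ _) (lerD (gbE k) (bE k)).
exists g.
  move=> t t0 tQ; apply: psum_exp Q_gt0 t0 tQ a_growth g_growth a0 _ _.
    by rewrite /g lam0 mul0r.
  by move=> k; rewrite a_euler; apply: eq_conv => // i _; rewrite gE.
exists ((C + 1) / (1 - q^-1)) => t t0 tQ.
have tE : `|t| = t by rewrite ger0_norm.
have tq : t * q < q^-1 by rewrite -[ltRHS]mul1r ltr_pdivlMr// -mulrA -expr2 qq.
have q'1 : q^-1 < 1 by rewrite invf_lt1.
rewrite -psumB; first last.
- by apply: growth_cvg Q_ge0 _ b_growth; rewrite tE.
- by apply: growth_cvg Q_ge0 _ g_growth; rewrite tE.
apply: (@le_trans _ _ ((C + 1) / (1 - `|t| * q))).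
  by apply: psum_le => //; rewrite ?addr_ge0 ?(ltW q0)// tE (lt_trans tq).
rewrite tE ler_wpM2l ?addr_ge0// lef_pV2 ?posrE ?subr_gt0 ?(lt_trans tq)//.
by rewrite lerD2l lerN2 ltW.
Qed.

Hypothesis a_rec : recurrence_from k0 (- (1 + Q)) Q a.

Let c := conv A a.
Let mu m := lam B B m + lam b B m.

Let c_euler k : k%:R * c k = conv mu c k.
Proof. exact: conv_derivation. Qed.

Let c_ge0 k : 0 <= c k.
Proof.
elim/ltn_ind: k => -[|k] IH; first by rewrite /c /conv big_ord1 A0 a0 mulr1.
rewrite -(pmulr_rge0 _ (ltr0Sn R k)) c_euler /conv big_ord_recl /mu !lam0 addr0 mul0r add0r.
apply: sumr_ge0 => i _; apply: mulr_ge0; first exact: lam_ge0.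
by apply: IH; rewrite /= /bump add1n subSS ltnS leq_subr.
Qed.

(** Induction along the Euler recursions for [2 k c_(2k)] and [k A_k]: [lam_double] compares the
    terms of even index in the former with those of the latter, and the odd ones are nonnegative. *)
Let c_double k : A k <= c k.*2.
Proof.
elim/ltn_ind: k => -[|k] IH; first by rewrite /c /conv big_ord1 A0 a0 mulr1.
have lamB_ge0 m : 0 <= lam B B m by rewrite sumr_ge0// => d _; rewrite if_same mulr_ge0.
rewrite -(ler_pM2l (ltr0Sn R k.*2.+1)) -doubleS c_euler.
rewrite -mul2n natrM -mulrA A_euler /conv mulr_sumr.
apply: (@le_trans _ _ (\sum_(i < k.+2) mu i.*2 * c (k.+1.*2 - i.*2)%N)).
  apply: ler_sum => i _; rewrite mulrA -doubleB.
  have [->|i0] := posnP i; first by rewrite /mu !lam0 addr0 mulr0 !mul0r.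
  apply: ler_pM => //; first by rewrite mulr_ge0.
    by rewrite mulrC mulr_natr lam_double.
  by apply: IH; rewrite ltn_subrL i0.
rewrite [leRHS](_ : _ = \sum_(j < k.+1.*2.+1) mu j * c (k.+1.*2 - j)%N) ?mul2n//.
apply: (sum_even_le (f := fun j => mu j * c (k.+1.*2 - j)%N)) => j; apply: mulr_ge0 => //; exact: lam_ge0.
Qed.

(** The sequence [c_(2j)] has characteristic roots 1 and [Q^2]. If its difference at the threshold
    were not positive, it would stay bounded, but it dominates [A], which grows at least
    linearly. *)
Let c_growth : exists2 D, 0 < D & exists J, forall i, D * Q ^+ i.*2 <= c (J + i).*2.
Proof.
pose e j := c j.*2.
have e_rec : recurrence_from k0.+2 (1 + Q ^+ 2) (Q ^+ 2) e.
  move=> j kj; rewrite /e !doubleS; apply: (@conv_recurrence R Q k0) => //.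
  by move: kj; clear; lia.
have e_ge0 j : 0 <= e j by exact: c_ge0.
set J := k0.+2 in e_rec *; exists (e J.+1 - e J); last first.
  exists J.+1 => i; rewrite -mul2n exprM; exact: recurrence_ge.
rewrite ltNge; apply/negP => e_le0.
have e_bound i : e (J + i)%N <= e J.
  elim: i => [|i]; first by rewrite addn0.
  apply: le_trans; rewrite -subr_le0 addnS (recurrence_diff e_rec).
  by rewrite mulr_le0_ge0// exprn_ge0// exprn_ge0.
have A_lin i : A k0 + i%:R * (A k0.+1 - A k0) <= A (k0 + i)%N.
  elim: i => [|i IH]; first by rewrite mul0r addr0 addn0.
  have := recurrence_diff A_rec i; have := Q_exp_ge1 i.
  rewrite addnS -natr1; move: A_lt IH; rewrite -subr_gt0; set D := A k0.+1 - _ => D0 IH q1 DE.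
  have : D * 1 <= D * Q ^+ i by rewrite ler_pM2l.
  by move: IH DE; lra.
have D0 : 0 < A k0.+1 - A k0 by rewrite subr_gt0.
have := archi_boundP (divr_ge0 (e_ge0 J) (ltW D0)); set N := Num.bound _.
rewrite ltr_pdivrMr// ltNge => /negP; apply.
apply: le_trans (e_bound N); apply: le_trans (c_double _).
have -> : (J + N = k0 + N.+2)%N by rewrite /J addnS addnS.
apply: le_trans (A_lin _); rewrite ler_wpDl//.
by rewrite ler_wpM2r ?(ltW D0)// ler_nat -addn2 leq_addr.
Qed.

(** The recurrence makes [(1 + t) (1 + Q t) a(t)] a polynomial, and the factor is at least 1 for
    [t >= 0]. *)
Let a_bounded : exists M, forall t, 0 <= t -> t * Q < 1 -> psum a t <= M.
Proof.
pose w := nth 0 [:: 1; - - (1 + Q); Q] : nat -> R.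
have w0 k : (3 <= k)%N -> w k = 0 by move=> k3; rewrite /w nth_default.
have w_growth : growth Q w.
  exists (\sum_(i < 3) `|w i|) => [|k]; first exact: sumr_ge0.
  have [k3|k3] := leqP 3 k.
    by rewrite w0// normr0 mulr_ge0 ?exprn_ge0// sumr_ge0.
  apply: (@le_trans _ _ (\sum_(i < 3) `|w i|)); last by rewrite ler_peMr// sumr_ge0.
  by rewrite (bigD1 (Ordinal k3))//= lerDl sumr_ge0.
exists (\sum_(k < k0.+2) `|conv w a k|) => t t0 tQ.
have tE : `|t| = t by rewrite ger0_norm.
have t1 : t <= 1.
  by apply: le_trans (ltW tQ); rewrite ler_peMr//; have := Q2; lra.
have := @psum_conv _ Q w a t Q_ge0.
rewrite tE => /(_ tQ w_growth a_growth) /(cvg_lim (@Rhausdorff R)).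
rewrite -/(psum _ _) (psum_finite _ (recurrence_conv a_rec)) (psum_finite _ w0).
have -> : \sum_(k < 3) w k * t ^+ k = 1 + ((1 + Q) * t + Q * t ^+ 2).
  by rewrite !big_ord_recl big_ord0 /w /= /bump /=; ring.
move=> waE.
have [a_le0|/ltW a_gt0] := lerP (psum a t) 0; first by apply: le_trans a_le0 _; exact: sumr_ge0.
apply: (@le_trans _ _ ((1 + ((1 + Q) * t + Q * t ^+ 2)) * psum a t)).
  by rewrite ler_peMl// lerDl addr_ge0// mulr_ge0 ?addr_ge0// exprn_ge0.
rewrite -waE; apply: le_trans (ler_norm _) _; apply: le_trans (ler_norm_sum _ _ _) _.
by apply: ler_sum => k _; rewrite normrM ler_piMr// ger0_norm ?exprn_ge0// exprn_ile1.
Qed.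

(** With [y = (t Q)^2], the even terms give [c(t) >= D t^(2J) / (2 (1 - y))]. The constant then
    comes from [1 - y <= 2 (1 - t Q)] and [t >= 1 / (2 Q)]. *)
Let c_psum_ge : exists2 m, 0 < m &
  forall t, 2^-1 <= t * Q -> t * Q < 1 -> m <= psum c t * (1 - t * Q).
Proof.
have [D D0 [J cJ]] := c_growth; exists (D * (2^-1 / Q) ^+ J.*2 * 4^-1).
  by rewrite !mulr_gt0 ?exprn_gt0 ?mulr_gt0 ?invr_gt0.
move=> t t2 tQ; have t2' : 2^-1 / Q <= t by rewrite ler_pdivrMr.
have t0 : 0 < t by apply: lt_le_trans t2'; rewrite mulr_gt0 ?invr_gt0.
set y := (t * Q) ^+ 2; have y0 : 0 <= y by rewrite exprn_ge0// mulr_ge0// ltW.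
have tQ0 : 0 <= t * Q by rewrite mulr_ge0// ltW.
have y1 : y < 1 by rewrite /y expr_lt1.
(* A partial sum of this length is already at least half of the geometric series in [y]. *)
have [N yN] : exists N, y ^+ N.+1 <= 2^-1.
  have : geometric 1 y @ \oo --> (0 : R) by apply: cvg_geometric; rewrite ger0_norm.
  move/cvgr_le => /(_ 2^-1); rewrite invr_gt0 ltr0n => /(_ isT)[N _ yN]; exists N.
  by have := yN N.+1; rewrite /= mul1r; apply.
have tE : `|t| = t by rewrite ger0_norm// ltW.
have c_cvg : cvgn (pseries c t).
  by apply/cvg_ex; exists (psum A t * psum a t); apply: (@psum_conv _ Q) => //; rewrite tE.
have c_le : \sum_(i < N.+1) D * t ^+ J.*2 * y ^+ i <= psum c t.
  apply: le_trans (psum_ge_partial (J + N).*2.+1 (ltW t0) c_ge0 c_cvg).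
  apply: le_trans (sum_even_le (f := fun k => c k * t ^+ k) _ _); last first.
    by move=> k; rewrite mulr_ge0// exprn_ge0// ltW.
  rewrite -addnS big_split_ord /= ler_wpDl//.
    by rewrite sumr_ge0// => i _; rewrite mulr_ge0// exprn_ge0// ltW.
  apply: ler_sum => i _; rewrite /y -exprM mul2n exprMn.
  have -> : D * t ^+ J.*2 * (t ^+ i.*2 * Q ^+ i.*2) = D * Q ^+ i.*2 * t ^+ (J + i).*2.
    by rewrite doubleD exprD; ring.
  by rewrite ler_wpM2r// exprn_ge0// ltW.
have : (1 - y) * psum c t >= D * t ^+ J.*2 * 2^-1.
  have := ler_wpM2l (_ : 0 <= 1 - y) c_le; rewrite subr_ge0 (ltW y1) => /(_ isT).
  rewrite -mulr_sumr mulrCA -opprB mulNr -subrX1 opprB; apply: le_trans.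
  by rewrite ler_pM2l ?mulr_gt0 ?exprn_gt0//; lra.
have -> : (1 - y) * psum c t =
  2 * (psum c t * (1 - t * Q)) - (1 - t * Q) * (psum c t * (1 - t * Q)) by rewrite /y; ring.
have tJ : D * (2^-1 / Q) ^+ J.*2 <= D * t ^+ J.*2.
  by rewrite ler_pM2l// lerXn2r// nnegrE ltW// mulr_gt0 ?invr_gt0.
have psum_ge0 : 0 <= psum c t * (1 - t * Q).
  rewrite mulr_ge0 ?subr_ge0 ?(ltW tQ)//; apply: le_trans c_le.
  by rewrite sumr_ge0// => i _; rewrite !mulr_ge0 ?exprn_ge0// ltW.
have : (1 - t * Q) * (psum c t * (1 - t * Q)) >= 0.
  by rewrite mulr_ge0// subr_ge0 ltW.
move: tJ psum_ge0; move: ((1 - t * Q) * (psum c t * (1 - t * Q))) (psum c t * (1 - t * Q)).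
by move: (D * (_ / _) ^+ _) (D * t ^+ _) => z u v w; lra.
Qed.

(** [a(t)] lies between two positive constants: the lower one holds since
    [A(t) a(t) >= m / (1 - t Q)] while [A(t) <= E / (1 - t Q)]. So [ln a(t)] is bounded, and it is
    within a constant of [psum b t]. *)
Lemma twist_bounded : exists C, forall t, 2^-1 <= t * Q -> t * Q < 1 -> `|psum b t| <= C.
Proof.
have [M aM] := a_bounded; have [m m0 cm] := c_psum_ge.
have [g a_exp [C gC]] := psum_log; have [E E0 AE] := A_growth.
have E1 : 1 <= E by have := AE 0; rewrite A0 normr1 expr0 mulr1.
exists (`|ln (m / E)| + `|ln M| + C) => t t2 tQ.
have t0 : 0 <= t.
  have : 0 < t * Q by apply: lt_le_trans t2; rewrite invr_gt0.
  by rewrite pmulr_lgt0// => /ltW.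
have tE : `|t| = t by rewrite ger0_norm.
have a_gt0 : 0 < psum a t by rewrite a_exp// expR_gt0.
have a_ge : m / E <= psum a t.
  rewrite ler_pdivrMr ?(lt_le_trans ltr01)//; apply: le_trans (cm t t2 tQ) _.
  have -> : psum c t = psum A t * psum a t.
    by apply: cvg_lim => //; apply: (@psum_conv _ Q) => //; rewrite tE.
  rewrite mulrAC [leRHS]mulrC ler_wpM2r ?(ltW a_gt0)//.
  rewrite -ler_pdivlMr ?subr_gt0//; apply: le_trans (ler_norm _) _.
  by rewrite -[X in 1 - X * _]tE; apply: psum_le => //; rewrite tE.
have mE : 0 < m / E by rewrite divr_gt0// (lt_le_trans ltr01).
have gE : psum g t = ln (psum a t) by rewrite a_exp// expRK.
have g_ge : ln (m / E) <= psum g t by rewrite gE ler_ln ?posrE.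
have g_le : psum g t <= ln M.
  by rewrite gE ler_ln ?posrE ?aM// (lt_le_trans a_gt0)// aM.
have := gC t t0 tQ; rewrite !ler_norml => /andP[g1 g2].
have := ler_norm (- ln (m / E)); rewrite normrN; have := ler_norm (ln M).
have := normr_ge0 (ln M); have := normr_ge0 (ln (m / E)).
move: g1 g2 g_ge g_le; lra.
Qed.

End Twist.

Lemma bernoulli_inequality (e : R) n : 0 <= e <= 1 -> 1 - n%:R * e <= (1 - e) ^+ n.
Proof.
move=> /andP[e0 e1]; elim: n => [|n IH]; first by rewrite mul0r subr0 expr0.
rewrite exprS; apply: (@le_trans _ _ ((1 - e) * (1 - n%:R * e))); last first.
  by rewrite ler_wpM2l// subr_ge0.
have : 0 <= n%:R * e * e by rewrite !mulr_ge0.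
by rewrite -natr1; lra.
Qed.

Lemma untwisted_unbounded M : exists2 t0, t0 * Q < 1 &
  forall t, t0 <= t -> t * Q < 1 -> M <= psum B t.
Proof.
have [||g A_exp [C gC]] := @psum_log A B A0 _ _ A_euler.
- by move=> k; rewrite ger0_norm.
- by move=> k; rewrite ger0_norm.
pose D := (A k0.+1 - A k0) / Q ^+ k0.+1.
have D0 : 0 < D by rewrite divr_gt0 ?subr_gt0// exprn_gt0.
(* Beyond the threshold, [N] terms of [A(t)] of size at least [D / 2] will exceed [exp(M + C)]. *)
pose N := Num.bound (expR (M + C) / D *+ 2); set n := (k0.+1 + N)%N.
have N_ge : expR (M + C) <= N%:R * D / 2.
  have : 0 <= expR (M + C) / D *+ 2 by rewrite mulrn_wge0// divr_ge0 ?expR_ge0// ltW.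
  move=> /archi_boundP; rewrite -/N => /ltW.
  by rewrite -mulr_natr mulrAC ler_pdivrMr// ler_pdivlMr.
have n0 : 0 < n%:R :> R by rewrite ltr0n.
(* For [t Q >= 1 - 1 / (2 n)], Bernoulli's inequality keeps [(t Q)^n] at least 1/2. *)
pose e : R := n%:R^-1 / 2.
have e0 : 0 < e by rewrite divr_gt0// invr_gt0.
have e1 : e <= 2^-1.
  by rewrite /e ler_piMl ?invr_ge0// invf_le1// ler1n.
exists ((1 - e) / Q); first by rewrite divfK ?gt_eqF// gtrBl.
move=> t; rewrite ler_pdivrMr// => et tQ.
have tQ0 : 0 < t * Q by apply: lt_le_trans et; move: e1; lra.
have t0 : 0 < t by move: tQ0; rewrite pmulr_lgt0.
have tE : `|t| = t by rewrite ger0_norm// ltW.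
have tn : 2^-1 <= (t * Q) ^+ n.
  have : 2^-1 <= (1 - e) ^+ n.
    apply: le_trans (bernoulli_inequality _ _); last by rewrite (ltW e0) (le_trans e1)// invf_le1// ler1n.
    by rewrite /e mulrA divff ?gt_eqF// mul1r; lra.
  by move/le_trans; apply; rewrite lerXn2r// nnegrE ?(ltW tQ0)//; move: e1; lra.
have A_le : expR (M + C) <= psum A t.
  have A_cvg : cvgn (pseries A t) by apply: growth_cvg Q_ge0 _ A_growth; rewrite tE.
  apply: le_trans (psum_ge_partial n (ltW t0) A_ge0 A_cvg).
  rewrite /n big_split_ord /= ler_wpDl//.
    by rewrite sumr_ge0// => i _; rewrite mulr_ge0// exprn_ge0// ltW.
  apply: (@le_trans _ _ (\sum_(i < N) D * (t * Q) ^+ n)).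
    rewrite sumr_const card_ord; apply: le_trans N_ge _.
    by rewrite -[leRHS]mulr_natl -[leLHS]mulrA ler_wpM2l// ler_pM2l.
  apply: ler_sum => i _; apply: (@le_trans _ _ (D * (t * Q) ^+ (k0.+1 + i))).
    by rewrite ler_pM2l// ler_wiXn2l ?(ltW tQ0) ?(ltW tQ)// /n leq_add2l ltnW.
  rewrite exprMn mulrCA mulrC ler_wpM2r ?exprn_ge0 ?(ltW t0)//.
  rewrite /D exprD mulrA divfK ?gt_eqF ?exprn_gt0//; rewrite addSn.
  exact: recurrence_ge.
move: A_le; rewrite A_exp ?(ltW t0)// ler_expR => MC.
have := gC t (ltW t0) tQ; rewrite ler_norml => /andP[_]; move: MC; lra.
Qed.

End AnalyticEstimates.

(** * Quadratic characters of the Picard group *)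

Section QuadraticCharacters.
Variables (F : finFieldType) (K : fieldType) (iota : {rmorphism F -> K}).
Variables (x : K) (n : nat) (b : 'I_n -> K).
Hypothesis x_trans : ~ algebraicOver iota x.
Hypothesis b_span : forall y : K,
  exists p q : 'I_n -> {poly F}, (forall i, q i != 0) /\
    y = \sum_(i < n) ev iota x (p i) / ev iota x (q i) * b i.
Hypothesis b_free : forall c : 'I_n -> {poly F},
  \sum_i ev iota x (c i) * b i = 0 -> forall i, c i = 0.
Implicit Types (p : place iota) (A D E : divisor iota).

Let degE := residue_deg_exists x_trans b_span.
Let div_M := div_ofM x_trans b_span.
Let div_V := div_ofV x_trans b_span.

Lemma even_placeP p : even_place p <->
  exists D z, z != 0 /\ << p >> = D *+ 2 + div_of iota z.
Proof.
split=> [[c pc]|[D [z [z0 pD]]]].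
  have cE : c = divisor_class (repr c) by rewrite /divisor_class reprK.
  exists (repr c).
  have /asboolP[z z0 zE] : (<< p >> : divisor iota) - repr c *+ 2 \in @principal F K iota.
    rewrite Quotient.idealrBE; apply/eqP; rewrite -/(divisor_class _) pc cE.
    by rewrite [RHS](raddfMn (\pi_(Pic iota))%qT) /= reprK.
  exists z; split => //.
  by rewrite -(div_of_eq x_trans b_span z0 zE) addrC subrK.
exists (divisor_class D); rewrite /divisor_class -(raddfMn (\pi_(Pic iota))%qT).
apply/eqP; rewrite -Quotient.idealrBE pD addrC addrA addNr add0r.
by apply/asboolP; exists z => // q; rewrite (coeff_div_of x_trans b_span).
Qed.

Section Separation.
Variable p : place iota.
Hypothesis p_not_even : ~ even_place p.

Let good (H : set (divisor iota)) :=
  [/\ forall A D, H A -> H D -> H (A - D), forall D, H (D *+ 2),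
      forall z, z != 0 -> H (div_of iota z) & ~ H << p >>].

Let maximal_subgroup : exists H, good H /\ forall G, H `<` G -> ~ good G.
Proof.
have [|A [PA maxA]] := @Zorn_bigcup (divisor iota) (fun S => S !=set0 -> good S).
  move=> C CP Ctot [w [S CS Sw]].
  have Sg : good S by apply: CP => //; exists w.
  have g X u : C X -> X u -> good X by move=> CX Xu; apply: CP => //; exists u.
  have [SB S2 Sdiv Sp] := Sg; split.
  - move=> u v [U CU Uu] [V CV Vv]; case: (Ctot _ _ CU CV) => h.
      by exists V => //; have [VB _ _ _] := g _ _ CV Vv; apply: VB => //; apply: h.
    by exists U => //; have [UB _ _ _] := g _ _ CU Uu; apply: UB => //; apply: h.
  - by move=> D; exists S.
  - by move=> z z0; exists S => //; apply: Sdiv.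
  - by move=> [X CX Xp]; have [_ _ _] := g _ _ CX Xp.
pose S0 : set (divisor iota) := [set D | exists E z, z != 0 /\ D = E *+ 2 + div_of iota z].
have div1 : div_of iota 1 = 0.
  by apply: (@addrI _ (div_of iota 1)); rewrite -div_M ?oner_eq0// mulr1 addr0.
have S0g : good S0.
  split.
  - move=> _ _ [D [z [z0 ->]]] [E [w [w0 ->]]]; exists (D - E), (z / w).
    by rewrite mulf_neq0 ?invr_eq0// div_M ?invr_eq0// div_V// mulrnBl opprD addrACA.
  - by move=> D; exists D, 1; rewrite oner_eq0 div1 addr0.
  - by move=> z z0; exists 0, z; rewrite mul0rn add0r.
  - by move=> /even_placeP.
have A0 : A !=set0.
  apply/set0P/negP => /eqP A0; apply: (maxA S0) => [|_//].
  rewrite A0 properEneq; split => //; apply/eqP => S00.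
  by have [_ S02 _ _] := S0g; have := S02 0; rewrite -S00.
exists A; split; first exact: PA.
by move=> B AB gB; apply: (maxA B AB).
Qed.

(** A subgroup [H] maximal among those containing all doubles and principal divisors but not [p] has
    index 2; the character is [true] exactly outside [H]. *)
Lemma quad_char_separation : exists2 chi, quad_char chi & chi << p >>.
Proof.
have [H [[HB H2 Hdiv Hp] maxH]] := maximal_subgroup.
have H0 : H 0 by have := H2 0; rewrite mul0rn.
have HN A : H A -> H (- A) by rewrite -sub0r; apply: HB.
have HD A D : H A -> H D -> H (A + D) by rewrite -{2}[D]opprK => HA /HN; apply: HB.
have H_p D : ~ H D -> H (D - << p >>).
  (* For [D] outside [H], the union of [H] and [D + H] is a strictly larger subgroup, hence contains
     [p]. *)
  move=> HD'; pose G := [set A | H A \/ H (A - D)].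
  have HDD : H (D + D) by have := H2 D; rewrite mulr2n.
  have GP : G << p >>.
    apply/not_notP => GP; apply: (maxH G).
      rewrite properEneq; split; last by move=> A HA; left.
      apply/eqP => HG; apply: HD'; rewrite HG; right; by rewrite subrr.
    split => //; last by move=> z z0; left; apply: Hdiv.
      move=> A B [HA|HA] [HB'|HB'].
      - by left; apply: HB.
      - right; have -> : A - B - D = A - (B - D) - (D + D).
          by rewrite opprB opprD !addrA [A + D - B]addrAC addrK.
        by apply: (HB) => //; apply: (HB).
      - by right; rewrite addrAC; apply: HB.
      - by left; have := HB _ _ HA HB'; rewrite opprB addrA subrK.
    by move=> D'; left.
  by case: GP => [//|GP]; rewrite -opprB; apply: HN.
exists (fun D => ~~ `[< H D >]); last by apply/asboolPn.
split; last by move=> z z0; apply/negbF/asboolP/Hdiv.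
move=> A D; have [HA|HA] := asboolP (H A); have [HD'|HD'] := asboolP (H D).
- by apply/negbF/asboolP/HD.
- by apply/asboolPn => HAD; apply: HD'; have := HB _ _ HAD HA; rewrite addrAC subrr add0r.
- by apply/asboolPn => HAD; apply: HA; have := HB _ _ HAD HD'; rewrite addrK.
apply/negbF/asboolP; have -> : A + D = (A - << p >>) + (D - << p >>) + << p >> *+ 2.
  by rewrite mulr2n addrACA !subrK.
by apply: (HD) => //; apply: (HD); apply: H_p.
Qed.

End Separation.

Lemma quad_char_even chi p : quad_char chi -> even_place p -> chi << p >> = false.
Proof.
move=> chiP /even_placeP[D [z [z0 ->]]]; have [chiD chi0] := chiP.
by rewrite chiD (quad_charMn _ _ chiP) chi0.
Qed.

Variable dl : nat.
Hypothesis dl_gt0 : (0 < dl)%N.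
Hypothesis dl_deg : exists D : divisor iota, div_deg D = dl%:Z.
Hypothesis dl_dvd : forall D : divisor iota, exists k : int, div_deg D = k * dl%:Z.

(* A character is determined by its values on effective divisors of bounded
   degree, because every divisor of large degree is equivalent to an effective one. *)
Lemma finite_quad_char : finite_set [set chi : divisor iota -> bool | quad_char chi].
Proof.
have [g [N gN]] := riemann x_trans b_span b_free; have [D1 D1d] := dl_deg.
pose M := `|N|%N + `|g|%N.
pose T := D1 |` [set D : divisor iota | effective D /\ div_deg D <= (M + dl).+1%:Z].
have finT : finite_set T.
  by rewrite finite_setU; split => //; exact: (finite_effective_le x_trans b_span).
pose r (chi : divisor iota -> bool) := [fset D in fset_set T | chi D]%fset.
suff r_inj : {in [set chi | quad_char chi] &, injective r}.
  rewrite -(eq_finite_set (inj_card_eq r_inj)).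
  apply: (@sub_finite_set _ _ [set` fpowerset (fset_set T)]) => // _ [chi _ <-] /=.
  by rewrite fpowersetE; apply/fsubsetP => D; rewrite !inE => /andP[].
move=> chi psi; rewrite !inE => chiP psiP rE.
have agree D : T D -> chi D = psi D.
  move=> TD; have := congr1 (fun A : {fset divisor iota} => D \in A) rE; rewrite /= !inE.
  by rewrite in_fset_set// mem_set.
apply/funext => D; have [k kD] := dl_dvd D.
(* The shift moves the degree into the range from [M + 1] to [M + dl], where Riemann's theorem gives
   an equivalent effective divisor, which lies in [T]. *)
pose l : int := (M %/ dl)%N.+1%:Z - k; pose E := D + D1 *~ l.
have E_deg : div_deg E = ((M %/ dl).+1 * dl)%N%:Z.
  by rewrite div_degD raddfMz /= D1d kD -mulrzl intz /l PoszM; ring.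
have ME : (M < (M %/ dl).+1 * dl)%N by rewrite -ltn_divLR.
have EM : ((M %/ dl).+1 * dl <= M + dl)%N by rewrite mulSn addnC leq_add2r leq_trunc_div.
have ellE : (ell E)%:Z = div_deg E - g.
  by apply: gN; rewrite E_deg; move: ME; rewrite /M; clear; lia.
have [z /(in_rr_nonzero x_trans b_span)[z0 rz]] : exists z, z \in rr_nonzero E.
  have : (0 < #|` rr_nonzero E|)%N.
    rewrite (card_rr_nonzero x_trans b_span) -ltnS prednK ?expn_gt0 ?(ltnW (card_finNzRing_gt1 F))//.
    rewrite -{1}[1%N](expn0 #|F|) ltn_exp2l ?card_finNzRing_gt1//.
    by move: ellE; rewrite E_deg; move: ME; rewrite /M; clear; lia.
  by rewrite cardfs_gt0 => /fset0Pn[z zE]; exists z.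
have eff_z : T (E + div_of iota z).
  right; split; first by apply/(rrE x_trans b_span E z0).
  rewrite div_degD (div_deg_principal x_trans b_span b_free z0) addr0 E_deg lez_nat.
  exact: leq_trans EM _.
have value c : quad_char c -> c D = c (E + div_of iota z) (+) (odd `|l| && c D1).
  move=> cP; have [cD c0] := cP; rewrite cD c0// addbF cD.
  have -> : c (D1 *~ l) = odd `|l| && c D1.
    by case: (l) => i; rewrite ?NegzE ?mulrNz ?(quad_charN _ cP) -pmulrn (quad_charMn _ _ cP) ?abszN.
  by rewrite addbK.
by rewrite !value// !agree//; left.
Qed.

Definition quad_chars : {fset divisor iota -> bool} :=
  fset_set [set chi : divisor iota -> bool | quad_char chi].

Lemma in_quad_chars chi : chi \in quad_chars <-> quad_char chi.
Proof.
by rewrite /quad_chars in_fset_set; [rewrite inE|exact: finite_quad_char].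
Qed.

Lemma quad_char_trivial : quad_char (fun _ : divisor iota => false).
Proof. by []. Qed.

Lemma quad_char_addb chi psi : quad_char chi -> quad_char psi ->
  quad_char (fun D => chi D (+) psi D).
Proof.
move=> [chiD chi0] [psiD psi0]; split=> [A D|z z0]; first by rewrite chiD psiD addbACA.
by rewrite chi0// psi0.
Qed.

(** If [p] is not even, adding a character that is [true] at [p] permutes the characters and changes
    the sign of the sum. *)
Lemma quad_char_orthogonality p :
  \sum_(chi <- quad_chars) sgb (chi << p >>) =
    if `[< even_place p >] then #|` quad_chars|%:Z else 0.
Proof.
case: asboolP => [pe|pne].
  rewrite (eq_big_seq (fun=> 1)) => [|chi /in_quad_chars chiP].
    by rewrite big_const_seq count_predT iter_addr addr0 natz.
  by rewrite quad_char_even.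
have [psi psiP psip] := quad_char_separation pne.
pose f (chi : divisor iota -> bool) D := chi D (+) psi D.
have fK : involutive f by move=> chi; apply/funext => D; rewrite /f addbK.
have f_perm : perm_eq (map f quad_chars) quad_chars.
  apply: uniq_perm; rewrite ?(map_inj_uniq (inv_inj fK)) ?fset_uniq//.
  have f_in chi : chi \in quad_chars -> f chi \in quad_chars.
    by move=> /in_quad_chars chiP; apply/in_quad_chars/quad_char_addb.
  move=> chi; apply/mapP/idP => [[c cX ->]|cX]; first exact: f_in.
  by exists (f chi); rewrite ?fK// f_in.
have : \sum_(chi <- quad_chars) sgb (chi << p >>) = - \sum_(chi <- quad_chars) sgb (chi << p >>).
  rewrite -{1}(perm_big _ f_perm) big_map -sumrN; apply: eq_bigr => chi _.
  by rewrite /f psip sgb_addb mulrN1.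
by lia.
Qed.

End QuadraticCharacters.

(** * Dirichlet density *)

Section Density.
Variables (F : finFieldType) (K : fieldType) (iota : {rmorphism F -> K}).
Variables (x : K) (n : nat) (b : 'I_n -> K).
Hypothesis x_trans : ~ algebraicOver iota x.
Hypothesis b_span : forall y : K,
  exists p q : 'I_n -> {poly F}, (forall i, q i != 0) /\
    y = \sum_(i < n) ev iota x (p i) / ev iota x (q i) * b i.
Hypothesis b_free : forall c : 'I_n -> {poly F},
  \sum_i ev iota x (c i) * b i = 0 -> forall i, c i = 0.
Variable dl : nat.
Hypothesis dl_gt0 : (0 < dl)%N.
Hypothesis dl_deg : exists D : divisor iota, div_deg D = dl%:Z.
Hypothesis dl_dvd : forall D : divisor iota, exists k : int, div_deg D = k * dl%:Z.
Variable R : realType.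
Implicit Types (p : place iota) (chi : divisor iota -> bool) (s t : R).

Let degE := residue_deg_exists x_trans b_span.
Let Q : R := (#|F| ^ dl)%N%:R.
Let triv : divisor iota -> bool := fun=> false.
Let cs chi k : R := (char_sum dl chi k)%:~R.
Let ps chi d : R := (place_sum dl chi d)%:~R.

Let trivP : quad_char triv. Proof. exact: quad_char_trivial. Qed.

Let Q2 : 2 <= Q.
Proof.
rewrite /Q ler_nat (leq_trans (card_finNzRing_gt1 F))//.
by rewrite -{1}[#|F|]expn1 leq_pexp2l// ltnW// card_finNzRing_gt1.
Qed.
Let Q_gt0 : 0 < Q. Proof. by apply: lt_le_trans Q2. Qed.
Let Q_ge0 : 0 <= Q. Proof. exact: ltW. Qed.

Let cs0 chi : quad_char chi -> cs chi 0 = 1.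
Proof. by move=> chiP; rewrite /cs (char_sum0 x_trans b_span). Qed.

Let cs_le chi k : `|cs chi k| <= cs triv k.
Proof.
rewrite /cs -intr_norm ler_int; apply: le_trans (ler_norm_sum _ _ _) _.
by apply: ler_sum => p _; rewrite /sgb; case: (chi _).
Qed.

Let cs_ge0 k : 0 <= cs triv k. Proof. exact: le_trans (cs_le triv k). Qed.

Let ps_le chi d : `|ps chi d| <= ps triv d.
Proof. by rewrite /ps -intr_norm ler_int; exact: place_sum_le. Qed.

Let ps_ge0 d : 0 <= ps triv d. Proof. exact: le_trans (ps_le triv d). Qed.

Let ps_cs d : ps triv d <= cs triv d.
Proof.
case: d => [|d]; last by rewrite ler_int (place_sum_le_char_sum x_trans b_span).
(* No place has degree 0, so [ps triv 0] is an empty sum. *)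
rewrite (@cs0 triv)// /ps /place_sum big_seq big1 ?ler01// => p.
rewrite (in_places_deg x_trans b_span) mul0n => /eqP p0.
by have := residue_deg_gt0 degE p; rewrite p0.
Qed.

Let cs_euler chi : quad_char chi -> euler_coef (cs chi) (ps chi) (ps triv).
Proof.
move=> chiP; apply: euler_coefP => k.
transitivity ((k%:Z * char_sum dl chi k)%:~R : R); first by rewrite intrM.
rewrite (char_sum_log_derivative x_trans b_span dl_gt0 dl_dvd)// raddf_sum.
apply: eq_bigr => d _; rewrite raddf_sum; apply: eq_bigr => j _.
by rewrite /=; case: ifP => _ //; rewrite !intrM; case: (odd j).
Qed.

Let k0_exists : exists k0, [/\ cs triv k0 < cs triv k0.+1,
  recurrence_from k0 (1 + Q) Q (cs triv) &
  forall chi, quad_char chi -> (exists D, chi D) -> recurrence_from k0 (- (1 + Q)) Q (cs chi)].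
Proof.
have [k0 [A_rec A_lt a_rec]] := char_sum_recurrence x_trans b_span b_free dl_gt0 dl_deg dl_dvd.
have QE : Q = (#|F| ^ dl)%N%:Z%:~R by rewrite /Q.
exists k0; split; first by rewrite ltr_int.
  by move=> k kk; rewrite /cs A_rec// rmorphB !rmorphM rmorphD rmorph1 /= QE.
move=> chi chiP chin k kk.
by rewrite /cs a_rec// rmorphB !rmorphM rmorphN rmorphD rmorph1 /= QE.
Qed.

Let ps_growth chi : growth Q (ps chi).
Proof.
have [k0 [A_lt A_rec _]] := k0_exists.
have [C C0 AC] := recurrence_growth Q2 cs_ge0 (ltW A_lt) A_rec.
exists C => // d; apply: le_trans (ps_le chi d) _; apply: le_trans (ps_cs d) _.
exact: le_trans (ler_norm _) (AC d).
Qed.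

Lemma ps_triv_unbounded M : exists2 y0, y0 < 1 &
  forall t, y0 <= t * Q -> t * Q < 1 -> M <= psum (ps triv) t.
Proof.
have [k0 [A_lt A_rec _]] := k0_exists.
have [t0 t0Q H] := untwisted_unbounded Q2 (cs0 trivP) cs_ge0 ps_ge0 ps_cs
  A_lt A_rec (cs_euler trivP) M.
by exists (t0 * Q) => // t tt tQ; apply: H => //; move: tt; rewrite ler_pM2r.
Qed.

Lemma ps_bounded chi : quad_char chi -> (exists D, chi D) ->
  exists C, forall t, 2^-1 <= t * Q -> t * Q < 1 -> `|psum (ps chi) t| <= C.
Proof.
move=> chiP chin; have [k0 [A_lt A_rec a_rec]] := k0_exists.
exact: (twist_bounded Q2 (cs0 trivP) cs_ge0 ps_ge0 ps_cs A_lt A_rec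
  (cs_euler trivP) (cs0 chiP) (cs_le chi) (ps_le chi) (cs_euler chiP)
  (a_rec _ chiP chin)).
Qed.

Lemma place_norm_powR p d s : residue_deg p = (d * dl)%N ->
  (place_norm p)%:R `^ (- s) = (Q `^ (- s)) ^+ d.
Proof.
move=> pd; rewrite (place_normE degE) pd mulnC expnM natrX -/Q.
by rewrite -powR_mulrn ?ltW// -powRrM mulrC powRrM powR_mulrn// powR_ge0.
Qed.

Let ind (S : set (place iota)) d : R := \sum_(p <- places_deg iota dl d) (`[< S p >] : nat)%:R.

(** Grouping the places by degree turns the unordered sum into a power series in [Q^(-s)];
    convergence allows its limit to be taken among the reals. *)
Lemma dirichlet_sumE (S : set (place iota)) s : cvgn (pseries (ind S) (Q `^ (- s))) ->
  dirichlet_sum S s = (psum (ind S) (Q `^ (- s)))%:E.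
Proof.
set t := Q `^ (- s) => cvgS.
pose G d := [set p : place iota | residue_deg p = (d * dl)%N].
pose f p : \bar R := if p \in S then ((place_norm p)%:R `^ (- s))%:E else 0%E.
have f0 p : (0 <= f p)%E by rewrite /f; case: ifP => // _; rewrite lee_fin powR_ge0.
have GT : \bigcup_d G d = setT.
  apply/seteqP; split=> // p _; have [d _ pd] := residue_deg_dvd x_trans b_span dl_gt0 dl_dvd p.
  by exists d.
have Gtriv : trivIset setT G.
  apply/trivIsetP => i j _ _ ij; apply/seteqP; split => // p [].
  by rewrite /G /= => -> /eqP; rewrite eqn_pmul2r// (negbTE ij).
rewrite /dirichlet_sum esum_mkcond -/f -GT nneseries_sum_bigcup//.
have GE d : (\esum_(p in G d) f p)%E = (ind S d * t ^+ d)%:E.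
  have finG : finite_set (G d).
    by apply: sub_finite_set (finite_places_le x_trans b_span (d * dl)) => q /= ->.
  rewrite esum_fset// fsbig_finite//= -/(places_deg iota dl d).
  rewrite /ind mulr_suml -sumEFin big_seq [RHS]big_seq; apply: eq_bigr => p.
  rewrite (in_places_deg x_trans b_span) => /eqP pd; rewrite /f (place_norm_powR _ pd).
  have -> : (p \in S) = `[< S p >] by apply/idP/asboolP; rewrite inE.
  by case: ifP => _; rewrite ?mul1r ?mul0r.
under eq_eseriesr do rewrite GE.
rewrite /psum -EFin_lim//; congr (limn _); apply/funext => N.
by rewrite /= /pseries /series /= sumEFin.
Qed.

Lemma psum_sum (I : Type) (r : seq I) (f : I -> nat -> R) t :
  (forall i, cvgn (pseries (f i) t)) ->
  pseries (fun k => \sum_(i <- r) f i k) t @ \oo --> \sum_(i <- r) psum (f i) t.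
Proof.
move=> fc; have -> : pseries (fun k => \sum_(i <- r) f i k) t =
    fun N => \sum_(i <- r) pseries (f i) t N.
  apply/funext => N; rewrite /pseries /series /= exchange_big; apply: eq_bigr => k _.
  by rewrite mulr_suml.
elim: r => [|i r IH]; first by rewrite big_nil; under eq_fun do rewrite big_nil; exact: cvg_cst.
by rewrite big_cons; under eq_fun do rewrite big_cons; apply: cvgD.
Qed.

Lemma bounded_sum (T : Type) (I : eqType) (r : seq I) (P : pred I) (f : I -> T -> R) (S : set T) :
  (forall i, i \in r -> P i -> exists C, forall y, S y -> `|f i y| <= C) ->
  exists C, forall y, S y -> `|\sum_(i <- r | P i) f i y| <= C.
Proof.
elim: r => [|i r IH] bd; first by exists 0 => y _; rewrite big_nil normr0.
have [|C CP] := IH; first by move=> j jr; apply: bd; rewrite inE jr orbT.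
have [Pi|nPi] := boolP (P i); last first.
  by exists C => y Sy; rewrite big_cons (negbTE nPi) CP.
have [D DP] := bd i (mem_head _ _) Pi; exists (D + C) => y Sy; rewrite big_cons Pi.
exact: le_trans (ler_normD _ _) (lerD (DP y Sy) (CP y Sy)).
Qed.

Let X := quad_chars iota.
Let even := [set p : place iota | even_place p].

Let card_X_gt0 : 0 < #|` X|%:R :> R.
Proof.
rewrite ltr0n cardfs_gt0; apply/fset0Pn; exists triv.
by apply/(in_quad_chars x_trans b_span b_free dl_gt0 dl_deg dl_dvd).
Qed.

Let ind_even d : ind even d = #|` X|%:R^-1 * \sum_(chi <- X) ps chi d.
Proof.
apply: (mulfI (lt0r_neq0 card_X_gt0)); rewrite mulVKf ?lt0r_neq0//.
rewrite /ps -raddf_sum /= /place_sum exchange_big /= mulr_sumr raddf_sum.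
apply: eq_bigr => p _; rewrite /=.
rewrite (quad_char_orthogonality x_trans b_span b_free dl_gt0 dl_deg dl_dvd).
by case: ifP => _; rewrite ?mulr1 ?mulr0.
Qed.

Let ind_setT : ind setT = ps triv.
Proof.
apply/funext => d; rewrite /ind /ps /place_sum raddf_sum; apply: eq_bigr => p _.
by rewrite asboolT.
Qed.

Let ind_cvg (S : set (place iota)) t : 0 <= t -> t * Q < 1 -> cvgn (pseries (ind S) t).
Proof.
move=> t0 tQ; have [C C0 psC] := ps_growth triv.
apply: (@growth_cvg _ Q) => //; first by rewrite ger0_norm.
exists C => // d; apply: le_trans (psC d); rewrite -ind_setT !ger0_norm ?sumr_ge0//.
apply: ler_sum => p _; have -> : `[< [set: place iota] p >] = true by exact: asboolT.
by rewrite ler_nat; case: asbool.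
Qed.

Let powR_QE s : Q `^ (- s) * Q = expR ((1 - s) * ln Q).
Proof.
rewrite -{2}[Q]powRr1// -powRD; last by rewrite lt0r_neq0// implybT.
by rewrite /powR gt_eqF// addrC.
Qed.

Let ratio s : 1 < s -> let t := Q `^ (- s) in
  fine (dirichlet_sum even s) / fine (dirichlet_sum [set: place iota] s) =
  #|` X|%:R^-1 * (\sum_(chi <- X) psum (ps chi) t) / psum (ps triv) t.
Proof.
move=> s1 t; have t0 : 0 <= t by exact: powR_ge0.
have tQ : t * Q < 1.
  by rewrite powR_QE expR_lt1 pmulr_llt0 ?subr_lt0// ln_gt0//; have := Q2; lra.
have ps_cvg chi : cvgn (pseries (ps chi) t).
  by apply: growth_cvg Q_ge0 _ (ps_growth chi); rewrite ger0_norm.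
rewrite !dirichlet_sumE; [|exact: ind_cvg..]; rewrite /= ind_setT; congr (_ / _).
apply: cvg_lim => //; have -> : pseries (ind even) t =
    fun N => #|` X|%:R^-1 * pseries (fun d => \sum_(chi <- X) ps chi d) t N.
  apply/funext => N; rewrite /pseries /series /= mulr_sumr; apply: eq_bigr => d _.
  by rewrite ind_even mulrA.
by apply: cvgMr; exact: psum_sum.
Qed.

Lemma even_density : has_dirichlet_density even (#|` X|%:R^-1 : R).
Proof.
have [C CP] : exists C, forall t, [set t | 2^-1 <= t * Q /\ t * Q < 1] t ->
    `|\sum_(chi <- X | chi != triv) psum (ps chi) t| <= C.
  apply: bounded_sum => chi /(in_quad_chars x_trans b_span b_free dl_gt0 dl_deg dl_dvd) chiP.
  move=> chi_neq; have [|D DP] := ps_bounded chiP; last by exists D => t [t2 tQ]; exact: DP.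
  apply/not_notP => H; move/eqP: chi_neq; apply; apply/funext => D.
  by apply/negbTE/negP => chiD; apply: H; exists D.
have C_ge0 : 0 <= C.
  apply: le_trans (CP (2^-1 / Q) _); first exact: normr_ge0.
  by rewrite /= divfK ?gt_eqF//; split => //; lra.
(* The trivial character contributes exactly the density, and the others at most
   [C / psum (ps triv) t], which is below [e] once the denominator exceeds [M]. *)
apply/cvgrPdist_le => e e0; pose M := C / e + 1.
have M0 : 0 < M by rewrite ltr_wpDl// divr_ge0// ltW.
have [y y1 yM] := ps_triv_unbounded M; pose y0 := Num.max y 2^-1.
have y0_gt0 : 0 < y0 by rewrite lt_max invr_gt0 ltr0n orbT.
have y0_lt1 : y0 < 1 by rewrite gt_max y1 /=; lra.
have lnQ : 0 < ln Q by rewrite ln_gt0//; have := Q2; lra.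
(* As [t Q = Q^(1 - s)], the condition [y0 <= t Q] amounts to this upper bound on [s]. *)
have eta0 : 1 < 1 - ln y0 / ln Q.
  by rewrite ltrBrDr gtrDl pmulr_llt0 ?invr_gt0// ln_lt0// y0_gt0.
near=> s; have s1 : 1 < s by near: s; exact: nbhs_right_gt.
have s2 : s < 1 - ln y0 / ln Q by near: s; exact: nbhs_right_lt.
rewrite ratio//; set t := Q `^ (- s).
have ty : y0 <= t * Q.
  rewrite powR_QE -[leLHS](lnK (x := y0)) ?posrE// ler_expR -ler_pdivrMr//; move: s2; lra.
have tQ : t * Q < 1 by rewrite powR_QE expR_lt1 pmulr_llt0 ?subr_lt0.
have [ty1 ty2] : y <= t * Q /\ 2^-1 <= t * Q.
  by split; apply: le_trans ty; rewrite le_max lexx ?orbT.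
have B_ge := yM t ty1 tQ; have B0 := lt_le_trans M0 B_ge.
rewrite (bigD1_seq triv) ?fset_uniq//=; last first.
  by apply/(in_quad_chars x_trans b_span b_free dl_gt0 dl_deg dl_dvd).
have := CP t (conj ty2 tQ); set r := \sum_(_ <- _ | _) _ => rC.
rewrite mulrDr mulrDl mulfK ?gt_eqF// opprD addrA subrr add0r normrN !normrM normfV.
rewrite normfV (ger0_norm (ltW B0)) (ger0_norm (ltW card_X_gt0)) ler_pdivrMr//.
apply: (@le_trans _ _ C).
  apply: le_trans rC; rewrite ler_piMl//.
  by rewrite invf_le1// ler1n -(ltr0n R).
rewrite mulrC -ler_pdivrMr//; apply: le_trans B_ge; rewrite lerDl ler01//.
Unshelve. all: by end_near.
Qed.

End Density.

(** A relation with [c i0 != 0] expresses [b i0] by the other elements, so the family could be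
    shortened. *)
Lemma minimal_span_free (F : finFieldType) (K : fieldType) (iota : {rmorphism F -> K})
    (x : K) (n : nat) (b : 'I_n -> K) :
  let spans m (b' : 'I_m -> K) := forall y : K,
    exists p q : 'I_m -> {poly F}, (forall i, q i != 0) /\
      y = \sum_(i < m) ev iota x (p i) / ev iota x (q i) * b' i in
  ~ algebraicOver iota x -> spans n b -> (forall m b', spans m b' -> (n <= m)%N) ->
  forall c : 'I_n -> {poly F}, \sum_i ev iota x (c i) * b i = 0 -> forall i, c i = 0.
Proof.
move=> spans x_trans; case: n b => [|n] b b_span n_min c c0 i0; first by case: i0.
apply/eqP/negPn/negP => ci0; have := n_min n (fun j => b (fintype.lift i0 j)).
rewrite ltnn => H; suff : false by []; apply: H => y.
have [p [q [q0 ->]]] := b_span y.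
have ev0 f : f != 0 -> ev iota x f != 0 by exact: transcendental_ev_neq0.
exists (fun j => p (fintype.lift i0 j) * q i0 * c i0 - p i0 * c (fintype.lift i0 j) * q (fintype.lift i0 j)).
exists (fun j => q (fintype.lift i0 j) * q i0 * c i0); split=> [j|].
  by rewrite !mulf_neq0.
have bi0 : b i0 = - (\sum_(j < n) ev iota x (c (fintype.lift i0 j)) * b (fintype.lift i0 j)) /
    ev iota x (c i0).
  apply: (mulIf (ev0 _ ci0)); rewrite divfK ?ev0// mulrC.
  by apply/eqP; rewrite -addr_eq0; apply/eqP; rewrite -[RHS]c0 [RHS](bigD1_ord i0).
rewrite (bigD1_ord i0)//= bi0 mulNr mulrN mulr_suml mulr_sumr -sumrN -big_split.
apply: eq_bigr => j _ /=; rewrite rmorphB !rmorphM /=.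
by field; rewrite !ev0.
Qed.

Theorem theorem4p3 (R : realType) (F : finFieldType) (K : fieldType)
    (iota : {rmorphism F -> K}) (odd_char : 2%N \notin [pchar F])
    (K_function_field : function_field iota) :
  exists2 d : R, 0 < d & has_dirichlet_density [set p : place iota | even_place p] d.
Proof.
have [x [x_trans [n0 [b0 b0_span]]]] := K_function_field.
pose spans n := `[< exists b : 'I_n -> K, forall y : K,
  exists p q : 'I_n -> {poly F}, (forall i, q i != 0) /\
    y = \sum_(i < n) ev iota x (p i) / ev iota x (q i) * b i >].
have ex_n : exists n, spans n.
  exists n0; apply/asboolP; exists b0 => y; have [p [q [q0 yE]]] := b0_span y.
  by exists p, q; split=> //; rewrite yE; apply: eq_bigr => i _; rewrite !evE.
case: (ex_minnP ex_n) => n /asboolP[b b_span] n_min.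
have b_free : forall c : 'I_n -> {poly F},
    \sum_i ev iota x (c i) * b i = 0 -> forall i, c i = 0.
  apply: (minimal_span_free x_trans b_span) => m b' b'_span.
  by apply: n_min; apply/asboolP; exists b'.
have [dl [dl_gt0 dl_deg dl_dvd]] := period_exists x_trans b_span.
exists (#|` quad_chars iota|%:R^-1); last first.
  exact: (even_density x_trans b_span b_free dl_gt0 dl_deg dl_dvd).
rewrite invr_gt0 ltr0n cardfs_gt0; apply/fset0Pn; exists (fun=> false).
by apply/(in_quad_chars x_trans b_span b_free dl_gt0 dl_deg dl_dvd).
Qed.
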